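(* Let $v$ be an Archimedean place of $K$ and $\mathbf{n}=(n_1,\dots,n_s)\in\mathbb{N}_+^s$, with $N=n_1+\cdots+n_s$. Then \[ \mu_v(\mathcal{C}_{\mathbf{n},v})^{1/d_v}\le c_vN^{2s-2}|\Delta_\mathbf{n}|_v,\qquad c_v=2^se^{sR_v}(2\pi R_v^s)^{s-1}|\Delta_\mathbf{1}|_v^{-1}, \] where $R_v=\max_{1\le i<j\le s}|\alpha_i-\alpha_j|_v$ and $\mathbf{1}=(1,\dots,1)$.
   Context: $\mathbb{N}_+$ denotes the positive integers. $K$ is a number field, $\alpha_1,\dots,\alpha_s\in K$ are distinct ($s\ge1$). For an Archimedean place $v$ given by an embedding $\sigma:K\hookrightarrow\mathbb{C}$, $|x|_v=|\sigma(x)|$, $K_v$ is the completion ($\mathbb{R}$ or $\mathbb{C}$, identified via $\sigma$), $d_v=[K_v:\mathbb{R}]$, and $\mu_v$ is Lebesgue measure on $K_v^s$ ($\mathbb{C}\cong\mathbb{R}^2$). For $\mathbf{n}\in\mathbb{N}^s$, $f_\mathbf{n}(z)=\prod_i(z-\alpha_i)^{n_i}$; for $h\in K[z]$, $h^\sigma$ is obtained by applying $\sigma$ to the coefficients; $\mathbf{e}_1,\dots,\mathbf{e}_s$ is the standard basis of $\mathbb{Z}^s$. For $\mathbf{n}\in\mathbb{N}_+^s$, $\Delta_\mathbf{n}=\prod_{i=1}^s\big((n_i-1)!\prod_{k\ne i}(\alpha_i-\alpha_k)^{n_k}\big)$, and $\mathcal{C}_{\mathbf{n},v}$ is the set of $(x_1,\dots,x_s)\in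 K_v^s$ with $|x_i|_v\le e^{R_v}(N-1)!$ for all $i$ (with $R_v=\max_{k,\ell}|\alpha_k-\alpha_\ell|_v$) and, for every $i\neq j$, $|x_ie^{\sigma(\alpha_j)-\sigma(\alpha_i)}-x_j|\le\max_{1\le k\le s}\big|\int_{\sigma(\alpha_i)}^{\sigma(\alpha_j)}f^\sigma_{\mathbf{n}-\mathbf{e}_k}(z)e^{\sigma(\alpha_j)-z}dz\big|$ (integral along the segment). *)

(* Defs.v *)
From HB Require Import structures.
From mathcomp Require Import all_boot all_order all_algebra all_field.
From mathcomp Require Import all_classical all_reals all_analysis.
From mathcomp Require Import complex.

Set Implicit Arguments.
Unset Strict Implicit.
Unset Printing Implicit Defensive.

Import Order.TTheory GRing.Theory Num.Theory.
Import numFieldNormedType.Exports.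

Local Open Scope classical_set_scope.
Local Open Scope ring_scope.

(* If f has a measurable left inverse g, the image measure by f is again
   sigma-finite. *)
Lemma sigma_finite_pushforward d1 d2 (T1 : measurableType d1)
    (T2 : measurableType d2) (R : realType)
    (m : {sigma_finite_measure set T1 -> \bar R}) (f : T1 -> T2) (g : T2 -> T1) :
  cancel f g -> measurable_fun setT g -> sigma_finite setT (pushforward m f).
Proof.
move=> fK mg; have [F UF Foo] := sigma_finiteT m.
exists (fun i => g @^-1` F i) => [|i].
  by rewrite -preimage_bigcup -UF preimage_setT.
have [mF mFoo] := Foo i; split; first by rewrite -[X in measurable X]setTI; exact: mg.
rewrite /pushforward (_ : f @^-1` _ = F i)//.
by apply/seteqP; split => x /=; rewrite fK.
Qed.

(* The product of two sigma-finite measures; the library only infers the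
   sigma-finite structure of m1 \x m2 for sub-probabilities. *)
Section sf_product.
Local Open Scope ereal_scope.
Context d1 d2 (T1 : measurableType d1) (T2 : measurableType d2) (R : realType).
Variable m1 : {sigma_finite_measure set T1 -> \bar R}.
Variable m2 : {sigma_finite_measure set T2 -> \bar R}.

Definition sf_product : set (T1 * T2) -> \bar R := m1 \x m2.

HB.instance Definition _ := Measure.on sf_product.

Let sf_product_sigma_finite : sigma_finite setT sf_product.
Proof.
have /sigma_finiteP[F [TF ndF Foo]] := sigma_finiteT m1.
have /sigma_finiteP[G [TG ndG Goo]] := sigma_finiteT m2.
exists (fun n => F n `*` G n).
  rewrite -setXTT TF TG predeqE => -[x y]; split.
    move=> [/= [n _ Fnx] [k _ Gky]]; exists (maxn n k) => //; split.
    - by move: x Fnx; exact/subsetPset/ndF/leq_maxl.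
    - by move: y Gky; exact/subsetPset/ndG/leq_maxr.
  by move=> [n _ []/= ? ?]; split; exists n.
move=> k; have [? ?] := Foo k; have [? ?] := Goo k.
split; first exact: measurableX.
by rewrite /sf_product product_measure1E// lte_mul_pinfty// ge0_fin_numE.
Qed.

HB.instance Definition _ := Measure_isSigmaFinite.Build _ _ _ sf_product
  sf_product_sigma_finite.

End sf_product.

Section tuple_measure.
Context d (T : measurableType d) (R : realType).
Variable mu : {sigma_finite_measure set T -> \bar R}.

Section cons_measure.
Variables (n : nat) (nu : {sigma_finite_measure set (n.-tuple T) -> \bar R}).

Definition cons_pair (p : T * n.-tuple T) : n.+1.-tuple T :=
  [tuple of p.1 :: p.2].

Definition cons_measure : set (n.+1.-tuple T) -> \bar R :=
  pushforward (sf_product mu nu) cons_pair.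

Let mcons : measurable_fun setT cons_pair.
Proof. exact: measurable_cons. Qed.

Let cons_measure0 : cons_measure set0 = 0%E.
Proof. by rewrite /cons_measure /pushforward preimage_set0 measure0. Qed.

Let cons_measure_ge0 A : (0 <= cons_measure A)%E.
Proof. exact: measure_ge0. Qed.

Let cons_measure_sigma_additive : semi_sigma_additive cons_measure.
Proof.
move=> F mF tF mUF; rewrite /cons_measure /pushforward preimage_bigcup.
apply: measure_semi_sigma_additive.
- by move=> i; rewrite -[X in measurable X]setTI; exact: mcons.
- apply/trivIsetP => /= i j _ _ ij; rewrite -preimage_setI.
  by move/trivIsetP : tF => /(_ _ _ _ _ ij) ->//; rewrite preimage_set0.
- by rewrite -preimage_bigcup -[X in measurable X]setTI; exact: mcons.
Qed.

HB.instance Definition _ := isMeasure.Build _ _ _ cons_measure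
  cons_measure0 cons_measure_ge0 cons_measure_sigma_additive.

Let cons_measure_sigma_finite : sigma_finite setT cons_measure.
Proof.
pose g (t : n.+1.-tuple T) : T * n.-tuple T := (thead t, [tuple of behead t]).
apply: (@sigma_finite_pushforward _ _ _ _ _ (sf_product mu nu) cons_pair g).
  by move=> [x t]; congr pair; apply/val_inj.
by apply: measurable_fun_pair; [exact: measurable_tnth|exact: measurable_behead].
Qed.

HB.instance Definition _ := Measure_isSigmaFinite.Build _ _ _ cons_measure
  cons_measure_sigma_finite.

End cons_measure.

Fixpoint tuple_measure n : {sigma_finite_measure set (n.-tuple T) -> \bar R} :=
  if n is m.+1 then cons_measure (tuple_measure m) else \d_([tuple] : 0.-tuple T).

End tuple_measure.

(* The completion of a number field at an Archimedean place, with the embedding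
   into the complex numbers by which it is identified with R or C, its Lebesgue
   measure and its degree over the reals. *)
Record arch_completion (R : realType) := ArchCompletion {
  ac_display : measure_display;
  ac_carrier : measurableType ac_display;
  ac_embed : ac_carrier -> R[i];
  ac_measure : {sigma_finite_measure set ac_carrier -> \bar R};
  ac_degree : nat
}.

Section completion.
Variable R : realType.

Definition real_completion : arch_completion R :=
  @ArchCompletion R _ (measurableTypeR R) (real_complex R)
    (@lebesgue_measure R) 1.

Definition complex_completion : arch_completion R :=
  @ArchCompletion R _ (measurableTypeR R * measurableTypeR R)%type
    (fun p => Complex p.1 p.2) (sf_product (@lebesgue_measure R) (@lebesgue_measure R)) 2.

Definition cexp (z : R[i]) : R[i] :=
  Complex (expR (complex.Re z) * cos (complex.Im z))
          (expR (complex.Re z) * sin (complex.Im z)).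

Definition cintegral01 (g : R -> R[i]) : R[i] :=
  Complex (Rintegral lebesgue_measure `[0, 1] (fun t => complex.Re (g t)))
          (Rintegral lebesgue_measure `[0, 1] (fun t => complex.Im (g t))).

Definition segment_integral (a b : R[i]) (g : R[i] -> R[i]) : R[i] :=
  cintegral01 (fun t => g (a + real_complex R t * (b - a)) * (b - a)).

End completion.

Section place.
Variables (R : realType) (K : fieldExtType rat) (sigma : {rmorphism K -> R[i]}).

Definition real_place : Prop := forall x : K, complex.Im (sigma x) = 0.

Definition completion : arch_completion R :=
  if `[< real_place >] then real_completion R else complex_completion R.

Definition K_v : measurableType _ := ac_carrier completion.
Definition of_K_v : K_v -> R[i] := @ac_embed R completion.
Definition d_v : nat := ac_degree completion.
Definition mu_v s : {sigma_finite_measure set (s.-tuple K_v) -> \bar R} :=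
  tuple_measure (ac_measure completion) s.

Definition abs_v (x : K) : R := Normc.normc (sigma x).

Section points.
Variables (s : nat) (alpha : 'I_s -> K).
Implicit Types n : 'I_s -> nat.

(* For s = 1 this is 0, also with the convention that the maximum over the empty
   set of pairs i < j is 0. *)
Definition R_v : R :=
  \big[Num.max/0]_(k < s) \big[Num.max/0]_(l < s) abs_v (alpha k - alpha l).

Definition f_poly n : {poly K} := \prod_(i < s) ('X - (alpha i)%:P) ^+ n i.

(* n - e_k; only used for n with positive entries, where the truncated
   subtraction is the usual one. *)
Definition sub_basis n (k : 'I_s) : 'I_s -> nat := fun i => (n i - (i == k))%N.

Definition Delta n : K :=
  \prod_(i < s) (((n i).-1)`!%:R *
                 \prod_(k < s | k != i) (alpha i - alpha k) ^+ n k).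

Definition exp_integral n (i j k : 'I_s) : R[i] :=
  segment_integral (sigma (alpha i)) (sigma (alpha j)) (fun z =>
    (map_poly sigma (f_poly (sub_basis n k))).[z] * cexp (sigma (alpha j) - z)).

Definition C_set n : set (s.-tuple K_v) :=
  [set x |
    (forall i, Normc.normc (of_K_v (tnth x i)) <=
               expR R_v * ((\sum_(l < s) n l)%N.-1)`!%:R) /\
    (forall i j, i != j ->
       Normc.normc (of_K_v (tnth x i) * cexp (sigma (alpha j) - sigma (alpha i))
                    - of_K_v (tnth x j)) <=
       \big[Num.max/0]_(k < s) Normc.normc (exp_integral n i j k))].

Definition c_v : R :=
  2 ^+ s * expR (s%:R * R_v) * (2 * pi * R_v ^+ s) ^+ (s - 1) *
  (abs_v (Delta (fun=> 1%N)))^-1.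

End points.
End place.

Arguments C_set {R K} sigma {s} alpha n.

(* Main.v *)
Require Import Defs.
From mathcomp Require Import all_boot all_order all_algebra all_field.
From mathcomp Require Import all_classical all_reals all_analysis.
From mathcomp Require Import complex.
From mathcomp Require Import ring lra zify.

Set Implicit Arguments.
Unset Strict Implicit.
Unset Printing Implicit Defensive.

Import Order.TTheory GRing.Theory Num.Theory.
Import numFieldNormedType.Exports.
Import measurable_realfun.

Local Open Scope classical_set_scope.
Local Open Scope ring_scope.

(** Write m_k = n_k - 1, M = sum_k m_k, f = prod_k (X - a_k)^m_k and let P be the
    numerator of f'/f = sum_k m_k / (X - a_k), of degree s - 1. Its roots b_j satisfy
    prod_j |f(b_j)| = prod_k ((m_k / M)^m_k prod_(l <> k) |a_k - a_l|^m_k). Above the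
    segment from f(b) to 0, paths descend from b to roots of f. They stay in the
    convex hull of the a_k, and have length at most 2 M R, since along such a path
    f has constant argument, so that the path meets almost every line at most M
    times. Two descents from the same root b_j of P bound the integral between their
    end points by N R^s e^R |f(b_j)|, up to a constant. As the plane is connected and
    paths only branch at critical points, Kruskal's algorithm extracts from these
    links a spanning tree of {a_1, ..., a_s} using each b_j once. Retaining only the
    constraints of that tree, the volume is that of a triangular system of balls,
    and the product of the multinomial coefficient M! / prod_k m_k! and of
    prod_k (m_k / M)^m_k is at most 1. *)

(** * Complex numbers *)

(** A descent never exceeds the level of |f| at which it starts, so two roots of f are best joined
    through a saddle, and the natural bound for a link is the value |f(b_j)| there. Bounding all
    links by the largest such value would be too weak: only when every root of P is spent once, with
    multiplicity, does the product of the bounds become, up to a power of M, the resultant of f and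
    P, which is comparable with |Delta_n|. This forces the count of the branches at b_j against the
    multiplicity of b_j in P. Descents may run through further critical points, where the preimage
    to follow is not unique. They are therefore limits of discrete chains with an explicit modulus
    of continuity of exponent 1/M, and compactness takes the place of differential equations. No
    differentiability is available for them: lengths are those of inscribed polygons, and integrals
    are increments of a primitive Q(z) e^(b - z) with Q' - Q = g, which depend on the end points
    only. Of N^(2s-2), one half comes from the lengths of the s - 1 links, the other from (N-1)! /
    M!. *)

Local Notation normc := Normc.normc.

Section Normc.
Variable R : realType.
Implicit Types (z w : R[i]).

Lemma normc_ge0 z : 0 <= normc z.
Proof. by case: z => x y; rewrite /= sqrtr_ge0. Qed.

Lemma normcX z n : normc (z ^+ n) = normc z ^+ n.
Proof.
elim: n => [|n IH]; first by rewrite !expr0 Normc.normc1.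
by rewrite !exprS Normc.normcM IH.
Qed.

Lemma normc_eq0 z : (normc z == 0) = (z == 0).
Proof.
apply/eqP/eqP => [/Normc.eq0_normc //|->]; exact: Normc.normc0.
Qed.

Lemma normc_gt0 z : (0 < normc z) = (z != 0).
Proof. by rewrite lt0r normc_ge0 andbT normc_eq0. Qed.

Lemma normcBC z w : normc (z - w) = normc (w - z).
Proof. by rewrite -normcN opprB. Qed.

Lemma normc_prod (I : Type) (r : seq I) (P : pred I) (F : I -> R[i]) :
  normc (\prod_(i <- r | P i) F i) = \prod_(i <- r | P i) normc (F i).
Proof.
by apply: (big_morph (@normc R) (@Normc.normcM R)); exact: Normc.normc1.
Qed.

Lemma le_normc_sum (I : Type) (r : seq I) (P : pred I) (F : I -> R[i]) :
  normc (\sum_(i <- r | P i) F i) <= \sum_(i <- r | P i) normc (F i).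
Proof.
elim/big_ind2: _ => [|z x w y zx wy|//]; first by rewrite Normc.normc0.
exact: le_trans (le_normcD _ _) (lerD zx wy).
Qed.

Lemma normc_real (x : R) : normc x%:C%C = `|x|.
Proof. by rewrite /= expr0n addr0 sqrtr_sqr. Qed.

Lemma normc_nat n : normc (n%:R : R[i]) = n%:R.
Proof. by rewrite -(rmorph_nat (real_complex R)) normc_real ger0_norm. Qed.

Lemma normRe_le z : `|complex.Re z| <= normc z.
Proof.
case: z => x y /=; rewrite -sqrtr_sqr ler_wsqrtr // lerDl; exact: sqr_ge0.
Qed.

Lemma normIm_le z : `|complex.Im z| <= normc z.
Proof.
case: z => x y /=; rewrite -sqrtr_sqr ler_wsqrtr // lerDr; exact: sqr_ge0.
Qed.

Lemma normc_le_ReIm z : normc z <= `|complex.Re z| + `|complex.Im z|.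
Proof.
case: z => x y /=; rewrite -[leRHS]ger0_norm ?addr_ge0 // -sqrtr_sqr.
rewrite ler_wsqrtr // sqrrD !real_normK ?num_real // lerD2r lerDl.
by rewrite mulrn_wge0 // mulr_ge0.
Qed.

Lemma ReD z w : complex.Re (z + w) = complex.Re z + complex.Re w.
Proof. by case: z w => [? ?] []. Qed.

Lemma ImD z w : complex.Im (z + w) = complex.Im z + complex.Im w.
Proof. by case: z w => [? ?] []. Qed.

Lemma ReN z : complex.Re (- z) = - complex.Re z.
Proof. by case: z. Qed.

Lemma ImN z : complex.Im (- z) = - complex.Im z.
Proof. by case: z. Qed.

Lemma ReM z w : complex.Re (z * w) =
  complex.Re z * complex.Re w - complex.Im z * complex.Im w.
Proof. by case: z w => [? ?] []. Qed.

Lemma ImM z w : complex.Im (z * w) =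
  complex.Re z * complex.Im w + complex.Im z * complex.Re w.
Proof. by case: z w => [? ?] []. Qed.

Lemma Re_sum (I : Type) (r : seq I) (P : pred I) (F : I -> R[i]) :
  complex.Re (\sum_(i <- r | P i) F i) = \sum_(i <- r | P i) complex.Re (F i).
Proof. exact: (big_morph _ ReD). Qed.

Lemma le_normc_dist z w t : normc (z - t) <= normc (z - w) + normc (w - t).
Proof. by rewrite -[z - t](subrKA w); exact: le_normcD. Qed.

Lemma ler_dist_normc z w : `|normc z - normc w| <= normc (z - w).
Proof.
have H (x y : R[i]) : normc x <= normc y + normc (x - y).
  by rewrite -[X in normc X <= _](subrKC y) le_normcD.
by rewrite ler_norml; have := H z w; have := H w z; rewrite (normcBC w z); lra.
Qed.

Lemma normc_cexp z : normc (cexp z) = expR (complex.Re z).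
Proof.
case: z => a b; rewrite /cexp /= !exprMn -mulrDr cos2Dsin2 mulr1 sqrtr_sqr.
by rewrite ger0_norm // expR_ge0.
Qed.

Lemma normc_cexp_le z : normc (cexp z) <= expR (normc z).
Proof.
by rewrite normc_cexp ler_expR (le_trans _ (normRe_le z)) // ler_norm.
Qed.

(* The only compactness statement needed for curves (Tychonoff's theorem),
   phrased so that closed conditions on finitely many values of the curves pass
   to the cluster curve. *)
Lemma curve_cluster (zeta : nat -> R -> R[i]) (B : R) :
  (forall n u, normc (zeta n u) <= B) ->
  exists xi : R -> R[i], forall (us : seq R) (e : R) (n0 : nat), 0 < e ->
    exists2 n, (n0 <= n)%N & forall u, u \in us -> normc (zeta n u - xi u) < e.
Proof.
move=> zB.
pose T := fun _ : R * bool => (R : topologicalType).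
pose g (n : nat) (p : R * bool) : R :=
  if p.2 then complex.Re (zeta n p.1) else complex.Im (zeta n p.1).
have cK : compact [set f : prod_topology T | forall p, `[- B, B]%classic (f p)].
  exact: (@tychonoff _ T (fun _ => `[- B, B]%classic)
           (fun _ => @segment_compact _ _ _)).
have gK n p : `[- B, B]%classic (g n p).
  rewrite /= in_itv /= -ler_norml /g; case: p.2.
    exact: le_trans (normRe_le _) (zB _ _).
  exact: le_trans (normIm_le _) (zB _ _).
have [] := cK ((g : nat -> prod_topology T) @ \oo) _.
  by exists 0%N => // n _ p; exact: gK.
move=> h [_ hcl]; exists (fun u => Complex (h (u, true)) (h (u, false))).
move=> us e n0 e0.
have nb p : nbhs h [set f : prod_topology T | `|f p - h p| < e / 2].
  have : nbhs (proj p h) [set x : R | `|x - h p| < e / 2].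
    apply/nbhs_ballP; exists (e / 2) => /=; first by rewrite divr_gt0.
    by move=> x /=; rewrite /ball /= distrC.
  by move=> pU; exact: (@proj_continuous _ T p h _ pU).
have nbs : nbhs h [set f : prod_topology T | forall u, u \in us ->
    `|f (u, true) - h (u, true)| < e / 2 /\
    `|f (u, false) - h (u, false)| < e / 2].
  elim: us => [|u us IH]; first by apply: (@filterS _ (nbhs h) _ setT) => //; exact: filterT.
  apply: filterS (filterI (filterI (nb (u, true)) (nb (u, false))) IH).
  by move=> f [[f1 f2] f3] v; rewrite inE => /predU1P[-> //|]; exact: f3.
have [] := hcl [set f | exists2 n, (n0 <= n)%N & f = g n] _ _ nbs.
  by exists n0 => // n /= n0n; exists n.
move=> _ [[n n0n ->] /= gn]; exists n => // u /gn [h1 h2].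
apply: le_lt_trans (normc_le_ReIm _) _.
rewrite [e]splitr; apply: ltrD; move: h1 h2; rewrite /g /=;
by case: (zeta n u).
Qed.

End Normc.

(** * Paths above a segment *)

Section Lifts.
Variable R : realType.
Implicit Types (z w : R[i]) (p : {poly R[i]}).

Lemma poly_lipschitz p (B : R) : exists2 L : R, 0 <= L &
  forall z w, normc z <= B -> normc w <= B ->
    normc (p.[z] - p.[w]) <= L * normc (z - w).
Proof.
elim/poly_ind: p => [|p c [L L0 IH]].
  by exists 0 => // z w _ _; rewrite !horner0 subr0 Normc.normc0 mul0r.
have [K [K0 HK]] : exists K, 0 <= K /\ forall z, normc z <= B -> normc p.[z] <= K.
  exists (L * (2 * `|B|) + normc p.[0] + 0).
  split; first by rewrite !addr_ge0 ?mulr_ge0 // normc_ge0.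
  move=> z zB; have B0 : 0 <= B by apply: le_trans zB; exact: normc_ge0.
  have := IH z 0 zB; rewrite Normc.normc0 subr0 => /(_ B0) H.
  rewrite -[X in normc X <= _](subrK p.[0]) addr0.
  apply: le_trans (le_normcD _ _) _; rewrite lerD2r (le_trans H) //.
  by rewrite ler_wpM2l // (ger0_norm B0) (le_trans zB) // mulr2n mulrDl mul1r lerDl.
exists (L * `|B| + K); first by rewrite addr_ge0 // mulr_ge0.
move=> z w zB wB; rewrite !hornerE.
have -> : p.[z] * z + c - (p.[w] * w + c) = (p.[z] - p.[w]) * z + p.[w] * (z - w).
  by ring.
apply: le_trans (le_normcD _ _) _; rewrite !Normc.normcM mulrDl lerD //.
  rewrite mulrAC; apply: ler_pM; rewrite ?normc_ge0 // ?IH //.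
  exact: le_trans zB (ler_norm _).
by rewrite ler_wpM2r ?normc_ge0 // HK.
Qed.

Lemma exists_expr_le_prod (T : eqType) (s : seq T) (x : T -> R) :
  (forall y, y \in s -> 0 <= x y) -> s != [::] ->
  exists2 y, y \in s & x y ^+ size s <= \prod_(t <- s) x t.
Proof.
move=> x0 sn.
have [y ys ymin] : exists2 y, y \in s & forall t, t \in s -> x y <= x t.
  elim: s sn x0 => // a [|b s] IH _ x0.
    by exists a; rewrite ?mem_head // => t; rewrite inE => /eqP ->.
  have [//|y yt|y ys ymin] := IH; first by apply: x0; rewrite inE yt orbT.
  have [ay|ya] := leP (x a) (x y).
    exists a; rewrite ?mem_head // => t; rewrite inE => /predU1P[-> //|/ymin].
    exact: le_trans.
  exists y; first by rewrite inE ys orbT.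
  by move=> t; rewrite inE => /predU1P[->|/ymin //]; exact: ltW.
exists y => //.
have -> : x y ^+ size s = \prod_(t <- s) x y.
  by rewrite big_const_seq count_predT iter_mulr_1.
rewrite big_seq [leRHS]big_seq; apply: ler_prod => t ts.
by rewrite x0 // ymin.
Qed.

Section Monic.
Variables (f : {poly R[i]}) (M : nat).
Hypotheses (f_monic : f \is monic) (size_f : size f = M.+1) (M_gt0 : (0 < M)%N).

Lemma poly_sub_roots (c : R[i]) : exists2 s : seq R[i], size s = M &
  f - c%:P = \prod_(z <- s) ('X - z%:P).
Proof.
have sc : (size (- c%:P : {poly R[i]})%R < size f)%N.
  by rewrite size_polyN size_f (leq_ltn_trans (size_polyC_leq1 _)).
have [s sE] := closed_field_poly_normal (f - c%:P).
have lc : lead_coef (f - c%:P) = 1 by rewrite lead_coefDl // (monicP f_monic).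
exists s; last by rewrite sE lc scale1r.
have : size (f - c%:P) = M.+1 by rewrite size_polyDl.
by rewrite sE lc scale1r size_prod_XsubC => -[].
Qed.

(* The distances from z to the roots of f - c have product |f(z) - c|. *)
Lemma nearest_root z c (s : seq R[i]) : size s = M ->
  f - c%:P = \prod_(z <- s) ('X - z%:P) ->
  exists2 y, y \in s & normc (z - y) ^+ M <= normc (f.[z] - c).
Proof.
move=> sM sE.
have [||y ys yle] := @exists_expr_le_prod _ s (fun y => normc (z - y)).
- by move=> y _; exact: normc_ge0.
- by rewrite -size_eq0 sM -lt0n.
exists y => //; move: yle; rewrite sM => /le_trans -> //.
have -> : f.[z] - c = (f - c%:P).[z] by rewrite !hornerE.
by rewrite sE horner_prod normc_prod; apply: ler_prod => t _;
  rewrite normc_ge0 !hornerE.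
Qed.

(** One step of a chain: changing the value of f by delta costs a displacement of at most
    |delta|^(1/M), even next to a critical point. *)
Lemma exists_near_preimage z c :
  exists y, f.[y] = c /\ normc (z - y) ^+ M <= normc (f.[z] - c).
Proof.
have [s sM sE] := poly_sub_roots c.
have [y ys yle] := nearest_root z sM sE; exists y; split => //.
apply/eqP; rewrite -subr_eq0; have -> : f.[y] - c = (f - c%:P).[y] by rewrite !hornerE.
by rewrite sE -/(root _ _) root_prod_XsubC.
Qed.

(** Discrete connectedness. The walk climbs by at most h per step, so on its way beyond 3 M h it
    first reaches each level 3 h l, l <= M, at a value below 3 h l + h. The entries of [s] near
    these values lie in M + 1 disjoint windows of width 3 h, one too many for M entries. *)
Lemma bounded_near_finset (d : nat -> R) (h : R) (n : nat) (s : seq R) :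
  size s = M -> 0 < h -> d 0%N = 0 ->
  (forall k, (k < n)%N -> d k.+1 <= d k + h) ->
  (forall k, (k <= n)%N -> exists2 e, e \in s & `|d k - e| <= h) ->
  d n <= 3 * M%:R * h.
Proof.
move=> sM h0 d0 dS ds; rewrite leNgt; apply/negP => dn.
have P (l : 'I_M.+1) : exists j : 'I_M, 3 * h * l%:R - h <= s`_j < 3 * h * l%:R + 2 * h.
  have ex : exists k, (k <= n)%N && (3 * h * l%:R <= d k).
    exists n; rewrite leqnn (le_trans _ (ltW dn)) // mulrAC ler_wpM2r ?(ltW h0) //.
    by rewrite ler_wpM2l // ler_nat -ltnS.
  have [k /andP[kn kd] kmin] := ex_minnP ex.
  have dk : d k < 3 * h * l%:R + h.
    case: k kn kd kmin => [|k] kn kd kmin.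
      by rewrite d0 ltr_wpDl // !mulr_ge0 // ltW.
    apply: le_lt_trans (dS _ kn) _; rewrite ltrD2r ltNge; apply/negP => H.
    by have := kmin k; rewrite H (ltnW kn) ltnn => /(_ isT).
  have [e es de] := ds _ kn.
  have ie : (index e s < M)%N by rewrite -sM index_mem.
  exists (Ordinal ie); rewrite /= nth_index //.
  by move: de; rewrite ler_norml => /andP[]; lra.
have [j jP] := choice P.
have jinj : injective j.
  move=> l l' jj; apply/val_inj => /=.
  have H (a b : 'I_M.+1) : j a = j b -> ~~ (a < b)%N.
    move=> jab; apply/negP => ab; have := jP a; have := jP b; rewrite -jab.
    have : (a.+1)%:R <= b%:R :> R by rewrite ler_nat.
    by rewrite -natr1 -(ler_pM2l h0); lra.
  by apply/eqP; rewrite eqn_leq leqNgt (H _ _ (esym jj)) leqNgt (H _ _ jj).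
by have := leq_card _ jinj; rewrite !card_ord ltnn.
Qed.

Lemma exists_expr_root (x : R) : 0 <= x -> exists2 h : R, 0 <= h & h ^+ M = x.
Proof.
move=> x0; exists (x `^ M%:R^-1); first exact: powR_ge0.
by rewrite -powR_mulrn ?powR_ge0 // -powRrM mulVf ?powRr1 // pnatr_eq0 -lt0n.
Qed.

(** The walk in [chain_modulus] stays within 4 M h, where h is an M-th root; raising to the power M
    clears that root. *)
Definition lift_modulus : R := (4 * M%:R) ^+ M.

Lemma lift_modulus_ge0 : 0 <= lift_modulus.
Proof. by rewrite exprn_ge0 // mulr_ge0. Qed.

Section Chain.
Variables (z : R[i]) (n : nat).

(** A discrete lift: the value of f moves from f(z) to 0 in n equal steps, each new point being a
    preimage close to the previous one. *)
Lemma exists_chain : exists c : nat -> R[i], c 0%N = z /\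
  forall k, f.[c k] = (1 - k%:R / n%:R)%:C%C * f.[z] /\
            normc (c k - c k.+1) ^+ M <= normc f.[z] / n%:R.
Proof.
have [c cP] := choice (fun p : nat * R[i] =>
  exists_near_preimage p.2 ((1 - p.1.+1%:R / n%:R)%:C%C * f.[z])).
pose g := fix g (k : nat) : R[i] := if k is k'.+1 then c (k', g k') else z.
exists g; split => // k.
have gE j : f.[g j] = (1 - j%:R / n%:R)%:C%C * f.[z].
  case: j => [|j]; first by rewrite mul0r subr0 rmorph1 mul1r.
  by have [] := cP (j, g j).
split; first exact: gE.
have [_] := cP (k, g k); rewrite /= -/(g k) => /le_trans -> //.
rewrite gE -mulrBl Normc.normcM -rmorphB normc_real mulrC.
rewrite ler_wpM2l ?normc_ge0 //.
rewrite (_ : _ - _ = n%:R^-1) ?ger0_norm ?invr_ge0 //.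
by rewrite -natr1; ring.
Qed.

(** The bounds on single steps alone would add up badly. But between i and j the value of f stays
    within h^M of f(c i), so each point is within h of one of the M solutions of f = f(c i), and its
    distance to c i is within h of one of M fixed numbers. [bounded_near_finset] then confines the
    walk. *)
Lemma chain_modulus (c : nat -> R[i]) (i j : nat) :
  (forall k, f.[c k] = (1 - k%:R / n%:R)%:C%C * f.[z] /\
            normc (c k - c k.+1) ^+ M <= normc f.[z] / n%:R) ->
  (i <= j)%N ->
  normc (c j - c i) ^+ M <= lift_modulus * ((j - i)%:R / n%:R * normc f.[z]).
Proof.
move=> cP ij.
have [x0 n0] : 0 <= (j - i)%:R / n%:R * normc f.[z] /\ 0 <= n%:R^-1 :> R.
  by split; rewrite ?mulr_ge0 ?normc_ge0 ?invr_ge0.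
have [h h0 hM] := exists_expr_root x0.
have root_le t : 0 <= t -> t ^+ M <= (j - i)%:R / n%:R * normc f.[z] -> t <= h.
  by move=> t0; rewrite -hM ler_pXn2r.
have stepE k : (k < j - i)%N -> normc (c (i + k)%N - c (i + k).+1) <= h.
  move=> kji; apply: root_le; first exact: normc_ge0.
  have [_ /le_trans -> //] := cP (i + k)%N.
  rewrite mulrC ler_wpM2r ?normc_ge0 // ler_peMl // ler1n.
  exact: leq_ltn_trans kji.
have [s sM sE] := poly_sub_roots f.[c i].
suff : normc (c j - c i) <= 4 * M%:R * h.
  rewrite -hM -exprMn => H; rewrite ler_pXn2r ?nnegrE ?mulr_ge0 //; exact: normc_ge0.
pose d k := normc (c (i + k)%N - c i).
have -> : normc (c j - c i) = d (j - i)%N by rewrite /d subnKC.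
have d0 : d 0%N = 0 by rewrite /d addn0 subrr Normc.normc0.
have dS k : (k < j - i)%N -> d k.+1 <= d k + h.
  move=> kji; rewrite /d addnS (le_trans (le_normc_dist _ (c (i + k)%N) _)) //.
  by rewrite addrC lerD2l normcBC stepE.
move: h0; rewrite le_eqVlt => /predU1P[hE|h0].
  suff H k : (k <= j - i)%N -> d k <= 0.
    by rewrite -hE mulr0 H.
  elim: k => [|k IH] kji; first by rewrite d0.
  by rewrite (le_trans (dS _ kji)) // -hE addr0 IH // ltnW.
apply: le_trans (_ : 3 * M%:R * h <= _); last first.
  by rewrite ler_pM2r // ler_wpM2r // ler_nat.
apply: (@bounded_near_finset d h (j - i)%N [seq normc (y - c i) | y <- s]) => //.
  by rewrite size_map.
move=> k kji; have [y ys yle] := nearest_root (c (i + k)%N) sM sE.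
exists (normc (y - c i)); first exact: map_f.
apply: le_trans (ler_dist_normc _ _) _.
rewrite (_ : _ - _ - (_ - _) = c (i + k)%N - y); last by ring.
apply: root_le; first exact: normc_ge0.
apply: le_trans yle _; have [-> _] := cP (i + k)%N; have [-> _] := cP i.
rewrite -mulrBl Normc.normcM -rmorphB normc_real ler_wpM2r ?normc_ge0 //.
rewrite (_ : _ - _ = - (k%:R / n%:R)); last by rewrite natrD; ring.
by rewrite normrN ger0_norm ?mulr_ge0 // ler_wpM2r // ler_nat.
Qed.

End Chain.

End Monic.
End Lifts.

(** * Existence of lifts and compactness of the family of lifts *)

Section LiftExistence.
Variable R : realType.
Implicit Types (z w : R[i]) (p : {poly R[i]}).

Lemma ler_addM_eps (x y D : R) : 0 <= D ->
  (forall e : R, 0 < e -> e <= 1 -> x <= y + e * D) -> x <= y.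
Proof.
move=> D0 H; rewrite leNgt; apply/negP => yx.
have D1 : 0 < D + 1 by rewrite ltr_wpDl.
pose e := Num.min 1 ((x - y) / (2 * (D + 1))).
have e0 : 0 < e by rewrite lt_min ltr01 divr_gt0 ?subr_gt0 // mulr_gt0.
have e1 : e <= 1 by rewrite ge_min lexx.
have := H e e0 e1; apply/negP; rewrite -ltNge -ltrBrDl.
apply: le_lt_trans (_ : (x - y) / (2 * (D + 1)) * (D + 1) < _).
  by apply: ler_pM; rewrite ?(ltW e0) // ?lerDl // ge_min lexx orbT.
rewrite invfM mulrA -mulrA mulVf ?gt_eqF // mulr1; lra.
Qed.

Lemma exists_invrS_lt (e : R) : 0 < e -> exists n0, forall n, (n0 <= n)%N ->
  n.+1%:R^-1 < e.
Proof.
move=> e0; exists (Num.trunc e^-1) => n n0n.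
rewrite invf_plt ?posrE //.
have ei : 0 <= e^-1 by rewrite invr_ge0 ltW.
have /andP[_ /lt_le_trans] := truncn_itv ei; apply.
by rewrite ler_nat.
Qed.

Variables (f : {poly R[i]}) (M : nat).
Hypotheses (f_monic : f \is monic) (size_f : size f = M.+1) (M_gt0 : (0 < M)%N).

(* The explicit modulus of continuity makes the lifts a compact family. *)
Definition is_lift z a (zeta : R -> R[i]) := [/\ zeta 0 = z, zeta 1 = a,
  forall u : R, 0 <= u <= 1 -> f.[zeta u] = (1 - u)%:C%C * f.[z] &
  forall u v : R, 0 <= u <= 1 -> 0 <= v <= 1 ->
    normc (zeta u - zeta v) ^+ M <= lift_modulus R M * (`|u - v| * normc f.[z])].

(** f is proper: the M-th power of the distance from z to some root of f is at most |f(z)|. *)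
Lemma poly_preimage_bounded (C : R) : exists2 B : R, 0 <= B &
  forall z, normc f.[z] <= C -> normc z <= B.
Proof.
have [s sM sE] := poly_sub_roots f_monic size_f M_gt0 0.
exists (\sum_(y <- s) normc y + Num.max 1 C).
  by rewrite addr_ge0 ?le_max ?ler01 // sumr_ge0 // => y _; exact: normc_ge0.
move=> z fz; have [y ys] := nearest_root M_gt0 z sM sE; rewrite subr0 => yle.
have zy : normc (z - y) <= Num.max 1 C.
  have [zy1|zy1] := leP (normc (z - y)) 1; first by rewrite le_max zy1.
  rewrite le_max (le_trans _ (le_trans yle fz)) ?orbT //.
  by rewrite -[leLHS]expr1 ler_weXn2l // ltW.
rewrite -(subrKC y z); apply: le_trans (le_normcD _ _) (lerD _ zy).
rewrite (big_rem y ys) /= lerDl sumr_ge0 // => ? _; exact: normc_ge0.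
Qed.

(** The conditions of [is_lift] are closed and each involves at most two parameters, so they pass to
    a cluster curve. The errors 1/(n+1) let one statement serve for the step functions of chains
    ([exists_lift]) and for genuine lifts whose starting point varies ([lift_closed]). *)
Lemma lift_limit (zs : nat -> R[i]) z (zeta : nat -> R -> R[i]) :
  (forall n, normc (zs n - z) <= n.+1%:R^-1) ->
  (forall n, zeta n 0 = zs n) ->
  (forall n (u : R), 0 <= u <= 1 ->
    normc (f.[zeta n u] - (1 - u)%:C%C * f.[zs n]) <= n.+1%:R^-1 * normc f.[zs n]) ->
  (forall n (u v : R), 0 <= u <= 1 -> 0 <= v <= 1 ->
    normc (zeta n u - zeta n v) ^+ M <=
    lift_modulus R M * ((`|u - v| + n.+1%:R^-1) * normc f.[zs n])) ->
  exists2 xi, is_lift z (xi 1) xi & forall a, (forall n, zeta n 1 = a) -> xi 1 = a.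
Proof.
move=> zsz zeta0 zetaf zetaM.
have inv1 n : 0 < (n.+1%:R^-1 : R) <= 1 by rewrite invr_gt0 ltr0n invf_le1 // ler1n.
have [L L0 HL] := poly_lipschitz f (normc z + 1).
have zsB n : normc (zs n) <= normc z + 1.
  rewrite -(subrKC z (zs n)); apply: le_trans (le_normcD _ _) _.
  by rewrite lerD2l (le_trans (zsz n)) //; have /andP[] := inv1 n.
have fzs n : normc (f.[zs n] - f.[z]) <= L * n.+1%:R^-1.
  apply: le_trans (HL _ _ (zsB n) _) _; first by rewrite lerDl.
  by rewrite ler_wpM2l.
have [C C0 fzsC] : exists2 C : R, 0 <= C & forall n, normc f.[zs n] <= C.
  exists (normc f.[z] + L) => [|n]; first by rewrite addr_ge0 ?normc_ge0.
  rewrite -(subrKC f.[z] f.[zs n]); apply: le_trans (le_normcD _ _) _.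
  rewrite lerD2l (le_trans (fzs n)) // ler_piMr //; by have /andP[] := inv1 n.
have [B B0 HB] := poly_preimage_bounded (C + C).
have zetaB n (u : R) : 0 <= u <= 1 -> normc (zeta n u) <= B.
  move=> u01; apply: HB.
  rewrite -(subrK ((1 - u)%:C%C * f.[zs n]) f.[_]).
  apply: le_trans (le_normcD _ _) _; apply: lerD.
    rewrite (le_trans (zetaf _ _ u01)) // (le_trans _ (fzsC n)) //.
    by rewrite ler_piMl ?normc_ge0 //; have /andP[] := inv1 n.
  rewrite Normc.normcM normc_real (le_trans _ (fzsC n)) // ler_piMl ?normc_ge0 //.
  by rewrite ger0_norm; move: u01; lra.
pose zet n (u : R) := if (0 <= u <= 1) then zeta n u else 0.
have zetB n (u : R) : normc (zet n u) <= B.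
  by rewrite /zet; case: ifP => [/zetaB //|_]; rewrite Normc.normc0.
have [xi xiP] := curve_cluster zetB.
have xiE (us : seq R) (e : R) : (forall u, u \in us -> 0 <= u <= 1) -> 0 < e ->
    exists n, n.+1%:R^-1 < e /\ forall u, u \in us -> normc (zeta n u - xi u) < e.
  move=> us01 e0; have [n0 n0P] := exists_invrS_lt e0.
  have [n n0n nP] := xiP us e n0 e0; exists n; split; first exact: n0P.
  by move=> u uus; have := nP u uus; rewrite /zet us01.
have xiB (u : R) : 0 <= u <= 1 -> normc (xi u) <= B + 1.
  move=> u01; have [v|n [_ nu]] := @xiE [:: u] 1 _ ltr01.
    by rewrite inE => /eqP ->.
  rewrite -(subrKC (zeta n u) (xi u)); apply: le_trans (le_normcD _ _) _.
  by rewrite lerD ?zetaB // normcBC ltW // nu // mem_head.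
have eq_eps (a b : R[i]) (D : R) : 0 <= D ->
    (forall e : R, 0 < e -> e <= 1 -> normc (a - b) <= e * D) -> a = b.
  move=> D0 H; apply/eqP; rewrite -subr_eq0 -normc_eq0 eq_le normc_ge0 andbT.
  by apply: (ler_addM_eps D0) => e e0 e1; rewrite add0r H.
have u0 : 0 <= (0 : R) <= 1 by rewrite lexx ler01.
have u1 : 0 <= (1 : R) <= 1 by rewrite lexx ler01.
have us1 (u : R) : 0 <= u <= 1 -> forall v : R, v \in [:: u] -> 0 <= v <= 1.
  by move=> ? v; rewrite inE => /eqP ->.
have us2 (u u' : R) : 0 <= u <= 1 -> 0 <= u' <= 1 ->
    forall v : R, v \in [:: u; u'] -> 0 <= v <= 1.
  by move=> ? ? v; rewrite !inE => /orP[] /eqP ->.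
exists xi; last first.
  move=> a aP; apply: (@eq_eps _ _ 1) => // e e0 _.
  have [n [_ /(_ 1)]] := xiE _ _ (us1 _ u1) e0.
  by rewrite mem_head aP normcBC mulr1 => /(_ isT)/ltW.
split => //.
- apply: (@eq_eps _ _ 2) => // e e0 _.
  have [n [ne /(_ 0)]] := xiE _ _ (us1 _ u0) e0.
  rewrite mem_head zeta0 normcBC => /(_ isT) H.
  apply: (le_trans (le_normc_dist _ (zs n) _)); have := le_lt_trans (zsz n) ne; lra.
- move=> u u01; have [K K0 HK] := poly_lipschitz f (B + 1).
  apply: (@eq_eps _ _ (K + C + L)); first by rewrite !addr_ge0.
  move=> e e0 _; have [n [ne /(_ u)]] := xiE _ _ (us1 _ u01) e0.
  rewrite mem_head normcBC => /(_ isT) H.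
  have := HK _ _ (xiB u u01) (le_trans (zetaB n u u01) (_ : _ <= B + 1)).
  rewrite lerDl ler01 => /(_ isT) H1.
  apply: le_trans (le_normc_dist _ f.[zeta n u] _) _.
  rewrite !mulrDr -addrA; apply: lerD.
    by rewrite (le_trans H1) // mulrC ler_wpM2r // ltW.
  apply: le_trans (le_normc_dist _ ((1 - u)%:C%C * f.[zs n]) _) _.
  apply: lerD.
    rewrite (le_trans (zetaf n u u01)) //.
    by apply: ler_pM; rewrite ?normc_ge0 ?(ltW ne).
  rewrite -mulrBr Normc.normcM normc_real.
  apply: le_trans (_ : normc (f.[zs n] - f.[z]) <= _).
    rewrite ler_piMl ?normc_ge0 // ger0_norm; move: u01; lra.
  by rewrite (le_trans (fzs n)) // mulrC ler_wpM2r // ltW.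
- move=> u v u01 v01.
  (* The modulus concerns an M-th power of a distance; a Lipschitz constant of X^M on the range of
     these distances controls the error made by passing to the limit. *)
  have [K K0 HK] := poly_lipschitz ('X^M : {poly R[i]}) (B + B + (B + 1) + (B + 1)).
  pose D := K * 2 + lift_modulus R M * (`|u - v| * L + normc f.[z] + L).
  have K'0 := lift_modulus_ge0 R M.
  apply: (@ler_addM_eps _ _ D).
    by rewrite addr_ge0 ?mulr_ge0 ?addr_ge0 ?mulr_ge0 ?normc_ge0.
  move=> e e0 e1; have [n [ne xin]] := xiE _ _ (us2 _ _ u01 v01) e0.
  have Hu : normc (zeta n u - xi u) < e by apply: xin; rewrite mem_head.
  have Hv : normc (zeta n v - xi v) < e by apply: xin; rewrite !inE eqxx orbT.
  pose t : R := normc (xi u - xi v); pose r : R := normc (zeta n u - zeta n v).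
  have tB : t <= B + B + (B + 1) + (B + 1).
    rewrite (le_trans (le_normcD _ _)) // normcN.
    by have := xiB _ u01; have := xiB _ v01; lra.
  have rB : r <= B + B + (B + 1) + (B + 1).
    rewrite (le_trans (le_normcD _ _)) // normcN.
    by have := zetaB n _ u01; have := zetaB n _ v01; lra.
  have tr : `|t - r| <= e * 2.
    apply: le_trans (ler_dist_normc _ _) _.
    have -> : xi u - xi v - (zeta n u - zeta n v) =
              (xi u - zeta n u) + (zeta n v - xi v) by ring.
    by rewrite (le_trans (le_normcD _ _)) // (normcBC (xi u)); lra.
  have /HK : normc t%:C%C <= B + B + (B + 1) + (B + 1).
    by rewrite normc_real ger0_norm // normc_ge0.
  move=> /(_ r%:C%C); rewrite normc_real ger0_norm ?normc_ge0 // => /(_ rB).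
  rewrite !hornerXn -!rmorphXn -!rmorphB !normc_real => H.
  have {}H : t ^+ M <= r ^+ M + K * (e * 2).
    rewrite -lerBlDl (le_trans (ler_norm _)) // (le_trans H) //.
    by rewrite ler_wpM2l.
  apply: le_trans H _.
  have Hz := zetaM n u v u01 v01; rewrite -/r in Hz.
  have Hf : normc f.[zs n] <= normc f.[z] + L * e.
    rewrite -(subrKC f.[z] f.[zs n]) (le_trans (le_normcD _ _)) // lerD2l.
    by rewrite (le_trans (fzs n)) // ler_wpM2l // ltW.
  have Hm : (`|u - v| + n.+1%:R^-1) * normc f.[zs n] <=
            `|u - v| * normc f.[z] + e * (`|u - v| * L + normc f.[z] + L).
    apply: le_trans (_ : (`|u - v| + e) * (normc f.[z] + L * e) <= _).
      apply: ler_pM => //; rewrite ?normc_ge0 ?lerD2l ?(ltW ne) //.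
    have : L * e * e <= L * e by rewrite ler_piMr // mulr_ge0 // ltW.
    by lra.
  have {}Hz := le_trans Hz (ler_wpM2l K'0 Hm).
  by move: Hz; rewrite /D; lra.
Qed.

Lemma exists_lift z : exists a, exists zeta, is_lift z a zeta.
Proof.
have cP n := exists_chain f_monic size_f M_gt0 z n.+1.
have [c cE] := choice cP.
(* At time u the chain with n + 1 steps is read at the index floor(u (n+1)), an error of at most
   1/(n+1) in time. *)
pose k n (u : R) := Num.trunc (u * n.+1%:R).
have kP n (u : R) : 0 <= u <= 1 ->
    ((k n u)%:R / n.+1%:R : R) <= u < (k n u)%:R / n.+1%:R + n.+1%:R^-1.
  move=> /andP[u0 _]; have n0 : 0 < n.+1%:R :> R by rewrite ltr0n.
  have /andP[k1 k2] := truncn_itv (mulr_ge0 u0 (ltW n0)).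
  by rewrite ler_pdivrMr // k1 -[X in _ < _ + X]mul1r -mulrDl natr1 ltr_pdivlMr //.
have [||||xi xiL _] := @lift_limit (fun=> z) z (fun n u => c n (k n u)).
- by move=> n; rewrite subrr Normc.normc0 invr_ge0.
- move=> n; rewrite /k mul0r truncn0.
  by have [] := cE n.
- move=> n u u01; have [_ /(_ (k n u))[-> _]] := cE n.
  rewrite -mulrBl Normc.normcM -rmorphB normc_real ler_wpM2r ?normc_ge0 //.
  have aux (q i : R) : q <= u < q + i -> `|1 - q - (1 - u)| <= i.
    by rewrite ler_norml; lra.
  exact: aux (kP n u u01).
- move=> n u v u01 v01.
  wlog vu : u v u01 v01 / v <= u.
    have [vu|uv] := leP v u; first exact.
    by move/(_ v u v01 u01 (ltW uv)); rewrite normcBC distrC.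
  have kk : (k n v <= k n u)%N by rewrite le_truncn // ler_wpM2r.
  have [_ cn] := cE n.
  apply: le_trans (chain_modulus f_monic size_f M_gt0 cn kk) _.
  rewrite ler_wpM2l ?lift_modulus_ge0 // ler_wpM2r ?normc_ge0 //.
  rewrite natrB // mulrBl ger0_norm ?subr_ge0 //.
  have aux (q q' i : R) :
    q <= u < q + i -> q' <= v < q' + i -> q - q' <= u - v + i by lra.
  exact: aux (kP n u u01) (kP n v v01).
by exists (xi 1); exists xi.
Qed.

Lemma lift_closed z a (zs : nat -> R[i]) :
  (forall n, normc (zs n - z) <= n.+1%:R^-1) ->
  (forall n, exists zeta, is_lift (zs n) a zeta) -> exists zeta, is_lift z a zeta.
Proof.
move=> zsz /choice[zeta zetaP].
have [||||xi xiL xia] := @lift_limit zs z zeta; first exact: zsz.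
- by move=> n; have [? _ _ _] := zetaP n.
- move=> n u u01; have [_ _ /(_ u u01) -> _] := zetaP n.
  by rewrite subrr Normc.normc0 mulr_ge0 ?normc_ge0 // invr_ge0.
- move=> n u v u01 v01; have [_ _ _ /(_ u v u01 v01) /le_trans -> //] := zetaP n.
  rewrite ler_wpM2l ?lift_modulus_ge0 // ler_wpM2r ?normc_ge0 // lerDl invr_ge0.
  exact: ler0n.
exists xi; rewrite -(xia a) // => n; by have [_ ? _ _] := zetaP n.
Qed.

End LiftExistence.

(** * Number of nearby preimages of a value *)

Section Branching.
Variable R : realType.
Implicit Types (z w : R[i]) (p : {poly R[i]}).

Lemma normc_coef_prod_XsubC (ys : seq R[i]) (B : R) j : 1 <= B ->
  (forall y, y \in ys -> normc y <= B) ->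
  normc (\prod_(y <- ys) ('X - y%:P))`_j <= (2 * B) ^+ size ys.
Proof.
move=> B1; elim: ys j => [|y ys IH] j yB.
  by rewrite big_nil coef1 normc_nat lern1 leq_b1.
have {}IH j' : normc (\prod_(y <- ys) ('X - y%:P))`_j' <= (2 * B) ^+ size ys.
  by apply: IH => x xys; apply: yB; rewrite inE xys orbT.
rewrite big_cons mulrBl coefB coefXM coefCM /= exprS.
apply: le_trans (le_normcD _ _) _; rewrite normcN Normc.normcM.
have -> : 2 * B * (2 * B) ^+ size ys =
    B * (2 * B) ^+ size ys + B * (2 * B) ^+ size ys by ring.
have X0 : 0 <= (2 * B) ^+ size ys by rewrite exprn_ge0 // mulr_ge0 // (le_trans ler01).
apply: lerD.
  apply: le_trans (_ : (2 * B) ^+ size ys <= _); last by rewrite ler_peMl.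
  by case: (j == 0%N); rewrite ?Normc.normc0.
by apply: ler_pM; rewrite ?normc_ge0 // yB // mem_head.
Qed.

(** In a coefficient below the leading one, every term contains one of the small roots as a
    factor. *)
Lemma normc_coef_prod_XsubC_small (ys : seq R[i]) (d : R) j : 0 <= d <= 1 ->
  (forall y, y \in ys -> normc y <= d) -> (j < size ys)%N ->
  normc (\prod_(y <- ys) ('X - y%:P))`_j <= d * 2 ^+ size ys.
Proof.
move=> /andP[d0 d1]; elim: ys j => // y ys IH j yd /=; rewrite ltnS => jys.
have yd' x : x \in ys -> normc x <= d by move=> xys; apply: yd; rewrite inE xys orbT.
have X0 : 0 <= 2 ^+ size ys :> R by rewrite exprn_ge0.
rewrite big_cons mulrBl coefB coefXM coefCM exprS.
apply: le_trans (le_normcD _ _) _; rewrite normcN Normc.normcM.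
have -> : d * (2 * 2 ^+ size ys) = d * 2 ^+ size ys + d * 2 ^+ size ys by ring.
apply: lerD.
  case: j jys => [|j] jys; first by rewrite eqxx Normc.normc0 mulr_ge0.
  exact: IH.
apply: ler_pM; rewrite ?normc_ge0 //; first by rewrite yd // mem_head.
have := @normc_coef_prod_XsubC ys 1 j (lexx _); rewrite mulr1; apply => x xys.
exact: le_trans (yd' _ xys) d1.
Qed.

Section Monic.
Variables (f : {poly R[i]}) (M : nat).
Hypotheses (f_monic : f \is monic) (size_f : size f = M.+1) (M_gt0 : (0 < M)%N).

(** If q + 2 solutions of f = c lay within d of b, then f(b + X) - c would have a monic factor of
    degree q + 2 whose lower coefficients are O(d), the other factor being bounded. Its coefficient
    of order q + 1, on which c has no influence, would be at most D d. *)
Lemma locally_few_preimages b q : (f \Po ('X + b%:P))`_q.+1 != 0 ->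
  exists2 d : R, 0 < d & forall (xs : seq R[i]) c, uniq xs -> size xs = q.+2 ->
    (forall x, x \in xs -> normc (x - b) <= d /\ f.[x] = c) -> False.
Proof.
move=> cf0; have [L L0 HL] := poly_lipschitz f (normc b + 1).
have [B B0 HB] := poly_preimage_bounded f_monic size_f M_gt0
  (normc f.[b] + L + (normc f.[b] + L)).
pose D := (q.+2)%:R * (2 ^+ q.+2 * (2 * (B + normc b + 1)) ^+ M).
have B1 : 1 <= B + normc b + 1 by rewrite lerDr addr_ge0 ?normc_ge0.
have D0 : 0 < D.
  have B2 : 0 < 2 * (B + normc b + 1) by lra.
  by rewrite /D; do 2?apply: mulr_gt0; rewrite ?ltr0n ?exprn_gt0.
pose d := Num.min 1 (normc (f \Po ('X + b%:P))`_q.+1 / (2 * D)).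
have d0 : 0 < d.
  by rewrite lt_min ltr01 divr_gt0 ?normc_gt0 // mulr_gt0.
have d1 : d <= 1 by rewrite ge_min lexx.
exists d => // xs c uxs sxs xsP.
have fb : normc f.[b] <= normc f.[b] + L by rewrite lerDl.
have cC : normc c <= normc f.[b] + L.
  have [x xs0] : exists x, x \in xs by case: (xs) sxs => // x ? _; exists x; rewrite mem_head.
  have [xb <-] := xsP _ xs0; rewrite -(subrKC f.[b] f.[x]).
  have xbB : normc x <= normc b + 1.
    rewrite -(subrKC b x) (le_trans (le_normcD _ _)) // lerD2l.
    exact: le_trans xb d1.
  have H := HL _ _ xbB (_ : normc b <= normc b + 1).
  apply: le_trans (le_normcD _ _) _; rewrite lerD2l (le_trans (H _)) ?lerDl //.
  by rewrite ler_piMr // (le_trans xb).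
have [rs rsM rsE] := poly_sub_roots f_monic size_f M_gt0 c.
have rsP r : r \in rs -> f.[r] = c.
  rewrite -root_prod_XsubC -rsE /root !hornerE subr_eq0 => /eqP //.
have sub : {subset xs <= rs}.
  move=> x /xsP[_ fx]; rewrite -root_prod_XsubC -rsE /root !hornerE.
  by rewrite fx subrr.
have [rest prest] : exists rest, perm_eq rs (xs ++ rest).
  have /count_subseqP[t trs xst] x : (count_mem x xs <= count_mem x rs)%N.
    rewrite count_uniq_mem //; case: (boolP (x \in xs)) => // /sub.
    by rewrite -has_pred1 has_count.
  have [rest rE] := perm_to_subseq trs; exists rest.
  by rewrite (permPl rE) perm_cat2r perm_sym.
pose sh (r : R[i]) := r - b.
have shE (t : seq R[i]) : (\prod_(r <- t) ('X - r%:P)) \Po ('X + b%:P) =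
    \prod_(r <- map sh t) ('X - r%:P).
  elim: t => [|r t IH]; first by rewrite !big_nil comp_polyC.
  rewrite /= !big_cons comp_polyM IH; congr (_ * _).
  by rewrite comp_polyB comp_polyX comp_polyC /sh polyCB; ring.
have E : (f \Po ('X + b%:P))`_q.+1 =
    (\prod_(r <- map sh xs) ('X - r%:P) * \prod_(r <- map sh rest) ('X - r%:P))`_q.+1.
  rewrite -!shE -comp_polyM -big_cat /= -(perm_big _ prest) /= -rsE.
  by rewrite comp_polyB comp_polyC coefB coefC subr0.
have rB r : r \in rs -> normc (sh r) <= B + normc b + 1.
  move=> rrs; rewrite /sh (le_trans (le_normcD _ _)) // normcN.
  have : normc r <= B by apply: HB; rewrite rsP // (le_trans cC) // lerDl (le_trans _ fb) ?normc_ge0.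
  lra.
suff : normc (f \Po ('X + b%:P))`_q.+1 <= D * d.
  apply/negP; rewrite -ltNge.
  apply: le_lt_trans (_ : D * (normc (f \Po ('X + b%:P))`_q.+1 / (2 * D)) < _).
    by rewrite ler_pM2l // ge_min lexx orbT.
  have c0 : 0 < normc (f \Po ('X + b%:P))`_q.+1 by rewrite normc_gt0.
  rewrite invfM mulrCA [D * _]mulrA [D * _]mulrC mulfK ?gt_eqF //.
  by lra.
rewrite E coefM; apply: le_trans (le_normc_sum _ _ _) _.
have -> : D * d = \sum_(j < q.+2) (d * 2 ^+ q.+2 * (2 * (B + normc b + 1)) ^+ M).
  rewrite sumr_const card_ord -[RHS]mulr_natl /D.
  have aux (x y t u : R) : x * (y * t) * u = x * (u * y * t) by ring.
  exact: aux.
apply: ler_sum => j _; rewrite Normc.normcM; apply: ler_pM; rewrite ?normc_ge0 //.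
  have := @normc_coef_prod_XsubC_small (map sh xs) d j; rewrite size_map sxs.
  apply => //; first by rewrite (ltW d0).
  by move=> y /mapP[x /xsP[xd _] ->].
apply: le_trans (_ : (2 * (B + normc b + 1)) ^+ size (map sh rest) <= _).
  apply: normc_coef_prod_XsubC => // y /mapP[x xr ->]; apply: rB.
  by rewrite (perm_mem prest) mem_cat xr orbT.
rewrite size_map ler_weXn2l //; first by lra.
by rewrite -rsM (perm_size prest) size_cat leq_addl.
Qed.

End Monic.
End Branching.

(** * Ends of lifts and the points where lifts diverge *)

Section LiftTheory.
Variable R : realType.
Implicit Types (z w : R[i]) (p : {poly R[i]}).

(** In characteristic 0, the order of vanishing q of p' at b leaves a nonzero Taylor coefficient of
    p of order q + 1. *)
Lemma mup_deriv_coef_neq0 p b : p^`() != 0 ->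
  (p \Po ('X + b%:P))`_(mup b p^`()).+1 != 0.
Proof.
move=> p'0; set q := mup b _.
have /dvdpP[g gE] : ('X - b%:P) ^+ q %| p^`() by rewrite -mup_geq.
have gb : g.[b] != 0.
  apply/negP => /eqP gb0; have /factor_theorem[h hE] : root g b by rewrite /root gb0.
  have : ~~ (('X - b%:P) ^+ q.+1 %| p^`()) by rewrite -mup_leq.
  by rewrite gE hE -mulrA -exprS dvdp_mull.
have : ((p \Po ('X + b%:P))^`())`_q != 0.
  rewrite deriv_comp gE comp_polyM derivD derivX derivC addr0 mulr1.
  have -> : (('X - b%:P) ^+ q) \Po ('X + b%:P) = 'X^q :> {poly R[i]}.
    elim: (q) => [|k IH]; first by rewrite !expr0 comp_polyC.
    by rewrite !exprS comp_polyM IH comp_polyB comp_polyX comp_polyC addrK.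
  by rewrite coefMXn ltnn subnn -horner_coef0 horner_comp !hornerE.
by rewrite coef_deriv mulrn_eq0 negb_or.
Qed.

Section Monic.
Variables (f : {poly R[i]}) (M : nat).
Hypotheses (f_monic : f \is monic) (size_f : size f = M.+1) (M_gt0 : (0 < M)%N).

Lemma locally_injective b : f^`().[b] != 0 ->
  exists2 d : R, 0 < d & forall x y, normc (x - b) <= d -> normc (y - b) <= d ->
    f.[x] = f.[y] -> x = y.
Proof.
move=> fb; have f'0 : f^`() != 0 by apply: contraNneq fb => ->; rewrite horner0.
have := mup_deriv_coef_neq0 b f'0; rewrite mupNroot // => c0.
have [d d0 dP] := locally_few_preimages f_monic size_f M_gt0 c0.
exists d => // x y xb yb fxy; apply/eqP/negP => /negP xy.
apply: (dP [:: x; y] f.[y]) => //=; first by rewrite inE xy.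
by move=> t; rewrite !inE => /orP[] /eqP ->.
Qed.

Lemma lift_end z a zeta : is_lift f M z a zeta -> f.[a] = 0.
Proof.
move=> [_ <- /(_ 1) -> //]; last by rewrite lexx ler01.
by rewrite subrr rmorph0 mul0r.
Qed.

Lemma lift_continuous z a zeta (d : R) : is_lift f M z a zeta -> 0 < d ->
  exists2 e : R, 0 < e & forall u v : R, 0 <= u <= 1 -> 0 <= v <= 1 ->
    `|u - v| <= e -> normc (zeta u - zeta v) < d.
Proof.
move=> [_ _ _ zetaM] d0.
pose K := lift_modulus R M * normc f.[z] + 1.
have K0 : 0 < K by rewrite ltr_wpDl // mulr_ge0 ?lift_modulus_ge0 ?normc_ge0.
exists (d ^+ M / (2 * K)); first by rewrite divr_gt0 ?exprn_gt0 // mulr_gt0.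
move=> u v u01 v01 uv; rewrite -(@ltr_pXn2r _ M) ?nnegrE ?normc_ge0 ?(ltW d0) //.
apply: le_lt_trans (zetaM u v u01 v01) _.
apply: le_lt_trans (_ : K * `|u - v| < _).
  by rewrite mulrCA mulrC ler_wpM2r // /K lerDl.
apply: le_lt_trans (_ : K * (d ^+ M / (2 * K)) < _); first by rewrite ler_pM2l.
have dM : 0 < d ^+ M by rewrite exprn_gt0.
by rewrite invfM mulrCA [K * _]mulrA [K * _]mulrC mulfK ?gt_eqF //; lra.
Qed.

Lemma lift_const z a zeta : is_lift f M z a zeta -> f.[z] = 0 -> a = z.
Proof.
move=> [z0 z1 _ zetaM] fz.
have := zetaM 1 0; rewrite fz Normc.normc0 !mulr0 z0 z1 !lexx ler01 => /(_ isT isT).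
move=> H; apply/eqP; rewrite -subr_eq0 -normc_eq0.
have : normc (a - z) ^+ M == 0 by rewrite eq_le H exprn_ge0 ?normc_ge0.
by rewrite expf_eq0 M_gt0.
Qed.

(** The modulus keeps its form: the factor 1 - u by which the parameter is rescaled is the one in
    |f(zeta u)| = (1 - u) |f(z)|. *)
Lemma lift_rest z a zeta (u : R) : is_lift f M z a zeta -> 0 <= u < 1 ->
  is_lift f M (zeta u) a (fun v => zeta (u + (1 - u) * v)).
Proof.
move=> [z0 z1 zetaf zetaM] /andP[u0 u1].
have u01 : 0 <= u <= 1 by rewrite u0 ltW.
have w01 v : 0 <= v <= 1 -> 0 <= u + (1 - u) * v <= 1.
  move=> /andP[v0 v1]; have u'0 : 0 <= 1 - u by lra.
  have := mulr_ge0 u'0 v0; have := ler_wpM2l u'0 v1; lra.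
have E (v : R) : 1 - (u + (1 - u) * v) = (1 - v) * (1 - u) by ring.
split.
- by rewrite mulr0 addr0.
- by rewrite mulr1 subrKC.
- by move=> v v01; rewrite !zetaf ?w01 // E rmorphM mulrA.
- move=> v v' v01 v'01; apply: le_trans (zetaM _ _ (w01 _ v01) (w01 _ v'01)) _.
  rewrite zetaf // Normc.normcM normc_real (_ : _ - _ = (1 - u) * (v - v')); last by ring.
  by rewrite normrM le_eqVlt; apply/orP; left; apply/eqP; ring.
Qed.

(** Let t be the last time up to which the lifts agree. Just after t, f takes equal values at
    distinct points near zeta(t), so f is not locally injective there and f' vanishes. The tails are
    lifts from that point, and f does not vanish there because t < 1. *)
Lemma lift_divergence z a b zeta xi :
  is_lift f M z a zeta -> is_lift f M z b xi -> a != b ->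
  exists c, [/\ f^`().[c] = 0, f.[c] != 0, normc f.[c] <= normc f.[z],
    exists zeta', is_lift f M c a zeta' & exists xi', is_lift f M c b xi'].
Proof.
move=> Lz Lx ab; have [z0 z1 zf _] := Lz; have [x0 x1 xf _] := Lx.
have fz : f.[z] != 0.
  by apply: contraNneq ab => fz; rewrite (lift_const Lz fz) (lift_const Lx fz).
pose S := [set u : R | 0 <= u <= 1 /\ forall v, 0 <= v <= u -> zeta v = xi v].
have S0 : S 0.
  split=> [|v]; first by rewrite lexx ler01.
  by rewrite -eq_le => /eqP <-; rewrite z0 x0.
have Sub : has_ubound S by exists 1 => u [/andP[]].
have Ssup : has_sup S by split => //; exists 0.
set t := sup S.
have t0 : 0 <= t by apply: ub_le_sup.
have t1 : t <= 1 by apply: ge_sup; [exists 0|move=> u [/andP[]]].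
have t01 : 0 <= t <= 1 by rewrite t0.
have eq_lt v : 0 <= v -> v < t -> zeta v = xi v.
  move=> v0 vt; have [u [_ uP] vu] := sup_gt (ex_intro _ 0 S0) vt.
  by apply: uP; rewrite v0 ltW.
have eq_t : zeta t = xi t.
  move: t0; rewrite le_eqVlt => /predU1P[<-|t0]; first by rewrite z0 x0.
  apply/eqP; rewrite -subr_eq0 -normc_eq0 eq_le normc_ge0 andbT leNgt.
  apply/negP => d0; set d := normc _ in d0.
  have d2 : 0 < d / 2 by rewrite divr_gt0.
  have [e1 e10 e1P] := lift_continuous Lz d2.
  have [e2 e20 e2P] := lift_continuous Lx d2.
  pose v := Num.max 0 (t - Num.min e1 e2).
  have vt : v < t by rewrite gt_max t0 ltrBlDr ltrDl lt_min e10.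
  have v0 : 0 <= v by rewrite le_max lexx.
  have tv : t - Num.min e1 e2 <= v by rewrite le_max lexx orbT.
  have v01 : 0 <= v <= 1 by rewrite v0 (le_trans (ltW vt)).
  have tvE : `|t - v| = t - v by rewrite ger0_norm // subr_ge0 ltW.
  have H1 := e1P t v t01 v01; have H2 := e2P v t v01 t01.
  have me1 : Num.min e1 e2 <= e1 by rewrite ge_min lexx.
  have me2 : Num.min e1 e2 <= e2 by rewrite ge_min lexx orbT.
  have {}H1 : normc (zeta t - zeta v) < d / 2 by apply: H1; rewrite tvE; lra.
  have {}H2 : normc (xi v - xi t) < d / 2 by apply: H2; rewrite distrC tvE; lra.
  have := le_normc_dist (zeta t) (zeta v) (xi t).
  by rewrite -/d {2}(eq_lt _ v0 vt); lra.
have t_lt1 : t < 1.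
  rewrite lt_neqAle t1 andbT; apply: contraNneq ab => tE.
  by rewrite -z1 -x1 -tE eq_t.
have t01' : 0 <= t < 1 by rewrite t0.
have ft : f.[zeta t] = (1 - t)%:C%C * f.[z] by rewrite zf.
exists (zeta t); split.
- apply/eqP/negP => /negP f't; have [d d0 dP] := locally_injective f't.
  have [e1 e10 e1P] := lift_continuous Lz d0.
  have [e2 e20 e2P] := lift_continuous Lx d0.
  pose u := Num.min 1 (t + Num.min e1 e2).
  have tu : t < u by rewrite lt_min t_lt1 ltrDl lt_min e10.
  have u1 : u <= 1 by rewrite ge_min lexx.
  have ut : u <= t + Num.min e1 e2 by rewrite ge_min lexx orbT.
  suff : S u by move/(ub_le_sup Sub); rewrite -/t leNgt tu.
  split; first by rewrite u1 (le_trans t0 (ltW tu)).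
  move=> v /andP[v0 vu]; have [vt|tv] := ltP v t; first exact: eq_lt.
  have v01 : 0 <= v <= 1 by rewrite v0 (le_trans vu).
  have tvE : `|v - t| = v - t by rewrite ger0_norm // subr_ge0.
  have me1 : Num.min e1 e2 <= e1 by rewrite ge_min lexx.
  have me2 : Num.min e1 e2 <= e2 by rewrite ge_min lexx orbT.
  apply: dP.
  + by apply/ltW/e1P => //; rewrite tvE; lra.
  + by rewrite eq_t; apply/ltW/e2P => //; rewrite tvE; lra.
  + by rewrite zf ?xf.
- by rewrite ft mulf_neq0 // (fmorph_eq0 (real_complex R)) subr_eq0 gt_eqF.
- rewrite ft Normc.normcM normc_real ler_piMl ?normc_ge0 //.
  by rewrite ger0_norm; lra.
- by eexists; exact: lift_rest Lz t01'.
- by rewrite eq_t; eexists; exact: lift_rest Lx t01'.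
Qed.

(** Ends of lifts are roots of f, so some end in [A] occurs for infinitely many n, and [lift_closed]
    applies along that subsequence. *)
Lemma lift_closed_ends (A : pred R[i]) z (zs : nat -> R[i]) :
  (forall n, normc (zs n - z) <= n.+1%:R^-1) ->
  (forall n, exists a zeta, A a /\ is_lift f M (zs n) a zeta) ->
  exists a zeta, A a /\ is_lift f M z a zeta.
Proof.
move=> zsz H; apply: contrapT => nH.
have [rs rsM rsE] := poly_sub_roots f_monic size_f M_gt0 0.
have far (t : seq R[i]) : exists n0, forall n a zeta, a \in t -> A a ->
    (n0 <= n)%N -> ~ is_lift f M (zs n) a zeta.
  elim: t => [|a t [n0 n0P]]; first by exists 0%N.
  have [Aa|nAa] := boolP (A a); last first.
    exists n0 => n b zeta; rewrite inE => /predU1P[-> /idPn //|]; exact: n0P.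
  have [n1 n1P] : exists n1, forall n zeta, (n1 <= n)%N -> ~ is_lift f M (zs n) a zeta.
    apply: contrapT => nex.
    have sel k : exists n, (k <= n)%N /\ exists zeta, is_lift f M (zs n) a zeta.
      apply: contrapT => nsel; apply: nex; exists k => n zeta kn Ln; apply: nsel.
      by exists n; split => //; exists zeta.
    have [g gP] := choice sel.
    have [k|k|zeta Lz] := @lift_closed _ f M f_monic size_f M_gt0 z a (zs \o g).
    - have [kg _] := gP k; apply: le_trans (zsz _) _.
      by rewrite lef_pV2 ?posrE ?ltr0n // ler_nat.
    - by have [_] := gP k.
    by apply: nH; exists a, zeta.
  exists (maxn n0 n1) => n b zeta; rewrite inE geq_max => bt Ab /andP[n0n n1n].
  by case/predU1P: bt => [->|bt]; [exact: n1P|exact: n0P bt Ab n0n].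
have [n0 n0P] := far rs; have [a [zeta [Aa La]]] := H n0.
apply: (n0P n0 a zeta) => //; rewrite -root_prod_XsubC -rsE /root !hornerE.
by rewrite (lift_end La) subrr.
Qed.

(* On the segment from x to y the points with a lift ending in A and those with
   a lift ending outside A form two closed sets, so these sets meet. *)
Lemma lift_both_ends (A : pred R[i]) x y : f.[x] = 0 -> f.[y] = 0 ->
  A x -> ~~ A y ->
  exists z a b zeta xi, [/\ A a, ~~ A b, is_lift f M z a zeta & is_lift f M z b xi].
Proof.
move=> fx fy Ax Ay.
pose pt (t : R) := x + t%:C%C * (y - x).
have pt_dist t t' : normc (pt t - pt t') = `|t - t'| * normc (y - x).
  by rewrite /pt -normc_real -Normc.normcM rmorphB; congr normc; ring.
pose E (B : pred R[i]) := [set t : R | 0 <= t <= 1 /\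
  exists a zeta, B a /\ is_lift f M (pt t) a zeta].
have Ecl (B : pred R[i]) t : 0 <= t <= 1 ->
    (forall e, 0 < e -> exists t', E B t' /\ `|t' - t| <= e) -> E B t.
  move=> t01 H; split => //.
  have [k kP] : exists k, forall n : nat, exists t', E B t' /\ `|t' - t| <= k / n.+1%:R
      /\ k * normc (y - x) <= 1.
    exists (1 + normc (y - x))^-1 => n.
    have k0 : 0 < 1 + normc (y - x) by rewrite ltr_pwDl ?normc_ge0.
    have [|t' [Et' tt']] := H ((1 + normc (y - x))^-1 / n.+1%:R).
      by rewrite divr_gt0 ?invr_gt0 ?ltr0n.
    exists t'; split => //; split => //.
    by rewrite mulrC ler_pdivrMr // mul1r lerDr.
  have [g gP] := choice kP.
  apply: (@lift_closed_ends B (pt t) (pt \o g)).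
    move=> n; have [_ [gt k1]] := gP n; rewrite /= pt_dist.
    apply: le_trans (ler_wpM2r (normc_ge0 _) gt) _.
    by rewrite mulrAC ler_piMl // invr_ge0.
  by move=> n; have [[_ ?] _] := gP n.
have E0 : E A 0.
  split; first by rewrite lexx ler01.
  have [a [zeta La]] := exists_lift f_monic size_f M_gt0 (pt 0).
  exists a, zeta; split => //; have ptx : pt 0 = x by rewrite /pt rmorph0 mul0r addr0.
  by rewrite ptx in La; rewrite (lift_const La fx).
have E1 : E (predC A) 1.
  split; first by rewrite lexx ler01.
  have [a [zeta La]] := exists_lift f_monic size_f M_gt0 (pt 1).
  exists a, zeta; split => //; have pty : pt 1 = y by rewrite /pt rmorph1 mul1r subrKC.
  by rewrite pty in La; rewrite (lift_const La fy).
have Eor t : 0 <= t <= 1 -> E A t \/ E (predC A) t.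
  move=> t01; have [a [zeta La]] := exists_lift f_monic size_f M_gt0 (pt t).
  by case: (boolP (A a)) => Aa; [left|right]; split => //; exists a, zeta.
have Eub : has_ubound (E A) by exists 1 => u [/andP[]].
set t := sup (E A).
have t0 : 0 <= t by apply: ub_le_sup.
have t1 : t <= 1 by apply: ge_sup; [exists 0|move=> u [/andP[]]].
have t01 : 0 <= t <= 1 by rewrite t0.
have EAt : E A t.
  apply: Ecl => // e e0.
  have te : t - e < t by lra.
  have [u Eu tu] := sup_gt (ex_intro _ 0 E0) te.
  have ut := ub_le_sup Eub Eu.
  exists u; split => //; rewrite -/t in ut; rewrite ler_norml; lra.
have EBt : E (predC A) t.
  move: t1; rewrite le_eqVlt => /predU1P[->//|t1].
  apply: Ecl => // e e0.
  pose u := Num.min 1 (t + e).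
  have tu : t < u by rewrite lt_min t1 ltrDl e0.
  have u1 : u <= 1 by rewrite ge_min lexx.
  have ut : u <= t + e by rewrite ge_min lexx orbT.
  exists u; split; last by rewrite ger0_norm; lra.
  have [|/(ub_le_sup Eub)|//] := Eor u; first by rewrite u1 (le_trans t0 (ltW tu)).
  by rewrite -/t leNgt tu.
have [_ [a [zeta [Aa La]]]] := EAt; have [_ [b [xi [Ab Lb]]]] := EBt.
by exists (pt t), a, b, zeta, xi.
Qed.

(* Labels that agree below level |f(b)| can only split at b itself, into at most
   as many classes as there are preimages near b of a value near f(b). *)
Lemma lift_few_labels (T : eqType) (I : eqType) (al : I -> R[i]) (cl : I -> T)
    (s : seq I) b q :
  (f \Po ('X + b%:P))`_q.+1 != 0 -> f.[b] != 0 ->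
  (forall z i j, normc f.[z] < normc f.[b] ->
    (exists zeta, is_lift f M z (al i) zeta) ->
    (exists zeta, is_lift f M z (al j) zeta) -> cl i = cl j) ->
  (forall i, i \in s -> exists zeta, is_lift f M b (al i) zeta) ->
  uniq (map cl s) -> size s != q.+2.
Proof.
move=> cq fb low Ls ucl; apply/negP => /eqP sq.
have [d d0 dP] := locally_few_preimages f_monic size_f M_gt0 cq.
(* A common positive time at which all these finitely many lifts are still near b. *)
have [e [e0 e1 [zeta zP]]] : exists e : R, [/\ 0 < e, e < 1 &
    exists zeta : I -> R -> R[i], forall i, i \in s ->
      is_lift f M b (al i) (zeta i) /\ normc (zeta i e - b) < d].
  have [zeta zL] : exists zeta : I -> R -> R[i], forall i, i \in s ->
      is_lift f M b (al i) (zeta i).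
    have ex i : exists g, i \in s -> is_lift f M b (al i) g.
      by case: (boolP (i \in s)) => [/Ls[g]|_]; [exists g|exists (fun=> 0)].
    by have [zeta zP] := choice ex; exists zeta.
  suff [e [e0 e1 eP]] : exists e : R, [/\ 0 < e, e < 1 & forall u, 0 <= u <= e ->
      forall i, i \in s -> normc (zeta i u - b) < d].
    exists e; split => //; exists zeta => i si; split; first exact: zL.
    by apply: eP => //; rewrite lexx ltW.
  elim: (s) zL => [|i t IH] zL; first by exists 2^-1; split; [lra|lra|].
  have [|e [e0 e1 eP]] := IH; first by move=> j jt; apply: zL; rewrite inE jt orbT.
  have Li := zL i (mem_head _ _); have [z0 _ _ _] := Li.
  have [e' e'0 e'P] := lift_continuous Li d0.
  exists (Num.min e e'); split; rewrite ?lt_min ?gt_min ?e0 ?e1 //.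
  move=> u; rewrite le_min => /andP[u0 /andP[ue ue']] j.
  rewrite inE => /predU1P[->|jt]; last by apply: eP => //; rewrite u0.
  rewrite -z0; apply: e'P; rewrite ?lexx ?ler01 ?subr0 ?ger0_norm //.
  by rewrite u0 (le_trans ue) // ltW.
have e01 : 0 <= e < 1 by rewrite ltW.
have e01' : 0 <= e <= 1 by rewrite !ltW.
(* Distinct points at time e would be too many preimages near b. Two equal ones are a single point
   below the level of b with lifts to both ends, so [low] identifies two labels. *)
have [u|/(uniqPn b)] := boolP (uniq [seq zeta i e | i <- s]).
  apply: (dP _ ((1 - e)%:C%C * f.[b]) u); first by rewrite size_map.
  move=> x /mapP[i si ->]; have [[_ _ /(_ e e01') -> _] ze] := zP i si.
  by rewrite ltW.
move=> [j [k [jk]]]; rewrite size_map => ks.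
have s0 : I by case: (s) ks.
have js := ltn_trans jk ks.
rewrite !(nth_map s0) // => zjk.
have [Lj _] := zP _ (mem_nth s0 js); have [Lk _] := zP _ (mem_nth s0 ks).
have [_ _ /(_ e e01') fe _] := Lj.
have {}Lj := lift_rest Lj e01; have {}Lk := lift_rest Lk e01.
rewrite -zjk in Lk.
suff : cl (nth s0 s j) = cl (nth s0 s k).
  move/eqP; rewrite -!(nth_map _ (cl s0)) // nth_uniq ?size_map //.
  by rewrite ltn_eqF.
apply: (low (zeta (nth s0 s j) e)); [|by eexists; exact: Lj|by eexists; exact: Lk].
rewrite fe Normc.normcM normc_real gtr_pMl ?normc_gt0 // ger0_norm; lra.
Qed.

End Monic.
End LiftTheory.

(** * Spanning trees *)

Section SpanningTree.
Variables (T : finType) (X : eqType).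
Implicit Types (E : seq (T * T * X)).

Lemma exists_representatives (cl : T -> T) (s : seq T) : exists s' : seq T,
  [/\ {subset s' <= s}, uniq (map cl s') &
      forall x, x \in s -> exists2 y, y \in s' & cl x = cl y].
Proof.
elim: s => [|a s [s' [ss us cs]]]; first by exists [::].
have [|nin] := boolP (cl a \in map cl s').
  move=> /mapP[b bs' ab]; exists s'; split => //.
    by move=> x /ss xs; rewrite inE xs orbT.
  by move=> x; rewrite inE => /predU1P[->|/cs //]; exists b.
exists (a :: s'); split; first by move=> x; rewrite !inE => /predU1P[->|/ss ->];
  rewrite ?eqxx ?orbT.
  by rewrite /= nin.
move=> x; rewrite inE => /predU1P[->|/cs[y ys' xy]]; first by exists a; rewrite ?mem_head.
by exists y => //; rewrite inE ys' orbT.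
Qed.

Definition constant_on E (U : Type) (cl : T -> U) :=
  forall e, e \in E -> cl e.1.1 = cl e.1.2.

Definition constant_on_set (A : pred T) (U : Type) (cl : T -> U) :=
  forall x y, A x -> A y -> cl x = cl y.

(* The connected components of E, as a labelling of T. *)
Lemma exists_components E : exists cl0 : T -> T, constant_on E cl0 /\
  forall x y, cl0 x = cl0 y -> forall (U : Type) (cl : T -> U), constant_on E cl -> cl x = cl y.
Proof.
(* Connectivity by its universal property, without paths: no labelling constant on [E] separates x
   from y. *)
pose r x y := `[< forall (U : Type) (cl : T -> U), constant_on E cl -> cl x = cl y >].
have rxx x : r x x by apply/asboolP.
have rE x y : r x y -> r x =1 r y.
  move=> /asboolP xy z; apply/asboolP/asboolP => H U cl clE.
    by rewrite -(xy U cl clE) (H U cl clE).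
  by rewrite (xy U cl clE) (H U cl clE).
exists (fun x => odflt x [pick y | r x y]); split.
  move=> e eE /=; have re : r e.1.1 e.1.2 by apply/asboolP => U cl; apply.
  rewrite (eq_pick (rE _ _ re)); case: pickP => //= H.
  by have := H e.1.2; rewrite rxx.
move=> x y.
have P z : r z (odflt z [pick y | r z y]) by case: pickP => //= ? ?.
move=> xy U cl clE; have /asboolP/(_ U cl clE) -> := P x; rewrite xy.
by have /asboolP/(_ U cl clE) -> := P y.
Qed.

(** Kruskal's algorithm with hyperedges [reach b], taken by increasing [rho]. Once the lower ones
    are connected, [reach b] meets at most [count_mem b bs + 1] components, so a star with
    [count_mem b bs] edges joins them. Loops pad a smaller star, so that each occurrence of b labels
    exactly one edge. *)
Lemma spanning_edges (R : realDomainType) (bs : seq X) (rho : X -> R)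
    (reach : X -> pred T) :
  (forall b, b \in bs -> exists x, reach b x) ->
  (forall b, b \in bs -> forall cl : T -> T,
    (forall b', b' \in bs -> rho b' < rho b -> constant_on_set (reach b') cl) ->
    forall s : seq T, all (reach b) s -> uniq (map cl s) ->
    (size s <= (count_mem b bs).+1)%N) ->
  exists E, [/\ perm_eq (map snd E) bs,
    forall e, e \in E -> reach e.2 e.1.1 /\ reach e.2 e.1.2 &
    forall (U : Type) (cl : T -> U), constant_on E cl ->
      forall b, b \in bs -> constant_on_set (reach b) cl].
Proof.
move=> reach0 few; pose le b b' := rho b <= rho b'.
suff [E [E1 E2 E3]] : exists E, [/\
    perm_eq (map snd E) (flatten [seq nseq (count_mem b bs) b | b <- sort le (undup bs)]),
    forall e, e \in E -> reach e.2 e.1.1 /\ reach e.2 e.1.2 &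
    forall (U : Type) (cl : T -> U), constant_on E cl ->
      forall b, b \in sort le (undup bs) -> constant_on_set (reach b) cl].
  exists E; split => // [|U cl clE b bbs].
    rewrite (permPl E1) -(permPr (perm_count_undup bs)).
    by apply/perm_flatten/perm_map; rewrite perm_sort.
  by apply: E3 => //; rewrite mem_sort mem_undup.
have le_tr : transitive le by move=> a b c; apply: le_trans.
have le_tot : total le by move=> a b; apply: le_total.
have : sorted le (sort le (undup bs)) by apply: sort_sorted.
have : {subset sort le (undup bs) <= bs} by move=> x; rewrite mem_sort mem_undup.
(* The induction runs over prefixes of the sorted list, which are closed under passing to smaller
   [rho]. *)
have : forall b b', b \in sort le (undup bs) -> b' \in bs -> rho b' < rho b ->
  b' \in sort le (undup bs) by move=> b b' _ ? _; rewrite mem_sort mem_undup.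
elim/last_ind: (sort le _) => [|t b IH] down sub srt; first by exists [::].
have srt' : sorted le t by move: srt; rewrite -cats1 => /cat_sorted2[].
have tb b' : b' \in t -> rho b' <= rho b.
  move=> b't; move: srt; rewrite -cats1 sorted_pairwise // pairwise_cat.
  by move=> /and3P[/allrelP/(_ _ b b't (mem_head _ _))].
have [|b' b't|//|E [E1 E2 E3]] := IH.
- move=> b1 b2 b1t b2bs b21.
  have : b2 \in rcons t b by apply: (down b1) => //; rewrite mem_rcons inE b1t orbT.
  rewrite mem_rcons inE => /predU1P[b2b|//].
  by move: b21; rewrite b2b ltNge tb.
- by apply: sub; rewrite mem_rcons inE b't orbT.
have bbs : b \in bs by apply: sub; rewrite mem_rcons mem_head.
have [cl0 [cl0E cl0P]] := exists_components E.
have [s' [s's us' s'c]] := exists_representatives cl0 [seq x <- enum T | reach b x].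
have rs' : all (reach b) s'.
  by apply/allP => x /s's; rewrite mem_filter => /andP[].
have s'b : (size s' <= (count_mem b bs).+1)%N.
  apply: (few b bbs cl0) => // b' b'bs b'b; apply: E3 => //.
  have : b' \in rcons t b by apply: (down b) => //; rewrite mem_rcons mem_head.
  by rewrite mem_rcons inE => /predU1P[b'E|//]; move: b'b; rewrite b'E ltxx.
have s'cov x : reach b x -> exists2 y, y \in s' & cl0 x = cl0 y.
  by move=> rx; apply: s'c; rewrite mem_filter rx mem_enum.
case: s' {s's us' s'c} rs' s'b s'cov => [_ _ H|x1 rest].
  by have [x /H[]] := reach0 b bbs.
move=> /= /andP[rx1 rrest]; rewrite ltnS => srest cov.
pose E' := [seq (x1, y, b) | y <- rest] ++ nseq (count_mem b bs - size rest) (x1, x1, b).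
have E'P e : e \in E' -> [/\ e.2 = b, e.1.1 = x1 & reach b e.1.2].
  rewrite mem_cat => /orP[/mapP[y yr ->]|/nseqP[-> _]]; split => //=.
  exact: (allP rrest).
exists (E ++ E'); split.
- rewrite map_cat map_rcons flatten_rcons; apply: perm_cat => //.
  rewrite /E' map_cat map_nseq -map_comp (eq_map (_ : _ =1 fun=> b)) //=.
  rewrite (_ : map _ rest = nseq (size rest) b).
    by rewrite -nseqD subnKC.
  by elim: (rest) => //= ? ? ->.
- move=> e; rewrite mem_cat => /orP[/E2 //|/E'P[-> -> ?]]; by split.
move=> U cl clE b'; rewrite mem_rcons inE.
have clE1 : constant_on E cl by move=> e eE; apply: clE; rewrite mem_cat eE.
move=> /predU1P[->|b't]; last by apply: E3.
suff H x : reach b x -> cl x = cl x1 by move=> x y /H -> /H ->.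
move=> /cov[y]; rewrite inE => /predU1P[->|yr] /cl0P -> //.
apply/esym/(clE (x1, y, b)); rewrite !mem_cat; apply/orP; right.
by apply/orP; left; apply/mapP; exists y.
Qed.

(** A set grows from r by edges that leave it; connectedness provides one until all vertices are
    covered, and the size of [E] leaves no edge over. Each x other than r carries the label of the
    edge that brought it in, so the product over vertices is the product over edges. *)
Lemma rooted_order (R : comNzRingType) (w : X -> R) E (x0 : X) (r : T) :
  size E = #|T|.-1 ->
  (forall cl : T -> bool, constant_on E cl -> forall x y, cl x = cl y) ->
  exists (rk : T -> nat) (par : T -> T) (lab : T -> X),
    [/\ forall x, x != r -> (rk (par x) < rk x)%N,
        forall x, x != r -> (x, par x, lab x) \in E \/ (par x, x, lab x) \in E &
        \prod_(x | x != r) w (lab x) = \prod_(e <- E) w e.2].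
Proof.
move=> sE conn.
have T0 : (0 < #|T|)%N by apply/card_gt0P; exists r.
have [S [E1 [E2 [rk [par [lab [[cS rS] pE sE1 inS [rkS labS wS]]]]]]]] :
    exists (S : {set T}) E1 E2 (rk : T -> nat) (par : T -> T) (lab : T -> X),
    [/\ #|S| = #|T|.-1.+1 /\ r \in S, perm_eq E (E1 ++ E2), (size E1).+1 = #|S|,
      forall e, e \in E1 -> (e.1.1 \in S) && (e.1.2 \in S) &
      [/\ forall x, x \in S -> x != r -> (rk (par x) < rk x)%N && (par x \in S),
        forall x, x \in S -> x != r -> (x, par x, lab x) \in E \/ (par x, x, lab x) \in E &
        \prod_(x in S | x != r) w (lab x) = \prod_(e <- E1) w e.2]].
  have : (#|T|.-1 < #|T|)%N by rewrite prednK.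
  elim: #|T|.-1 => [_|k IH kT].
    exists [set r]%SET, [::], E, (fun=> 0%N), id, (fun=> x0).
    split; rewrite ?cards1 ?set11 //; split=> [x|x|].
    - by rewrite inE => ->.
    - by rewrite inE => ->.
    - by rewrite big_nil big_pred0 // => x; rewrite inE andbN.
  have [S [E1 [E2 [rk [par [lab [[cS rS] pE sE1 inS [rkS labS wS]]]]]]]] := IH (ltnW kT).
  have [e eE eS] : exists2 e, e \in E & (e.1.1 \in S) != (e.1.2 \in S).
    apply: contrapT => H.
    have cst x : x \in S.
      apply: etrans rS; apply: (conn (fun x => x \in S)) => e eE.
      by apply: contrapT => He; apply: H; exists e => //; apply/eqP.
    by move: kT; rewrite -cS (eq_card (B := T)) ?ltnn // => x; rewrite cst.
  have eE2 : e \in E2.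
    move: eE; rewrite (perm_mem pE) mem_cat => /orP[/inS/andP[e1 e2]|//].
    by move: eS; rewrite e1 e2.
  have [x [y [xS yS exy exyS]]] : exists x y, [/\ x \notin S, y \in S,
      (x, y, e.2) \in E \/ (y, x, e.2) \in E &
      (e.1.1 \in (x |: S)%SET) && (e.1.2 \in (x |: S)%SET)].
    case: e eE eS {eE2} => [[x y] b] /= eE.
    case: (boolP (x \in S)) => xS; case: (boolP (y \in S)) => yS // _.
      by exists y, x; split => //; [right|rewrite !inE xS eqxx orbT].
    by exists x, y; split => //; [left|rewrite !inE yS eqxx orbT].
  have xr : x != r by apply: contraNneq xS => ->.
  have xz z : z \in S -> (z == x) = false by move=> zS; apply: contraNF xS => /eqP <-.
  exists (x |: S)%SET, (e :: E1), (rem e E2),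
    (fun z => if z == x then (rk y).+1 else rk z),
    (fun z => if z == x then y else par z), (fun z => if z == x then e.2 else lab z).
  split.
  - by rewrite cardsU1 xS cS inE rS orbT.
  - rewrite (permPl pE) /= perm_sym -cat1s perm_catCA perm_cat2l /=.
    by rewrite perm_sym perm_to_rem.
  - by rewrite cardsU1 xS -sE1.
  - move=> e'; rewrite inE => /predU1P[->//|/inS/andP[h1 h2]].
    by rewrite !inE h1 h2 !orbT.
  - split.
    + move=> z; rewrite !inE => /predU1P[->|zS] zr.
        by rewrite eqxx xz // ltnSn yS orbT.
      have /andP[h1 h2] := rkS z zS zr.
      by rewrite !xz // h1 h2 orbT.
    + move=> z; rewrite !inE => /predU1P[->|zS] zr; first by rewrite eqxx.
      by rewrite xz //; exact: labS.
    + rewrite (bigD1 x) /=; last by rewrite !inE eqxx.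
      rewrite eqxx big_cons -wS; congr (_ * _).
      apply: eq_big => [z|z]; last first.
        by rewrite !inE; case: (z =P x) => //=; rewrite andbF.
      rewrite !inE; case: (boolP (z \in S)) => zS; first by rewrite xz //= andbT.
      by case: (z =P x) => //= ->; rewrite andbF.
have ST x : x \in S.
  have /subset_cardP/(_ (fintype.subset_predT _))-> // : #|S| = #|T|.
  by rewrite cS prednK.
have E20 : E2 = [::].
  apply: size0nil; have := perm_size pE; rewrite size_cat sE.
  move: sE1; rewrite cS => -[->] /eqP.
  by rewrite -{1}[_.-1]addn0 eqn_add2l => /eqP <-.
exists rk, par, lab; split.
- by move=> x xr; have /andP[] := rkS x (ST x) xr.
- by move=> x xr; apply: labS.
- rewrite (perm_big _ pE) E20 cats0 -wS; apply: eq_bigl => x.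
  by rewrite ST.
Qed.

End SpanningTree.

(** * Critical points *)

Section CriticalPoints.
Variables (R : realType) (s : nat) (a : 'I_s -> R[i]) (m : 'I_s -> nat).

Definition weight_sum := (\sum_(i < s) m i)%N.

Definition weighted_poly : {poly R[i]} := \prod_(i < s) ('X - (a i)%:P) ^+ m i.

(* The numerator of f'/f = sum_k m_k / (X - a_k). A point a_k with m_k = 0 is one
   of its roots. *)
Definition crit_poly : {poly R[i]} :=
  \sum_(k < s) (m k)%:R *: \prod_(l < s | l != k) ('X - (a l)%:P).

Local Notation f := weighted_poly.
Local Notation P := crit_poly.
Local Notation M := weight_sum.
Local Notation W := (\prod_(i < s) ('X - (a i)%:P)).

Lemma weighted_poly_monic : f \is monic.
Proof. by apply: monic_prod => i _; rewrite monic_exp // monicXsubC. Qed.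

Lemma size_weighted_poly : size f = M.+1.
Proof.
rewrite size_prod => [|i _]; last by rewrite expf_neq0 // polyXsubC_eq0.
rewrite (eq_bigr (fun i => (m i + 1)%N)) => [|i _].
  by rewrite big_split /= sum1_card subSn ?addnK // leq_addl.
by rewrite size_exp_XsubC addn1.
Qed.

Lemma horner_weighted_poly z : f.[z] = \prod_(i < s) (z - a i) ^+ m i.
Proof. by rewrite horner_prod; apply: eq_bigr => i _; rewrite !hornerE. Qed.

Lemma weighted_poly_root z : f.[z] = 0 <-> exists2 i, z = a i & (0 < m i)%N.
Proof.
rewrite horner_weighted_poly; split => [/eqP/prodf_eq0[i _]|[i -> mi]].
  by rewrite expf_eq0 subr_eq0 => /andP[mi /eqP ->]; exists i.
by apply/eqP/prodf_eq0; exists i => //; rewrite expf_eq0 mi subrr eqxx.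
Qed.

Lemma horner_crit_poly k : P.[a k] = (m k)%:R * \prod_(l < s | l != k) (a k - a l).
Proof.
rewrite horner_sum (bigD1 k) //= [X in _ + X = _]big1 ?addr0 => [|l lk].
  by rewrite hornerZ horner_prod; congr (_ * _); apply: eq_bigr => i _; rewrite !hornerE.
by rewrite hornerZ horner_prod (bigD1 k) 1?eq_sym //= hornerXsubC subrr mul0r mulr0.
Qed.

(** The logarithmic derivative cleared of denominators, so that it makes sense at the points a_k
    too. *)
Lemma deriv_weighted_poly : f^`() * W = f * P.
Proof.
have dprod (I : finType) (F : I -> {poly R[i]}) (t : seq I) : uniq t ->
    (\prod_(i <- t) F i)^`() = \sum_(i <- t) (F i)^`() * \prod_(j <- t | j != i) F j.
  elim: t => [|i t IH] /=; first by rewrite !big_nil derivC.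
  move=> /andP[it ut]; rewrite !big_cons derivM IH // eqxx /= mulr_sumr; congr (_ * _ + _).
    rewrite [RHS]big_seq_cond [LHS]big_seq; apply: eq_bigl => j.
    by case: (boolP (j \in t)) => //= jt; apply/esym; apply: contraNneq it => <-.
  rewrite big_seq [RHS]big_seq; apply: eq_bigr => j jt.
  rewrite big_cons mulrCA; congr (_ * _).
  by rewrite (_ : i != j) //; apply: contraNneq it => ->.
have -> := dprod _ (fun i => ('X - (a i)%:P) ^+ m i) _ (index_enum_uniq 'I_s).
rewrite mulr_suml mulr_sumr; apply: eq_bigr => k _.
rewrite deriv_exp derivXsubC mul1r.
have [->|mk] := posnP (m k); first by rewrite scale0r mulr0 mulr0n !mul0r.
rewrite [W](bigD1 k) //= [f](bigD1 k) //= -scaler_nat -!scalerAl -scalerAr; congr (_ *: _).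
have -> : ('X - (a k)%:P) ^+ m k = ('X - (a k)%:P) * ('X - (a k)%:P) ^+ (m k).-1.
  by rewrite -exprS prednK.
by rewrite -!mulrA; ring.
Qed.

Lemma lead_size_crit_poly : (0 < M)%N ->
  size P = s /\ lead_coef P = M%:R.
Proof.
move=> M0.
have s0 : (0 < s)%N.
  rewrite lt0n; apply: contraTneq M0 => s0.
  by rewrite /weight_sum big1 // => i _; have := ltn_ord i; rewrite {2}s0.
have sz k : size (\prod_(l < s | l != k) ('X - (a l)%:P)) = s.
  rewrite -big_filter size_prod_XsubC size_filter.
  rewrite -sum1_count (eq_bigl (mem (predC1 k))) // sum1_card cardC1 card_ord.
  by rewrite prednK.
have szP : (size P <= s)%N.
  apply: (leq_trans (size_sum _ _ _)); apply/bigmax_leqP => k _.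
  by rewrite (leq_trans (size_scale_leq _ _)) // sz.
have coP : P`_s.-1 = M%:R.
  rewrite coef_sum natr_sum; apply: eq_bigr => k _; rewrite coefZ.
  have := lead_coef_prod_XsubC (index_enum 'I_s) (fun l => l != k) a.
  by rewrite lead_coefE sz => ->; rewrite mulr1.
have szE : size P = s.
  apply/eqP; rewrite eqn_leq szP /= -[X in (X <= _)%N]prednK // ltnNge.
  apply/negP => /leq_sizeP/(_ _ (leqnn _))/eqP.
  by rewrite coP pnatr_eq0 gtn_eqF.
by rewrite lead_coefE szE coP.
Qed.

End CriticalPoints.

(** * The spanning tree of links through roots of P *)

Section CriticalTree.
Variables (R : realType) (s : nat) (a : 'I_s -> R[i]) (m : 'I_s -> nat).
Hypotheses (a_inj : injective a) (M_gt0 : (0 < weight_sum m)%N).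

Local Notation f := (weighted_poly a m).
Local Notation P := (crit_poly a m).
Local Notation M := (weight_sum m).
Local Notation W := (\prod_(i < s) ('X - (a i)%:P)).
Local Notation f_monic := (weighted_poly_monic a m).
Local Notation size_f := (size_weighted_poly a m).

(** The second alternative is for m_i = 0: then a_i is not a root of f, no lift ends there, but a_i
    is a root of P and must be linked through itself. *)
Definition reach (b : R[i]) (i : 'I_s) : bool :=
  `[< (exists zeta, is_lift f M b (a i) zeta) \/ a i = b >].

Lemma crit_roots : exists2 bs : seq R[i], size bs = s.-1 &
  P = M%:R *: \prod_(b <- bs) ('X - b%:P).
Proof.
have [szP lP] := lead_size_crit_poly a M_gt0.
have [bs bsE] := closed_field_poly_normal P; rewrite lP in bsE.
exists bs => //; have := szP; rewrite bsE size_scale ?size_prod_XsubC; last first.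
  by rewrite pnatr_eq0 -lt0n.
by move=> <-.
Qed.

Section Roots.
Variable bs : seq R[i].
Hypotheses (size_bs : size bs = s.-1) (bsE : P = M%:R *: \prod_(b <- bs) ('X - b%:P)).

Let M0 : M%:R != 0 :> R[i]. Proof. by rewrite pnatr_eq0 -lt0n. Qed.

Lemma crit_poly_root b : (P.[b] == 0) = (b \in bs).
Proof. by rewrite bsE hornerZ mulf_eq0 (negbTE M0) -root_prod_XsubC. Qed.

Lemma crit_poly_neq0 : P != 0.
Proof. by rewrite bsE scaler_eq0 (negbTE M0) monic_neq0 // monic_prod_XsubC. Qed.

Lemma crit_value_neq0 b : b \in bs -> f.[b] != 0.
Proof.
rewrite -crit_poly_root => Pb; apply/eqP => /weighted_poly_root[k bk mk].
move: Pb; rewrite bk horner_crit_poly mulf_eq0 pnatr_eq0 gtn_eqF //=.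
move/prodf_eq0 => [l lk]; rewrite subr_eq0 => /eqP/a_inj kl.
by rewrite kl eqxx in lk.
Qed.

(** A resultant computed in two ways: the product of (a_k - b) over the roots b of P is P(a_k) / M,
    and P(a_k) has a single surviving term. *)
Lemma prod_crit_values : \prod_(b <- bs) normc f.[b] =
  \prod_(k < s) (((m k)%:R / M%:R) ^+ m k * \prod_(l < s | l != k) normc (a k - a l) ^+ m k).
Proof.
under eq_bigr do rewrite horner_weighted_poly normc_prod.
rewrite exchange_big /=; apply: eq_bigr => k _.
under eq_bigr do rewrite normcX normcBC.
rewrite !prodrXl -exprMn; congr (_ ^+ _).
have /(congr1 (@normc _)) : P.[a k] = M%:R * \prod_(b <- bs) (a k - b).
  rewrite bsE hornerZ horner_prod; congr (_ * _).
  by apply: eq_bigr => b _; rewrite !hornerE.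
rewrite horner_crit_poly !Normc.normcM !normc_prod !normc_nat => /esym E.
have M0' : M%:R != 0 :> R by rewrite pnatr_eq0 -lt0n.
by apply: (mulfI M0'); rewrite E; field.
Qed.

Lemma divergence_crit z i j zeta xi : i != j ->
  is_lift f M z (a i) zeta -> is_lift f M z (a j) xi ->
  exists b, [/\ b \in bs, normc f.[b] <= normc f.[z], reach b i & reach b j].
Proof.
move=> ij Li Lj.
have aij : a i != a j by apply: contraNneq ij => /a_inj ->.
have [b [f'b fb fbz Lbi Lbj]] := lift_divergence f_monic size_f M_gt0 Li Lj aij.
exists b; split => //; [|by apply/asboolP; left..].
have /(congr1 (fun p => p.[b])) := deriv_weighted_poly a m.
rewrite !hornerM f'b mul0r -crit_poly_root => /esym/eqP.
by rewrite mulf_eq0 (negbTE fb).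
Qed.

(** As f(b) is not 0, [deriv_weighted_poly] splits the multiplicity of b in P into that in f', which
    governs the branching of lifts at b, and that in W, which accounts for b being one of the
    a_k. *)
Lemma mup_crit b : b \in bs ->
  (mup b f^`() + mup b W = count_mem b bs)%N /\ f^`() != 0.
Proof.
move=> bbs; have fb := crit_value_neq0 bbs.
have W0 : W != 0 by rewrite monic_neq0 // monic_prod_XsubC.
have f0 : f != 0 by rewrite monic_neq0 // f_monic.
have f'0 : f^`() != 0.
  apply: contraNneq crit_poly_neq0 => f'0.
  have := deriv_weighted_poly a m; rewrite f'0 mul0r => /esym/eqP.
  by rewrite mulf_eq0 (negbTE f0).
split => //; rewrite -mupM // deriv_weighted_poly mupM // ?crit_poly_neq0 //.
rewrite mupNroot // add0n bsE -mul_polyC mupMr ?mu_prod_XsubC //.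
by rewrite rootC.
Qed.

(** The multiplicity of b in P is just what [spanning_edges] requires: a zero of f' of order q
    allows at most q + 1 classes of ends of lifts, and a point a_k equal to b adds at most one. *)
Lemma crit_tree (r : 'I_s) :
  exists (rk : 'I_s -> nat) (par : 'I_s -> 'I_s) (lab : 'I_s -> R[i]),
    [/\ forall x, x != r -> (rk (par x) < rk x)%N,
        forall x, x != r -> [/\ lab x \in bs, reach (lab x) x & reach (lab x) (par x)] &
        \prod_(x | x != r) normc f.[lab x] = \prod_(b <- bs) normc f.[b]].
Proof.
(* Two ends of lifts from z are both reached from some root of P of level at most |f(z)|, so a
   labelling constant on these reaches cannot tell them apart. *)
have low (T : eqType) (cl : 'I_s -> T) z i j :
    (forall b', b' \in bs -> normc f.[b'] <= normc f.[z] -> constant_on_set (reach b') cl) ->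
    (exists zeta, is_lift f M z (a i) zeta) ->
    (exists zeta, is_lift f M z (a j) zeta) -> cl i = cl j.
  move=> cst [zeta Li] [xi Lj]; have [->//|ij] := eqVneq i j.
  by have [b [bbs fb ri rj]] := divergence_crit ij Li Lj; apply: (cst b).
have lift_any z : exists i zeta, is_lift f M z (a i) zeta.
  have [x [zeta L]] := exists_lift f_monic size_f M_gt0 z.
  by have /weighted_poly_root[i xi _] := lift_end L; exists i, zeta; rewrite -xi.
have [||E [E1 E2 E3]] := @spanning_edges _ _ R bs (fun b => normc f.[b]) reach.
- move=> b _; have [i [zeta L]] := lift_any b.
  by exists i; apply/asboolP; left; exists zeta.
- move=> b bbs cl cst t rt ut.
  have [mupE f'0] := mup_crit bbs.
  have few (t' : seq 'I_s) : uniq (map cl t') ->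
      (forall i, i \in t' -> exists zeta, is_lift f M b (a i) zeta) ->
      (size t' <= (mup b f^`()).+1)%N.
    move=> ut' Lt'; rewrite leqNgt; apply/negP => lt.
    have := @lift_few_labels _ f M f_monic size_f M_gt0 _ _ a cl
      (take (mup b f^`()).+2 t') b (mup b f^`()).
    rewrite mup_deriv_coef_neq0 // size_takel // eqxx.
    have lw z i j : normc f.[z] < normc f.[b] ->
        (exists zeta, is_lift f M z (a i) zeta) ->
        (exists zeta, is_lift f M z (a j) zeta) -> cl i = cl j.
      move=> zb; apply: low => b' b'bs b'z; apply: cst => //.
      exact: le_lt_trans zb.
    suff : uniq (map cl (take (mup b f^`()).+2 t')).
      move=> u /(_ isT (crit_value_neq0 bbs) lw); rewrite u => H.
      by have := H (fun i it => Lt' i (mem_take it)) isT.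
    by rewrite map_take take_uniq.
  have WE : W = \prod_(x <- map a (index_enum 'I_s)) ('X - x%:P) by rewrite big_map.
  have [[k bk]|nk] := pselect (exists k, b = a k).
    have mW : mup b W = 1%N.
      rewrite WE mu_prod_XsubC count_uniq_mem ?map_inj_uniq ?index_enum_uniq //.
      by rewrite bk map_f ?mem_index_enum.
    rewrite -mupE mW addn1.
    have ut0 : uniq t := map_uniq ut.
    have : (size t <= (size [seq i <- t | i != k]).+1)%N.
      rewrite -(count_predC (pred1 k) t) size_filter -add1n leq_add2r.
      by rewrite count_uniq_mem // leq_b1.
    move/leq_trans; apply; rewrite ltnS; apply: few.
      apply: subseq_uniq ut; exact/map_subseq/filter_subseq.
    move=> i; rewrite mem_filter => /andP[ik it].
    have /asboolP[//|ab] := allP rt i it.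
    by move: ik; rewrite (a_inj (etrans ab bk)) eqxx.
  have mW : mup b W = 0%N.
    rewrite mupNroot // WE root_prod_XsubC; apply/mapP => -[k _ bk].
    by apply: nk; exists k.
  rewrite -mupE mW addn0; apply: few => // i it.
  have /asboolP[//|ab] := allP rt i it.
  by case: nk; exists i.
have sE : size E = #|'I_s|.-1.
  by rewrite card_ord -size_bs -(perm_size E1) size_map.
(* A labelling that separates two roots of f would, by [lift_both_ends], yield a point with lifts to
   ends of both labels, against [low]. A point with m_k = 0 is a root of P, hence linked to the end
   of a lift that starts there. *)
have conn (cl : 'I_s -> bool) : constant_on E cl -> forall x y, cl x = cl y.
  move=> /E3 cst.
  have root_eq i j : (0 < m i)%N -> (0 < m j)%N -> cl i = cl j.
    move=> mi mj; apply: contrapT => ij.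
    pose A : pred R[i] := fun z => [exists k, (a k == z) && (cl k == cl i)].
    have AE k : A (a k) = (cl k == cl i).
      apply/existsP/idP => [[l /andP[/eqP/a_inj -> //]]|kl].
      by exists k; rewrite eqxx.
    have [|||| z [x [y [zeta [xi [Ax Ay Lx Ly]]]]]] :=
        @lift_both_ends _ f M f_monic size_f M_gt0 A (a i) (a j).
    - by apply/weighted_poly_root; exists i.
    - by apply/weighted_poly_root; exists j.
    - by rewrite AE.
    - by rewrite AE; apply/eqP => /esym.
    have /weighted_poly_root[k xk _] := lift_end Lx.
    have /weighted_poly_root[l yl _] := lift_end Ly.
    rewrite xk AE in Ax Lx; rewrite yl AE in Ay Ly.
    move/negP: Ay; apply; rewrite -(eqP Ax); apply/eqP/esym.
    by apply: (low _ cl z) => [b' b'bs _||]; [exact: cst|exists zeta|exists xi].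
  have rep k : exists2 l, (0 < m l)%N & cl k = cl l.
    have [mk|mk] := posnP (m k); last by exists k.
    have kbs : a k \in bs by rewrite -crit_poly_root horner_crit_poly mk mul0r.
    have [l [zeta L]] := lift_any (a k).
    exists l.
      by have /weighted_poly_root[l' /a_inj -> ?] := lift_end L.
    by apply: (cst _ kbs); apply/asboolP; [right|left; exists zeta].
  move=> x y; have [x' mx' ->] := rep x; have [y' my' ->] := rep y.
  exact: root_eq.
have [rk [par [lab [H1 H2 H3]]]] :=
  @rooted_order _ _ R (fun b => normc f.[b]) E 0 r sE conn.
exists rk, par, lab; split => //; last first.
  by rewrite H3 -(perm_big _ E1) /= big_map.
move=> x xr; have := H2 x xr.
by case=> eE; have [/= ? ?] := E2 _ eE; split=> //;
  rewrite -(perm_mem E1); apply/mapP; eexists; [exact: eE| |exact: eE|].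
Qed.

End Roots.
End CriticalTree.

(** * Convex hull and length of the paths *)

Section Clamp.
Variable R : realType.
Implicit Types (t u v : R).

(** Composition with this retraction extends a path on [0, 1] to a continuous function on the whole
    line. *)
Definition clamp t : R := Num.max 0 (Num.min 1 t).

Lemma clamp01 t : 0 <= clamp t <= 1.
Proof. by rewrite /clamp le_max lexx /= ge_max ler01 ge_min lexx. Qed.

Lemma clampK t : 0 <= t <= 1 -> clamp t = t.
Proof. by move=> /andP[t0 t1]; rewrite /clamp (min_idPr t1) (max_idPr t0). Qed.

Lemma clamp_dist t u : `|clamp t - clamp u| <= `|t - u|.
Proof.
rewrite /clamp /Num.max /Num.min; do 6?case: ifP => //; rewrite ?ler_norml;
by have := ler_norm (t - u); have := ler_norm (u - t); rewrite (distrC u t); lra.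
Qed.

Lemma continuous_clamp (X : R -> R) :
  (forall d : R, 0 < d -> exists2 e : R, 0 < e & forall u v, 0 <= u <= 1 -> 0 <= v <= 1 ->
    `|u - v| <= e -> `|X u - X v| < d) ->
  continuous (X \o clamp).
Proof.
move=> H t; apply/cvgrPdist_lt => d d0; have [e e0 eP] := H d d0.
apply/nbhs_ballP; exists e => // u /= tu.
by apply: eP; rewrite ?clamp01 // (le_trans (clamp_dist _ _)) // ltW.
Qed.

End Clamp.

Section Hull.
Variables (R : realType) (s : nat) (a : 'I_s -> R[i]).

(* The convex hull of the points a_k, in terms of its support function. *)
Definition in_hull (z : R[i]) := forall u : R[i], exists k,
  complex.Re (u * z) <= complex.Re (u * a k).

Lemma in_hull_point k : in_hull (a k).
Proof. by move=> u; exists k. Qed.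

Lemma in_hull_convex z w (t : R) : in_hull z -> in_hull w -> 0 <= t <= 1 ->
  in_hull (z + t%:C%C * (w - z)).
Proof.
move=> hz hw t01 u; have [k zk] := hz u; have [l wl] := hw u.
have -> : complex.Re (u * (z + t%:C%C * (w - z))) =
    (1 - t) * complex.Re (u * z) + t * complex.Re (u * w).
  rewrite mulrDr mulrCA mulrBr ReD [X in _ + X]ReM /= mul0r subr0 ReD ReN; ring.
have [kl|lk] := leP (complex.Re (u * a k)) (complex.Re (u * a l)).
  exists l; have H1 : (1 - t) * complex.Re (u * z) <= (1 - t) * complex.Re (u * a l).
    by rewrite ler_wpM2l ?(le_trans zk) //; lra.
  have H2 : t * complex.Re (u * w) <= t * complex.Re (u * a l).
    by rewrite ler_wpM2l //; lra.
  lra.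
exists k; have H1 : (1 - t) * complex.Re (u * z) <= (1 - t) * complex.Re (u * a k).
  by rewrite ler_wpM2l //; lra.
have H2 : t * complex.Re (u * w) <= t * complex.Re (u * a k).
  by rewrite ler_wpM2l ?(le_trans wl (ltW lk)) //; lra.
lra.
Qed.

Section Diameter.
Variable D : R.
Hypothesis diam : forall k l, normc (a k - a l) <= D.

(** With u the conjugate of z - a_l, some k satisfies |z - a_l|^2 = Re(u (z - a_l)) <= Re(u (a_k -
    a_l)) <= |z - a_l| D. *)
Lemma in_hull_dist z l : in_hull z -> normc (z - a l) <= D.
Proof.
move=> hz; pose u := conjc (z - a l).
have [k] := hz u; rewrite -subr_ge0 -ReN -ReD -mulrN -mulrDr => H.
have E : complex.Re (u * (z - a l)) = normc (z - a l) ^+ 2.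
  rewrite /u; case: (z - a l) => x y /=; rewrite sqr_sqrtr ?addr_ge0 ?sqr_ge0 //.
  by rewrite mulNr opprK -!expr2.
have Nu : normc u = normc (z - a l).
  by rewrite /u; case: (z - a l) => x y /=; rewrite sqrrN.
have : normc (z - a l) ^+ 2 <= normc (z - a l) * D.
  apply: le_trans (_ : complex.Re (u * (a k - a l)) <= _).
    rewrite -E -subr_ge0 -ReN -ReD -mulrN -mulrDr.
    by rewrite (_ : a k - a l - (z - a l) = a k - z) //; ring.
  apply: le_trans (ler_norm _) _; apply: le_trans (normRe_le _) _.
  by rewrite Normc.normcM Nu ler_wpM2l ?normc_ge0.
have [z0|] := eqVneq (normc (z - a l)) 0.
  by rewrite z0 => _; apply: le_trans (diam l l); exact: normc_ge0.
by move=> z0; rewrite expr2 ler_pM2l // lt0r z0 normc_ge0.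
Qed.

Lemma in_hull_width z w u : normc u = 1 -> in_hull z -> in_hull w ->
  complex.Re (u * z) - complex.Re (u * w) <= D.
Proof.
move=> u1 hz hw; have [k zk] := hz u; have [l] := hw (- u).
rewrite !mulNr !ReN lerN2 => wl.
have H : complex.Re (u * (a k - a l)) <= D.
  apply: le_trans (ler_norm _) _; apply: le_trans (normRe_le _) _.
  by rewrite Normc.normcM u1 mul1r.
move: H; rewrite mulrBr ReD ReN; lra.
Qed.

End Diameter.

Section Lifts.
Variable m : 'I_s -> nat.
Hypothesis M_gt0 : (0 < weight_sum m)%N.

Local Notation f := (weighted_poly a m).
Local Notation P := (crit_poly a m).
Local Notation M := (weight_sum m).

Lemma ReV_gt0 (y : R[i]) : 0 < complex.Re y -> 0 < complex.Re y^-1.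
Proof.
case: y => x y /= x0; rewrite divr_gt0 // ltr_pwDl ?sqr_ge0 // exprn_gt0 //.
Qed.

Lemma crit_poly_log_deriv z : (forall k, z != a k) ->
  P.[z] = (\prod_(l < s) (z - a l)) * \sum_(k < s) (m k)%:R / (z - a k).
Proof.
move=> za; rewrite horner_sum mulr_sumr; apply: eq_bigr => k _.
rewrite hornerZ horner_prod (bigD1 (P := xpredT) k) //=.
under eq_bigr do rewrite hornerXsubC.
by have zk : z - a k != 0 by [rewrite subr_eq0 za]; field.
Qed.

(** The Gauss-Lucas inequality: each term becomes m_k / (u (z - a_k)), and inversion preserves the
    right half-plane. *)
Lemma Re_log_deriv_gt0 u z : (forall k, complex.Re (u * a k) < complex.Re (u * z)) ->
  0 < complex.Re (u^-1 * \sum_(k < s) (m k)%:R / (z - a k)).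
Proof.
move=> H; rewrite mulr_sumr Re_sum.
have E k : complex.Re (u^-1 * ((m k)%:R / (z - a k))) =
           (m k)%:R * complex.Re (u * (z - a k))^-1.
  rewrite mulrCA -(rmorph_nat (real_complex R)) ReM /= mul0r subr0.
  by rewrite invfM.
have pos k : 0 < complex.Re (u * (z - a k))^-1.
  by apply: ReV_gt0; rewrite mulrBr ReD ReN subr_gt0.
have [k mk] : exists k, (0 < m k)%N.
  apply: contrapT => nex; move: M_gt0; rewrite /weight_sum big1 // => k _.
  by apply/eqP; rewrite -leqn0 leqNgt; apply/negP => mk; apply: nex; exists k.
rewrite (bigD1 k) //= ltr_pwDl ?E ?mulr_gt0 ?ltr0n // sumr_ge0 // => l _.
by rewrite E mulr_ge0 // ltW.
Qed.

Lemma crit_in_hull b : P.[b] = 0 -> in_hull b.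
Proof.
move=> Pb u; apply: contrapT => H.
have {}H k : complex.Re (u * a k) < complex.Re (u * b).
  by rewrite ltNge; apply/negP => ?; apply: H; exists k.
have bk k : b != a k by apply/eqP => bk; have := H k; rewrite -bk ltxx.
have := Re_log_deriv_gt0 H; have /eqP := crit_poly_log_deriv bk.
rewrite Pb eq_sym mulf_eq0 => /orP[/prodf_eq0[k _]|/eqP ->].
  by rewrite subr_eq0 (negbTE (bk k)).
by rewrite mulr0 ltxx.
Qed.

Lemma poly_taylor1 (p : {poly R[i]}) z0 : exists2 C : R, 0 <= C & forall d, normc d <= 1 ->
  normc (p.[z0 + d] - p.[z0] - p^`().[z0] * d) <= C * normc d ^+ 2.
Proof.
elim/poly_ind: p => [|p c [C C0 HC]].
  by exists 0 => // d _; rewrite deriv0 !horner0 mul0r !subr0 Normc.normc0 mul0r.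
exists (C * (normc z0 + 1) + normc p^`().[z0]).
  by rewrite addr_ge0 ?mulr_ge0 ?addr_ge0 ?normc_ge0.
move=> d d1; rewrite derivD derivM derivX derivC mulr1 addr0 !hornerD !hornerM !hornerX !hornerC.
have -> : p.[z0 + d] * (z0 + d) + c - (p.[z0] * z0 + c) - (p^`().[z0] * z0 + p.[z0]) * d
  = (p.[z0 + d] - p.[z0] - p^`().[z0] * d) * (z0 + d) + p^`().[z0] * d ^+ 2 by ring.
apply: le_trans (le_normcD _ _) _; rewrite Normc.normcM [X in _ + X]Normc.normcM normcX mulrDl lerD //.
rewrite mulrAC; apply: ler_pM; rewrite ?normc_ge0 ?HC //.
by rewrite (le_trans (le_normcD _ _)) // lerD2l.
Qed.

(* If Re (u zeta) had a maximum beyond the hull, then by the Gauss-Lucas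
   inequality it would increase strictly as |f| increases from that point. *)
Lemma lift_in_hull z x zeta : f.[z] != 0 -> in_hull z -> is_lift f M z x zeta ->
  forall t : R, 0 <= t <= 1 -> in_hull (zeta t).
Proof.
move=> fz hz L t t01 u; apply: contrapT => nex.
have [z0 z1 zf _] := L.
pose X (t : R) := complex.Re (u * zeta t).
have out_t k : complex.Re (u * a k) < X t.
  by rewrite ltNge; apply/negP => ?; apply: nex; exists k.
have Xcont : continuous (X \o @clamp R).
  apply: continuous_clamp => d d0.
  have u0 : 0 < normc u + 1 by rewrite ltr_wpDl ?normc_ge0.
  have [e e0 eP] := lift_continuous M_gt0 L (divr_gt0 d0 u0).
  exists e => // v w v01 w01 vw; rewrite /X -ReN -ReD -mulrN -mulrDr.
  apply: le_lt_trans (normRe_le _) _; rewrite Normc.normcM.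
  apply: le_lt_trans (_ : (normc u + 1) * normc (zeta v - zeta w) < _).
    by rewrite ler_wpM2r ?normc_ge0 // lerDl.
  by rewrite mulrC -ltr_pdivlMr // eP.
have [t0 t001 t0max] := EVT_max ler01 (continuous_subspaceT Xcont).
rewrite in_itv /= in t001.
have {}t0max v : 0 <= v <= 1 -> X v <= X t0.
  by move=> v01; have := t0max v; rewrite in_itv /= !clampK //; apply.
have out k : complex.Re (u * a k) < X t0 := lt_le_trans (out_t k) (t0max _ t01).
have t0_gt0 : 0 < t0.
  rewrite lt_neqAle eq_sym; case/andP: (t001) => -> _; rewrite andbT.
  apply/eqP => t00; have [k zk] := hz u; have := out k.
  by rewrite t00 /X z0 ltNge zk.
have t0_lt1 : t0 < 1.
  rewrite lt_neqAle; case/andP: (t001) => _ ->; rewrite andbT.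
  apply/eqP => t00; have /weighted_poly_root[k xk _] := lift_end L.
  by have := out k; rewrite t00 /X z1 xk ltxx.
set w := zeta t0.
have fw : f.[w] = (1 - t0)%:C%C * f.[z] by rewrite zf.
have fw0 : f.[w] != 0.
  by rewrite fw mulf_neq0 // (fmorph_eq0 (real_complex R)) subr_eq0 gt_eqF.
have wa k : w != a k by apply/eqP => wk; have := out k; rewrite -wk ltxx.
pose la := \sum_(k < s) (m k)%:R / (w - a k).
have f'w : f^`().[w] = f.[w] * la.
  have /(congr1 (fun p => p.[w])) := deriv_weighted_poly a m.
  rewrite !hornerM crit_poly_log_deriv // horner_prod.
  under eq_bigr do rewrite hornerXsubC.
  have W0 : \prod_(i < s) (w - a i) != 0.
    by apply/prodf_neq0 => k _; rewrite subr_eq0.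
  by rewrite mulrCA [LHS]mulrC => /(mulfI W0).
have c0 : 0 < complex.Re (u / la).
  have := ReV_gt0 (Re_log_deriv_gt0 out); by rewrite invfM invrK.
have la0 : la != 0 by apply: contraTneq c0 => ->; rewrite invr0 mulr0 ltxx.
have [C C0 HC] := poly_taylor1 f w.
have f'w0 : f^`().[w] != 0 by rewrite f'w mulf_neq0.
pose C1 := C / normc f^`().[w].
have C10 : 0 <= C1 by rewrite divr_ge0 ?normc_ge0.
(* As f'(w) = f(w) la, raising the value from f(w) to (1 + e) f(w) moves the point by e / la up to a
   quadratic error. *)
have step e d : normc d <= 1 -> f.[w + d] = (1 + e)%:C%C * f.[w] ->
    normc (e%:C%C / la - d) <= C1 * normc d ^+ 2.
  move=> d1 fe; have := HC d d1; rewrite fe rmorphD rmorph1 mulrDl mul1r [f.[w] + _]addrC addrK.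
  have -> : e%:C%C * f.[w] - f^`().[w] * d = f^`().[w] * (e%:C%C / la - d).
    by rewrite f'w; field.
  by rewrite Normc.normcM /C1 mulrAC ler_pdivlMr ?normc_gt0 // mulrC.
pose c := complex.Re (u / la).
pose A := C1 * (2 * normc la^-1) ^+ 2 * normc u.
have A0 : 0 <= A.
  apply: mulr_ge0 (normc_ge0 _); apply: mulr_ge0 => //.
  by rewrite exprn_ge0 // mulr_ge0 ?normc_ge0.
pose d := Num.min 1 (2 * C1 + 1)^-1.
have d0 : 0 < d by rewrite lt_min ltr01 invr_gt0; lra.
have [e1 e10 e1P] := lift_continuous M_gt0 L d0.
have t1 : 0 < 1 - t0 by lra.
(* The gain in Re(u zeta) is e c and the error at most e^2 A; e <= c / (A + 1) makes the gain win.
   The other two bounds keep v in [0, 1] and |dv| below d. *)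
pose e := Num.min (c / (A + 1)) (Num.min t0 e1).
have e0 : 0 < e by rewrite !lt_min divr_gt0 ?t0_gt0 // ltr_wpDl.
have [ec et ee] : [/\ e <= c / (A + 1), e <= t0 & e <= e1].
  by split; rewrite !ge_min lexx ?orbT.
(* Chosen so that 1 - v = (1 - t0) (1 + e), that is f(zeta v) = (1 + e) f(w). *)
pose v := t0 - (1 - t0) * e.
have te : 0 <= (1 - t0) * e <= e.
  by rewrite mulr_ge0 ?(ltW t1) ?(ltW e0) //= ler_piMl ?(ltW e0) //; lra.
have v01 : 0 <= v <= 1 by rewrite /v; lra.
pose dv := zeta v - w.
have dvd : normc dv < d.
  by apply: e1P => //; rewrite /v addrAC subrr add0r normrN ger0_norm; lra.
have dv1 : normc dv <= 1 by rewrite (le_trans (ltW dvd)) // ge_min lexx.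
have fv : f.[w + dv] = (1 + e)%:C%C * f.[w].
  rewrite subrKC zf // fw mulrA -rmorphM; congr (_%:C%C * _); rewrite /v; ring.
have st := step e dv dv1 fv.
(* By the choice of d the quadratic error is at most half of |dv|, whence |dv| <= 2 e / |la|. *)
have C1dv : C1 * normc dv ^+ 2 <= normc dv / 2.
  rewrite expr2 mulrA mulrC ler_wpM2l ?normc_ge0 //.
  have : normc dv <= (2 * C1 + 1)^-1.
    by rewrite (le_trans (ltW dvd)) // ge_min lexx orbT.
  have C2 : 0 < 2 * C1 + 1 by lra.
  rewrite -[X in _ <= X]mul1r ler_pdivlMr // => H.
  have := normc_ge0 dv; nra.
have nE : normc (e%:C%C / la) = e * normc la^-1.
  by rewrite Normc.normcM normc_real ger0_norm // ltW.
have dv_le : normc dv <= e * (2 * normc la^-1).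
  have := le_normcD (e%:C%C / la) (- (e%:C%C / la - dv)).
  rewrite normcN nE (_ : _ + - _ = dv); last by ring.
  lra.
have Xv : complex.Re (u * dv) <= 0.
  by have := t0max v v01; rewrite /X /dv mulrBr ReD ReN -/w; lra.
have Ec : e * c = complex.Re (u * (e%:C%C / la - dv)) + complex.Re (u * dv).
  by rewrite -ReD -mulrDr subrK mulrCA [RHS]ReM /= mul0r subr0.
have Hc : e * c <= e * (e * A).
  rewrite Ec -[leRHS]addr0 lerD //.
  apply: le_trans (ler_norm _) _; apply: le_trans (normRe_le _) _.
  rewrite Normc.normcM; apply: le_trans (ler_wpM2l (normc_ge0 _) st) _.
  have := ler_pXn2r (isT : (0 < 2)%N); move=> /(_ R (normc dv) (e * (2 * normc la^-1))).
  rewrite !nnegrE normc_ge0 !mulr_ge0 ?normc_ge0 ?(ltW e0) // dv_le => /(_ isT isT) H.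
  have H2 := ler_wpM2l (normc_ge0 u) (ler_wpM2l C10 H).
  by apply: le_trans H2 _; rewrite /A le_eqVlt; apply/orP; left; apply/eqP; ring.
have cA : c <= e * A by move: Hc; rewrite ler_pM2l.
move: ec; rewrite ler_pdivlMr; last by rewrite ltr_wpDl.
rewrite mulrDr mulr1; lra.
Qed.

End Lifts.
End Hull.

(** * Variation of a real function by counting level crossings *)

Section Variation.
Variable R : realType.

Lemma sum_measure_le d (T : measurableType d) (mu : {measure set T -> \bar R})
    (I J : Type) (s : seq I) (t : seq J) (A : I -> set T) (B : J -> set T) :
  (forall i, measurable (A i)) -> (forall j, measurable (B j)) ->
  (forall x, \sum_(i <- s) (\1_(A i) x : R) <= \sum_(j <- t) (\1_(B j) x : R)) ->
  (\sum_(i <- s) mu (A i) <= \sum_(j <- t) mu (B j))%E.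
Proof.
move=> mA mB AB.
have E (K : Type) (r : seq K) (C : K -> set T) : (forall k, measurable (C k)) ->
    (\sum_(k <- r) mu (C k) = \int[mu]_x (\sum_(k <- r) (\1_(C k) x : R))%:E)%E.
  move=> mC; under eq_integral do rewrite -sumEFin.
  rewrite ge0_integral_sum //.
  - by apply: eq_bigr => k _; rewrite integral_indic // setIT.
  - by move=> k; apply/measurable_EFinP; exact: measurable_indic.
rewrite !E //; apply: ge0_le_integral => //.
- by move=> x _; rewrite lee_fin sumr_ge0.
- by apply/measurable_EFinP; apply: measurable_sum => i; exact: measurable_indic.
- by apply/measurable_EFinP; apply: measurable_sum => i; exact: measurable_indic.
- by move=> x _; rewrite lee_fin.
Qed.

(** The Banach indicatrix: the sum on the left is the integral over c of the number of i with c
    strictly between X(ts i) and X(ts (i+1)). Each such i gives a time strictly inside the i-th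
    interval where X = c; these times are distinct, so there are at most K of them unless c = c0. *)
Lemma variation_le (ts : nat -> R) (X : R -> R) (n K : nat) (lo hi c0 : R) :
  continuous X -> (forall i, ts i <= ts i.+1) -> lo <= hi ->
  (forall i, (i <= n)%N -> lo <= X (ts i) <= hi) ->
  (forall c, c != c0 -> forall us : seq R, uniq us ->
    (forall u, u \in us -> ts 0%N <= u <= ts n /\ X u = c) -> (size us <= K)%N) ->
  \sum_(i < n) `|X (ts i.+1) - X (ts i)| <= K%:R * (hi - lo).
Proof.
move=> cX tsS lohi Xb few.
have ts_mono i j : (i <= j)%N -> ts i <= ts j.
  elim: j => [|j IH]; first by rewrite leqn0 => /eqP ->.
  by rewrite leq_eqVlt => /predU1P[-> //|/IH /le_trans]; apply.
pose A (i : 'I_n) : set R :=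
  [set` `]Num.min (X (ts i)) (X (ts i.+1)), Num.max (X (ts i)) (X (ts i.+1))[].
(* K copies of [lo, hi], and n null sets that absorb the exceptional level. *)
pose B (j : 'I_K + 'I_n) : set R := if j is inl _ then `[lo, hi]%classic else [set c0].
suff key : (\sum_(i < n) @lebesgue_measure R (A i) <=
            \sum_(j : 'I_K + 'I_n) @lebesgue_measure R (B j))%E.
  have mA i : (lebesgue_measure (A i) = `|X (ts i.+1) - X (ts i)|%:E)%E.
    rewrite /A lebesgue_measure_itv /= lte_fin.
    rewrite lt_max !gt_min !ltxx /= orbF.
    case: (ltgtP (X (ts i)) (X (ts i.+1))) => H.
    - by rewrite orbT /= -EFinB gtr0_norm // subr_gt0.
    - by rewrite /= -EFinB ltr0_norm ?subr_lt0 // opprB.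
    - by rewrite H ?ltxx /= subrr normr0.
  have mB1 : (lebesgue_measure (`[lo, hi]%classic : set R) = (hi - lo)%:E)%E.
    rewrite lebesgue_measure_itv /= lte_fin; case: ltP => //.
    by move=> H; rewrite (@le_anti _ _ lo hi) ?lohi ?H // subrr.
  move: key; have -> : (\sum_(j : 'I_K + 'I_n) lebesgue_measure (B j) = (K%:R * (hi - lo))%:E)%E.
    rewrite big_sumType /= [X in (_ + X)%E]big1 ?adde0 => [|i _]; last first.
      exact: lebesgue_measure_set1.
    under eq_bigr do rewrite mB1.
    by rewrite sumEFin sumr_const card_ord mulr_natl.
  by under eq_bigr do rewrite mA; rewrite sumEFin lee_fin.
apply: sum_measure_le.
- by move=> i; exact: measurable_itv.
- by case=> j; [exact: measurable_itv|exact: measurable_set1].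
move=> c; rewrite big_sumType /=.
have indE (i : 'I_n) : (\1_(A i) c : R) = (c \in A i)%:R by rewrite indicE.
have [cc|cc] := eqVneq c c0.
  apply: ler_wpDl; first by rewrite sumr_ge0.
  apply: ler_sum => i _; rewrite !indicE.
  have -> : c \in [set c0] by rewrite cc inE.
  by rewrite ler_nat leq_b1.
have [cAll|nex] := pselect (exists i, A i c); last first.
  rewrite big1 => [|i _]; first by rewrite addr_ge0 // sumr_ge0.
  by rewrite indicE memNset // => Ac; apply: nex; exists i.
have cJ : `[lo, hi]%classic c.
  have [k] := cAll; rewrite /A /= !in_itv /=.
  have := Xb k (ltnW (ltn_ord k)); have := Xb k.+1 (ltn_ord k).
  by rewrite lt_max gt_min => /andP[? ?] /andP[? ?] /andP[/orP[] ? /orP[] ?];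
    apply/andP; split; lra.
apply: ler_wpDr; first by rewrite sumr_ge0.
under [leRHS]eq_bigr do rewrite indicE mem_set //.
rewrite sumr_const card_ord.
have tauP (i : 'I_n) : exists u, c \in A i -> [/\ ts i < u, u < ts i.+1 & X u = c].
  have [cAi|_] := boolP (c \in A i); last by exists 0.
  move: cAi => /set_mem.
  rewrite /A /= in_itv /= => /andP[c1 c2].
  have c12 : Num.min (X (ts i)) (X (ts i.+1)) <= c <= Num.max (X (ts i)) (X (ts i.+1)).
    by rewrite (ltW c1) (ltW c2).
  have [u] := IVT (tsS i) (continuous_subspaceT cX) c12.
  rewrite in_itv /= => /andP[u1 u2] Xu; exists u => _; split => //.
    rewrite lt_neqAle u1 andbT; apply/eqP => uE.
    by move: c1 c2; rewrite -Xu -uE lt_max gt_min !ltxx /=; lra.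
  rewrite lt_neqAle u2 andbT; apply/eqP => uE.
  by move: c1 c2; rewrite -Xu uE lt_max gt_min !ltxx ?orbF /=; lra.
have [tau tauE] := choice tauP.
pose us := [seq tau i | i <- enum 'I_n & c \in A i].
under eq_bigr do rewrite indicE.
rewrite -natr_sum ler_nat.
have -> : (\sum_(i < n) (c \in A i))%N = size us.
  rewrite size_map size_filter -sum1_count [RHS]big_mkcond big_enum /=.
  by apply: eq_bigr => i _; case: (c \in A i).
apply: (few c cc).
  rewrite map_inj_in_uniq ?filter_uniq -?enumT ?enum_uniq //.
  have H (i j : 'I_n) : c \in A i -> c \in A j -> tau i = tau j -> ~~ (i < j)%N.
    move=> ci cj tij; apply/negP => ij; have [_ t1 _] := tauE i ci.
    have [t2 _ _] := tauE j cj; have := ts_mono _ _ ij; rewrite tij in t1; lra.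
  move=> i j; rewrite !mem_filter => /andP[ci _] /andP[cj _] tij.
  by apply/val_inj/eqP; rewrite eqn_leq leqNgt (H _ _ cj ci (esym tij)) leqNgt (H _ _ ci cj tij).
move=> u /(@mapP _ _ _ _ _)[k]; rewrite mem_filter => /andP[ci _] ->.
have [t1 t2 ->] := tauE k ci; split => //.
have := ts_mono 0%N k (leq0n _); have := ts_mono k.+1 n (ltn_ord k); lra.
Qed.

End Variation.

(** * Length of lifts *)

Section LiftLength.
Variable R : realType.

Section Monic.
Variables (f : {poly R[i]}) (M : nat).
Hypotheses (f_monic : f \is monic) (size_f : size f = M.+1) (M_gt0 : (0 < M)%N).

(* Along a lift f(zeta) / f(z) is real, so the lift meets the line Re (u y) = c in
   zeros of a real polynomial of degree at most M; its two leading coefficients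
   vanish only when the line passes through the centroid of the roots. *)
Lemma lift_line_few z x zeta (u : R[i]) : is_lift f M z x zeta -> f.[z] != 0 -> u != 0 ->
  exists c0 : R, forall c : R, c != c0 -> forall ts : seq R, uniq ts ->
    (forall t, t \in ts -> 0 <= t <= 1 /\ complex.Re (u * zeta t) = c) ->
    (size ts <= M)%N.
Proof.
move=> [_ _ zf _] fz u0.
have [rs rsM rsE] := poly_sub_roots f_monic size_f M_gt0 0.
rewrite subr0 in rsE.
exists (complex.Re (u * \sum_(r <- rs) r) / M%:R) => c cc ts uts tsP.
pose ii : R[i] := 'i%C.
have ii2 : ii * ii = -1 by rewrite -expr2 sqr_i.
have ii0 : ii != 0 by apply/eqP => ii0; move: ii2; rewrite ii0 mul0r => /eqP;
  rewrite eq_sym oppr_eq0 oner_eq0.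
(* The line is parametrized by y = (c + i e) / u with e real; [rho r] is the complex parameter of
   the root r. *)
pose rho r := - ii * (u * r - c%:C%C).
pose G := \prod_(y <- map rho rs) ('X - y%:P).
pose ka := (ii / u) ^+ M * conjc f.[z].
have sG : size G = M.+1 by rewrite size_prod_XsubC size_map rsM.
have fG (e : R) : f.[(c%:C%C + ii * e%:C%C) / u] = (ii / u) ^+ M * G.[e%:C%C].
  have -> : (ii / u) ^+ M = \prod_(r <- rs) (ii / u).
    by rewrite big_const_seq count_predT iter_mulr_1 rsM.
  rewrite rsE /G !horner_prod big_map -big_split /=; apply: eq_bigr => r _.
  rewrite !hornerXsubC /rho mulNr opprK.
  have -> : ii / u * (e%:C%C + ii * (u * r - c%:C%C)) =
    (ii * e%:C%C + (ii * ii) * (u * r - c%:C%C)) / u by ring.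
  by rewrite ii2; field.
have ka0 : ka != 0.
  by rewrite mulf_neq0 ?expf_neq0 ?mulf_neq0 ?invr_eq0 // conjc_eq0.
(* On the line, [q] is Im(conj(f(z)) f(y)), which vanishes wherever f(y) / f(z) is real. *)
pose q : {poly R} := \poly_(j < M.+1) complex.Im (ka * G`_j).
have qE (e : R) : q.[e] = complex.Im (ka * G.[e%:C%C]).
  rewrite horner_poly (horner_coef_wide _ (_ : size G <= M.+1)%N) ?sG // mulr_sumr.
  rewrite (big_morph (@complex.Im R) (@ImD R) (erefl _)); apply: eq_bigr => j _.
  by rewrite mulrA -rmorphXn [RHS]ImM /= mulr0 add0r.
(* If the top coefficient vanishes, [ka] is real and nonzero; if the next one vanishes too, the
   [rho r] have imaginary parts of sum 0, which means c = c0. *)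
have q0 : q != 0.
  apply: contraNneq cc => q0.
  have Im0 : complex.Im ka = 0.
    have := congr1 (fun p : {poly R} => p`_M) q0; rewrite coef0 coef_poly ltnSn.
    have := monicP (monic_prod_XsubC (map rho rs) xpredT id).
    rewrite -/G lead_coefE sG /= => ->.
    by rewrite mulr1.
  have := congr1 (fun p : {poly R} => p`_M.-1) q0; rewrite coef0 coef_poly.
  rewrite prednK // ltnW ?ltnSn //.
  have -> : G`_M.-1 = - \sum_(y <- map rho rs) y.
    by rewrite -rsM -(size_map rho) coefPn_prod_XsubC // size_map rsM -lt0n.
  rewrite mulrN ImN ImM Im0 mul0r addr0 => /eqP; rewrite oppr_eq0 mulf_eq0.
  have Re0 : complex.Re ka != 0.
    by apply: contraNneq ka0 => R0; rewrite eq_complex R0 Im0 !eqxx.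
  rewrite (negbTE Re0) /= big_map (big_morph (@complex.Im R) (@ImD R) (erefl _)).
  under eq_bigr do rewrite /rho mulNr ImN ImM /= mul0r mul1r add0r ReD ReN /=.
  rewrite sumrN oppr_eq0 big_split /= sumrN big_const_seq count_predT iter_addr_0 rsM.
  rewrite mulr_sumr Re_sum subr_eq0 => /eqP ->.
  by rewrite -[c *+ M]mulr_natr mulfK // pnatr_eq0 -lt0n.
have tq t : t \in ts -> root q (complex.Im (u * zeta t)) /\
    (c%:C%C + ii * (complex.Im (u * zeta t))%:C%C) / u = zeta t.
  move=> /tsP[t01 tc].
  have E : (c%:C%C + ii * (complex.Im (u * zeta t))%:C%C) / u = zeta t.
    by rewrite -tc -complexE mulrAC mulfV // mul1r.
  split => //; rewrite /root qE /ka mulrAC -fG E zf //.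
  by rewrite -mulrA ImM /= ; case: (f.[z]) => p q'; rewrite /=; apply/eqP; ring.
suff : (size [seq complex.Im (u * zeta t)%R | t <- ts] < size q)%N.
  rewrite size_map => /leq_trans/(_ (size_poly _ _)); by rewrite ltnS.
apply: max_poly_roots => //.
  by apply/allP => y /mapP[t /tq[rt _] ->].
(* A point of the line is determined by Im(u y), and the time by the point, since f(zeta t) = (1 -
   t) f(z). *)
rewrite map_inj_in_uniq // => t t' tts t'ts tt'.
have [_ E] := tq t tts; have [_ E'] := tq t' t'ts.
have zz : zeta t = zeta t' by rewrite -E -E' tt'.
have [t01 _] := tsP t tts; have [t'01 _] := tsP t' t'ts.
have := zf t t01; rewrite zz zf // => /(mulIf fz)/(fmorph_inj (real_complex R)).
lra.
Qed.

End Monic.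

Section Length.
Variables (s : nat) (a : 'I_s -> R[i]) (m : 'I_s -> nat) (D : R).
Hypothesis M_gt0 : (0 < weight_sum m)%N.
Hypothesis diam : forall k l, normc (a k - a l) <= D.

Local Notation f := (weighted_poly a m).
Local Notation M := (weight_sum m).
Local Notation f_monic := (weighted_poly_monic a m).
Local Notation size_f := (size_weighted_poly a m).

Lemma lift_variation z x zeta (u : R[i]) (n : nat) : f.[z] != 0 -> in_hull a z ->
  is_lift f M z x zeta -> normc u = 1 -> (0 < n)%N ->
  \sum_(i < n) `|complex.Re (u * (zeta (i.+1%:R / n%:R) - zeta (i%:R / n%:R)))|
    <= M%:R * D.
Proof.
move=> fz hz L u1 n0.
have u0 : u != 0 by rewrite -normc_gt0 u1.
have [c0 c0P] := lift_line_few f_monic size_f M_gt0 L fz u0.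
have hull := lift_in_hull M_gt0 fz hz L.
pose X t := complex.Re (u * zeta t).
have cX : continuous (X \o @clamp R).
  apply: continuous_clamp => d d0; have [e e0 eP] := lift_continuous M_gt0 L d0.
  exists e => // v w v01 w01 vw; rewrite /X -ReN -ReD -mulrN -mulrDr.
  apply: le_lt_trans (normRe_le _) _; rewrite Normc.normcM u1 mul1r.
  exact: eP.
have n0' : 0 < n%:R :> R by rewrite ltr0n.
pose ts (i : nat) : R := i%:R / n%:R.
have ts01 i : (i <= n)%N -> 0 <= ts i <= 1.
  by move=> ni; rewrite /ts divr_ge0 //= ler_pdivrMr // mul1r ler_nat.
have [lo [hi [hilo lohi Xb]]] : exists lo hi : R, [/\ hi - lo = D, lo <= hi &
    forall t, 0 <= t <= 1 -> lo <= X t <= hi].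
  have z01 : 0 <= (0 : R) <= 1 by rewrite lexx ler01.
  have [k kmax] : exists k : 'I_s, forall l, complex.Re (u * a l) <= complex.Re (u * a k).
    have [k0 _] := hull 0 z01 1.
    pose k := [arg max_(k > k0) complex.Re (u * a k)]%O.
    exists k => l; rewrite /k; case: arg_maxP => // i _; exact.
  exists (complex.Re (u * a k) - D), (complex.Re (u * a k)); split.
  - by rewrite opprB addrC subrK.
  - by rewrite lerBlDr lerDl (le_trans _ (diam k k)) ?normc_ge0.
  move=> t t01; rewrite /X; have [l tl] := hull t t01 u.
  have := in_hull_width diam u1 (in_hull_point a k) (hull t t01).
  by have := kmax l; lra.
rewrite -hilo.
have := @variation_le R ts (X \o @clamp R) n M lo hi c0 cX _ lohi _ _.
have -> : \sum_(i < n) `|(X \o @clamp R) (ts i.+1) - (X \o @clamp R) (ts i)| =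
    \sum_(i < n) `|complex.Re (u * (zeta (i.+1%:R / n%:R) - zeta (i%:R / n%:R)))|.
  apply: eq_bigr => i _ /=; rewrite !clampK ?ts01 //; last exact: ltnW.
  by rewrite /X mulrBr ReD ReN.
apply.
- by move=> i; rewrite /ts ler_pM2r ?invr_gt0 // ler_nat.
- by move=> i ni; rewrite /= clampK ?ts01 // Xb // ts01.
move=> c cc us uus usP; apply: (c0P c cc us uus) => t /usP.
rewrite {1}/ts mul0r /ts divff ?gt_eqF // => -[t01] /=.
by rewrite clampK.
Qed.

(** The directions u = 1 and u = -i give the real and imaginary parts, each of variation at most M
    D; hence the factor 2. *)
Lemma lift_length z x zeta (n : nat) : f.[z] != 0 -> in_hull a z ->
  is_lift f M z x zeta -> (0 < n)%N ->
  \sum_(i < n) normc (zeta (i.+1%:R / n%:R) - zeta (i%:R / n%:R)) <= 2 * (M%:R * D).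
Proof.
move=> fz hz L n0.
have Re1 : normc (1 : R[i]) = 1 := Normc.normc1 _.
have Imi : normc (- 'i%C : R[i]) = 1.
  by rewrite normcN /= expr0n expr1n add0r sqrtr1.
have := lift_variation fz hz L Re1 n0; have := lift_variation fz hz L Imi n0.
move=> H1 H2; have := lerD H1 H2; rewrite -big_split /= => H.
have -> : 2 * (M%:R * D) = M%:R * D + M%:R * D by ring.
apply: le_trans H; apply: ler_sum => i _; rewrite mul1r.
apply: le_trans (normc_le_ReIm _) _; rewrite [leLHS]addrC lerD2r.
by rewrite mulNr ReN ReM /= mul0r mul1r sub0r opprK.
Qed.

End Length.
End LiftLength.

(** * Integrals *)

Section Integral.
Variable R : realType.
Implicit Types (z w p d : R[i]) (g Q : {poly R[i]}).

Definition Re_poly Q : {poly R} := \poly_(j < size Q) complex.Re Q`_j.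

Lemma coef_Re_poly Q j : (Re_poly Q)`_j = complex.Re Q`_j.
Proof. by rewrite coef_poly; case: ltnP => // /leq_sizeP ->. Qed.

Lemma horner_Re_poly Q (t : R) : (Re_poly Q).[t] = complex.Re Q.[t%:C%C].
Proof.
rewrite horner_poly horner_coef Re_sum; apply: eq_bigr => j _.
by rewrite -rmorphXn ReM /= mulr0 subr0.
Qed.

Lemma is_derive_Re_horner Q (t : R) :
  is_derive t 1 (fun t : R => complex.Re Q.[t%:C%C]) (complex.Re Q^`().[t%:C%C]).
Proof.
have -> : (fun t : R => complex.Re Q.[t%:C%C]) = horner (Re_poly Q).
  by apply/funext => x; rewrite horner_Re_poly.
have -> : complex.Re Q^`().[t%:C%C] = (horner (Re_poly Q))^`()%classic t.
  rewrite -derivE -horner_Re_poly; congr (_.[_]); apply/polyP => j.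
  rewrite coef_Re_poly !coef_deriv coef_Re_poly.
  by rewrite -mulr_natr -(rmorph_nat (real_complex R)) ReM /= mulr0 subr0 mulr_natr.
rewrite derive1E; apply/derivableP; exact: derivable_horner.
Qed.

Lemma is_derive_expR_trig (al be d1 d2 t : R) :
  is_derive t 1 (fun t : R => expR (al - t * d1) * cos (be - t * d2))
    (- d1 * (expR (al - t * d1) * cos (be - t * d2)) +
      d2 * (expR (al - t * d1) * sin (be - t * d2))) /\
  is_derive t 1 (fun t : R => expR (al - t * d1) * sin (be - t * d2))
    (- d1 * (expR (al - t * d1) * sin (be - t * d2)) -
      d2 * (expR (al - t * d1) * cos (be - t * d2))).
Proof.
have lin (c e : R) : is_derive t 1 (fun t : R => c - t * e) (- e).
  have -> : (fun t : R => c - t * e) = cst c - (fun t : R => t * e).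
    by apply/funext.
  have h : is_derive t 1 (fun t : R => t * e) e.
    have -> : (fun t : R => t * e) = e *: (id : R -> R).
      by apply/funext => x /=; rewrite mulrC.
    by apply: is_derive_eq; rewrite /= -[_ *: _]/(_ * _) mulr1.
  by apply: is_derive_eq; rewrite sub0r.
have ex : is_derive t 1 (fun t : R => expR (al - t * d1)) (- d1 * expR (al - t * d1)).
  by have := @is_derive1_comp R expR _ t _ _ (is_derive_expR _) (lin al d1); rewrite mulrC.
have co : is_derive t 1 (fun t : R => cos (be - t * d2)) (d2 * sin (be - t * d2)).
  have := @is_derive1_comp R cos _ t _ _ (is_derive_cos _) (lin be d2).
  by rewrite mulrNN mulrC.
have si : is_derive t 1 (fun t : R => sin (be - t * d2)) (- d2 * cos (be - t * d2)).
  by have := @is_derive1_comp R sin _ t _ _ (is_derive_sin _) (lin be d2); rewrite mulrC.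
split.
  apply: is_derive_eq (is_deriveM ex co) _.
  by rewrite -![_ *: _]/(_ * _); ring.
apply: is_derive_eq (is_deriveM ex si) _.
by rewrite -![_ *: _]/(_ * _); ring.
Qed.

(** The factor [w] reduces complex increments to real ones: 1 and -i give the real and imaginary
    parts in [segment_integral_prim], the conjugate of an increment gives its modulus in
    [normc_prim_le]. *)
Lemma is_derive_Re_horner_cexp w b p d Q (t : R) :
  is_derive t 1
    (fun t : R => complex.Re (w * (Q.[p + t%:C%C * d] * cexp (b - (p + t%:C%C * d)))))
    (complex.Re (w * ((Q^`() - Q).[p + t%:C%C * d] * cexp (b - (p + t%:C%C * d)) * d))).
Proof.
have [S SE S'E] : exists2 S : {poly R[i]}, forall x : R, S.[x%:C%C] = w * Q.[p + x%:C%C * d] &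
    forall x : R, S^`().[x%:C%C] = w * Q^`().[p + x%:C%C * d] * d.
  exists (w%:P * (Q \Po (p%:P + 'X * d%:P))) => x.
    by rewrite hornerM hornerC horner_comp hornerD hornerC hornerM hornerX hornerC.
  rewrite derivM derivC mul0r add0r deriv_comp derivD derivC add0r derivM derivX.
  rewrite derivC mul1r mulr0 addr0 !hornerM !hornerC horner_comp hornerD hornerC.
  by rewrite hornerM hornerX hornerC mulrA.
pose al := complex.Re (b - p); pose be := complex.Im (b - p).
have [dc ds] := is_derive_expR_trig al be (complex.Re d) (complex.Im d) t.
have d1 := is_derive_Re_horner S t.
have d2 := is_derive_Re_horner ((- 'i%C)%:P * S) t.
have cE (x : R) : cexp (b - (p + x%:C%C * d)) =
    Complex (expR (al - x * complex.Re d) * cos (be - x * complex.Im d))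
            (expR (al - x * complex.Re d) * sin (be - x * complex.Im d)).
  have E1 : complex.Re (b - (p + x%:C%C * d)) = al - x * complex.Re d.
    by rewrite /al; case: (b) (p) (d) => [? ?] [? ?] [? ?] /=; ring.
  have E2 : complex.Im (b - (p + x%:C%C * d)) = be - x * complex.Im d.
    by rewrite /be; case: (b) (p) (d) => [? ?] [? ?] [? ?] /=; ring.
  by rewrite /cexp E1 E2.
have -> : (fun t : R => complex.Re (w * (Q.[p + t%:C%C * d] * cexp (b - (p + t%:C%C * d)))))
  = (fun t : R => complex.Re S.[t%:C%C]) *
    (fun t : R => expR (al - t * complex.Re d) * cos (be - t * complex.Im d)) -
    (fun t : R => complex.Re ((- 'i%C)%:P * S).[t%:C%C]) *
    (fun t : R => expR (al - t * complex.Re d) * sin (be - t * complex.Im d)).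
  apply/funext => x; rewrite cE mulrA -SE !fctE hornerM hornerC.
  by move: (S.[x%:C%C]) => [s1 s2] /=; ring.
apply: is_derive_eq (is_deriveB (is_deriveM d1 dc) (is_deriveM d2 ds)) _.
rewrite -![_ *: _]/(_ * _) cE.
rewrite derivM derivC mul0r add0r !hornerM !hornerC S'E SE hornerD hornerN.
set c := expR _ * cos _; set e := expR _ * sin _.
move: (Q.[p + t%:C%C * d]) (Q^`().[p + t%:C%C * d]) => q q'.
case: w q q' d {S SE S'E dc ds d1 d2 cE} @c @e => [w1 w2] [q1 q2] [q'1 q'2] [d1 d2] /=.
by move: (expR _ * cos _) (expR _ * sin _) => c e; ring.
Qed.

(** Induction on the degree: if H' - H = g', then Q = H - g works. *)
Lemma exists_antiderivative g : exists Q, Q^`() - Q = g.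
Proof.
have [n] := ubnP (size g); elim: n g => // n IH g; rewrite ltnS => gn.
have [->|g0] := eqVneq g 0; first by exists 0; rewrite deriv0 subr0.
have [H HE] := IH g^`() (leq_trans (lt_size_deriv g0) gn).
exists (H - g); rewrite derivB -[in RHS](addr0 g) -(subrr g^`()) -{1}HE; ring.
Qed.

Section Primitive.
Variables (g Q : {poly R[i]}) (b : R[i]).
Hypothesis QE : Q^`() - Q = g.

Let prim z := Q.[z] * cexp (b - z).
Let F w p d (t : R) := complex.Re (w * prim (p + t%:C%C * d)).
Let F' w p d (t : R) :=
  complex.Re (w * (g.[p + t%:C%C * d] * cexp (b - (p + t%:C%C * d)) * d)).

Let is_derive_F w p d (t : R) : is_derive t 1 (F w p d) (F' w p d t).
Proof. by rewrite /F' -QE; exact: is_derive_Re_horner_cexp. Qed.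

Let continuous_of_is_derive (X X' : R -> R) :
  (forall t : R, is_derive t 1 X (X' t)) -> continuous X.
Proof.
move=> H t; apply: differentiable_continuous; apply/derivable1_diffP.
exact: (@ex_derive _ _ _ _ _ _ _ (H t)).
Qed.

Let continuous_F w p d : continuous (F w p d).
Proof. exact: continuous_of_is_derive (is_derive_F w p d). Qed.

Let continuous_F' w p d : continuous (F' w p d).
Proof.
have -> : F' w p d = fun t : R => complex.Re ((w * d) *
    (g.[p + t%:C%C * d] * cexp (b - (p + t%:C%C * d)))).
  by apply/funext => t; rewrite /F'; congr complex.Re; ring.
exact: continuous_of_is_derive (is_derive_Re_horner_cexp (w * d) b p d g).
Qed.

(** The integral depends on its end points only, which allows the segment to be exchanged for two
    lifts from a critical point. *)
Lemma segment_integral_prim p q :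
  segment_integral p q (fun z => g.[z] * cexp (b - z)) = prim q - prim p.
Proof.
have RI w : Rintegral lebesgue_measure `[0, 1] (F' w p (q - p)) =
    complex.Re (w * (prim q - prim p)).
  rewrite /Rintegral (@continuous_FTC2 _ _ (F w p (q - p))) //; first last.
  - by move=> t _; rewrite derive1E; exact: (@derive_val _ _ _ _ _ _ _ (is_derive_F w p (q - p) t)).
  - split.
    + by move=> t _; exact: (@ex_derive _ _ _ _ _ _ _ (is_derive_F w p (q - p) t)).
    + by apply: cvg_at_right_filter; exact: continuous_F.
    + by apply: cvg_at_left_filter; exact: continuous_F.
  - by apply: continuous_subspaceT; exact: continuous_F'.
  rewrite -EFinB /= /F rmorph1 rmorph0 mul1r mul0r addr0 subrKC.
  by rewrite mulrBr ReD ReN.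
apply/eqP; rewrite eq_complex /segment_integral /cintegral01 /=.
have -> : (fun t : R => complex.Re (g.[p + t%:C%C * (q - p)] *
    cexp (b - (p + t%:C%C * (q - p))) * (q - p))) = F' 1 p (q - p).
  by apply/funext => t; rewrite /F' mul1r.
have -> : (fun t : R => complex.Im (g.[p + t%:C%C * (q - p)] *
    cexp (b - (p + t%:C%C * (q - p))) * (q - p))) = F' (- 'i%C) p (q - p).
  by apply/funext => t; rewrite /F' mulNr ReN ReM /= mul0r mul1r sub0r opprK.
rewrite !RI mul1r eqxx /=.
by rewrite mulNr ReN [complex.Re ('i%C * _)]ReM /= mul0r mul1r sub0r opprK.
Qed.

(** The mean value theorem holds for real functions only; multiplying by the conjugate of the
    increment and taking real parts turns the increment into its squared modulus. *)
Lemma normc_prim_le p q (K : R) :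
  (forall t : R, 0 <= t <= 1 -> normc (g.[p + t%:C%C * (q - p)] *
     cexp (b - (p + t%:C%C * (q - p)))) <= K) ->
  normc (prim q - prim p) <= K * normc (q - p).
Proof.
move=> gK; set w := conjc (prim q - prim p).
have [c c01 cE] := MVT_segment ler01 (fun (t : R) _ => is_derive_F w p (q - p) t)
  (continuous_subspaceT (@continuous_F w p (q - p))).
rewrite in_itv /= in c01.
have Nw : normc w = normc (prim q - prim p).
  by rewrite /w; case: (prim q - prim p) => x y /=; rewrite sqrrN.
have E : F w p (q - p) 1 - F w p (q - p) 0 = normc (prim q - prim p) ^+ 2.
  rewrite /F rmorph1 rmorph0 mul1r mul0r addr0 subrKC -ReN -ReD -mulrBr /w.
  case: (prim q - prim p) => x y /=; rewrite sqr_sqrtr ?addr_ge0 ?sqr_ge0 //.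
  by rewrite mulNr opprK -!expr2.
have : normc (prim q - prim p) ^+ 2 <=
    normc (prim q - prim p) * (K * normc (q - p)).
  rewrite -E cE subr0 mulr1 /F'; apply: le_trans (ler_norm _) _.
  apply: le_trans (normRe_le _) _; rewrite !Normc.normcM Nw.
  rewrite ler_wpM2l ?normc_ge0 // ler_wpM2r ?normc_ge0 //.
  by rewrite -Normc.normcM gK.
have [z0|z0] := eqVneq (normc (prim q - prim p)) 0.
  rewrite z0 => _; rewrite mulr_ge0 ?normc_ge0 //.
  by apply: le_trans (gK 0 _); [exact: normc_ge0|rewrite lexx ler01].
by rewrite expr2 ler_pM2l // lt0r z0 normc_ge0.
Qed.

End Primitive.
End Integral.

(** * Increment of the primitive along a link *)

Section EdgeBound.
Variables (R : realType) (s : nat) (a : 'I_s -> R[i]) (m : 'I_s -> nat) (D : R).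
Hypotheses (M_gt0 : (0 < weight_sum m)%N).
Hypothesis diam : forall k l, normc (a k - a l) <= D.

Local Notation f := (weighted_poly a m).
Local Notation M := (weight_sum m).

Variables (g Q : {poly R[i]}) (l : 'I_s) (B : R).
Hypotheses (QE : Q^`() - Q = g) (B_ge0 : 0 <= B).
Hypothesis gB : forall z, in_hull a z -> normc g.[z] <= B * normc f.[z].

Let prim z := Q.[z] * cexp (a l - z).

Let D_ge0 : 0 <= D.
Proof. by apply: le_trans (diam l l); exact: normc_ge0. Qed.

(** The lift is replaced by an inscribed polygon. Its chords stay in the hull by convexity, its
    length is bounded independently of the mesh, and for a fine mesh |f| exceeds |f(z)| on it by at
    most e, which is arbitrary. *)
Lemma lift_prim_le z x zeta : f.[z] != 0 -> in_hull a z -> is_lift f M z x zeta ->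
  normc (prim x - prim z) <= expR D * B * normc f.[z] * (2 * (M%:R * D)).
Proof.
move=> fz hz L; have [z0 z1 zf _] := L.
have hull := lift_in_hull M_gt0 fz hz L.
have [Lf Lf0 HLf] := poly_lipschitz f (normc (a l) + D).
have hullB y : in_hull a y -> normc y <= normc (a l) + D.
  move=> hy; rewrite -(subrKC (a l) y) (le_trans (le_normcD _ _)) // lerD2l.
  exact: in_hull_dist.
have C0 : 0 <= expR D * B * (2 * (M%:R * D)).
  by rewrite !mulr_ge0 ?expR_ge0.
apply: (ler_addM_eps C0) => e e0 _.
have Lf1 : 0 < Lf + 1 by rewrite ltr_wpDl.
have [d d0 dP] := lift_continuous M_gt0 L (divr_gt0 e0 Lf1).
have [n0 n0P] := exists_invrS_lt d0; pose n := n0.+1.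
have n_gt0 : 0 < n%:R :> R by rewrite ltr0n.
have n01 i : (i <= n)%N -> 0 <= (i%:R / n%:R : R) <= 1.
  by move=> ni; rewrite divr_ge0 //= ler_pdivrMr // mul1r ler_nat.
pose pt (i : nat) := zeta (i%:R / n%:R).
have -> : prim x - prim z = \sum_(i < n) (prim (pt i.+1) - prim (pt i)).
  rewrite -(big_mkord xpredT (fun i => prim (pt i.+1) - prim (pt i))).
  rewrite telescope_sumr // /pt mul0r divff ?gt_eqF // z0 z1 //.
apply: le_trans (le_normc_sum _ _ _) _.
apply: le_trans (_ : \sum_(i < n) expR D * B * (normc f.[z] + e) *
    normc (pt i.+1 - pt i) <= _); last first.
  rewrite -mulr_sumr; apply: le_trans (_ : expR D * B * (normc f.[z] + e) *
      (2 * (M%:R * D)) <= _).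
    rewrite ler_wpM2l ?mulr_ge0 ?expR_ge0 ?addr_ge0 ?normc_ge0 ?(ltW e0) //.
    exact: (lift_length M_gt0 diam fz hz L (isT : (0 < n)%N)).
  by rewrite le_eqVlt; apply/orP; left; apply/eqP; ring.
apply: ler_sum => i _.
have i01 := n01 i (ltnW (ltn_ord i)); have i'01 := n01 i.+1 (ltn_ord i).
apply: (normc_prim_le QE) => t t01.
set y := pt i + t%:C%C * (pt i.+1 - pt i).
have hy : in_hull a y by apply: in_hull_convex => //; apply: hull.
have ptd : normc (pt i.+1 - pt i) < e / (Lf + 1).
  apply: dP => //; rewrite -mulrBl -natr1 addrAC subrr add0r mul1r ger0_norm ?invr_ge0 //.
  by apply/ltW/n0P.
have fpt : normc f.[pt i] <= normc f.[z].
  rewrite /pt zf // Normc.normcM normc_real ler_piMl ?normc_ge0 //.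
  by move: i01; move: (i%:R / n%:R) => q; rewrite ler_norml; lra.
have yd : normc (y - pt i) <= e / (Lf + 1).
  rewrite /y addrAC subrr add0r Normc.normcM normc_real (le_trans _ (ltW ptd)) //.
  by rewrite ler_piMl ?normc_ge0 // ger0_norm; lra.
have fy : normc f.[y] <= normc f.[z] + e.
  rewrite -(subrKC f.[pt i] f.[y]) (le_trans (le_normcD _ _)) // lerD //.
  apply: le_trans (HLf _ _ (hullB _ hy) (hullB _ (hull _ i01))) _.
  apply: le_trans (ler_wpM2l Lf0 yd) _.
  by rewrite mulrCA ler_piMr ?(ltW e0) // ler_pdivrMr // mul1r lerDl.
rewrite Normc.normcM mulrC -mulrA; apply: ler_pM; rewrite ?normc_ge0 //.
  apply: le_trans (normc_cexp_le _) _; rewrite ler_expR normcBC.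
  exact: in_hull_dist.
by apply: le_trans (gB hy) _; rewrite ler_wpM2l.
Qed.

Lemma reach_prim_le b i j : f.[b] != 0 -> in_hull a b -> reach a m b i -> reach a m b j ->
  normc (prim (a j) - prim (a i)) <= expR D * B * normc f.[b] * (4 * (M%:R * D)).
Proof.
move=> fb hb.
have H k : reach a m b k ->
    normc (prim (a k) - prim b) <= expR D * B * normc f.[b] * (2 * (M%:R * D)).
  move=> /asboolP[[zeta L]|->]; first exact: lift_prim_le L.
  by rewrite subrr Normc.normc0 !mulr_ge0 ?expR_ge0 ?normc_ge0.
move=> /H Hi /H Hj; apply: le_trans (le_normc_dist _ (prim b) _) _.
rewrite (normcBC (prim b)).
have -> : expR D * B * normc f.[b] * (4 * (M%:R * D)) =
  expR D * B * normc f.[b] * (2 * (M%:R * D)) + expR D * B * normc f.[b] * (2 * (M%:R * D)).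
  by ring.
exact: lerD.
Qed.

End EdgeBound.

(** * Volumes *)

Section Shear.
Context d1 d2 (T : measurableType d1) (U : measurableType d2) (R : realType).
Variables (m : {sigma_finite_measure set T -> \bar R}).
Variables (nu : {sigma_finite_measure set U -> \bar R}).
Variable add : T -> T -> T.
Hypothesis add_measurable : measurable_fun setT (fun p : T * T => add p.1 p.2).
Hypothesis add_invariant : forall A c, measurable A -> m [set y | A (add y c)] = m A.

Let shear (h : U -> T) (p : T * U) := (add p.1 (h p.2), p.2).

Let measurable_shear (h : U -> T) (A : set (T * U)) :
  measurable_fun setT h -> measurable A -> measurable (shear h @^-1` A).
Proof.
move=> mh mA.
have m2 := measurableT_comp mh (@measurable_snd _ _ T U).
have m12 := measurable_fun_pair (@measurable_fst _ _ T U) m2.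
have mPhi : measurable_fun setT (shear h).
  by apply: measurable_fun_pair (measurableT_comp add_measurable m12) _;
    exact: measurable_snd.
by rewrite -[X in measurable X]setTI; exact: mPhi.
Qed.

Let shear_section (h : U -> T) (A : set (T * U)) y :
  xsection (shear h @^-1` A) y = [set t | A (add y (h t), t)].
Proof. by apply/seteqP; split => t /xsectionP. Qed.

Lemma measurable_shear_section (h : U -> T) (A : set (T * U)) y :
  measurable_fun setT h -> measurable A -> measurable [set t | A (add y (h t), t)].
Proof.
by move=> mh mA; rewrite -shear_section; apply: measurable_xsection;
  exact: measurable_shear.
Qed.

Lemma measurable_fun_shear_section (h : U -> T) (A : set (T * U)) :
  measurable_fun setT h -> measurable A ->
  measurable_fun setT (fun y => nu [set t | A (add y (h t), t)]).
Proof.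
move=> mh mA; have := measurable_fun_xsection nu (measurable_shear mh mA).
by congr measurable_fun; apply/funext => y; rewrite -(shear_section h A y).
Qed.

(** Two orders of integration of the sheared set: for fixed t the shear translates the section of A,
    which preserves [m]; for fixed y the section is the one on the right. *)
Lemma product_measure_shear (h : U -> T) (A : set (T * U)) :
  measurable_fun setT h -> measurable A ->
  (m \x nu)%E A = (\int[m]_y nu [set t | A (add y (h t), t)])%E.
Proof.
move=> mh mA; have mPA := measurable_shear mh mA.
have E B : measurable B -> (m \x nu)%E B = (m \x^ nu)%E B.
  by move=> mB; apply: product_measure_unique => // *; exact: product_measure2E.
have -> : (\int[m]_y nu [set t | A (add y (h t), t)] = (m \x nu)%E (shear h @^-1` A))%E.
  by apply: eq_integral => y _; rewrite -(shear_section h A y).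
rewrite !E //; apply: eq_integral => t _ /=.
have -> : ysection (shear h @^-1` A) t = [set y | ysection A t (add y (h t))].
  by apply/seteqP; split => y /=; rewrite /ysection /= !inE.
by rewrite add_invariant //; exact: measurable_ysection.
Qed.

End Shear.

Section TupleVolume.
Context d (T : measurableType d) (R : realType).
Variable mu : {sigma_finite_measure set T -> \bar R}.
Variables (add sub : T -> T -> T).
Hypothesis add_measurable : measurable_fun setT (fun p : T * T => add p.1 p.2).
Hypothesis sub_measurable : measurable_fun setT (fun p : T * T => sub p.1 p.2).
Hypothesis addK : forall y c, sub (add y c) c = y.
Hypothesis add_invariant : forall A c, measurable A -> mu [set y | A (add y c)] = mu A.

Lemma measurable_triangular_set s (c : 'I_s -> s.-tuple T -> T) (B : 'I_s -> set T) :
  (forall i, measurable_fun setT (c i)) -> (forall i, measurable (B i)) ->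
  measurable [set x : s.-tuple T | forall i, B i (sub (tnth x i) (c i x))].
Proof.
move=> mc mB.
have -> : [set x : s.-tuple T | forall i, B i (sub (tnth x i) (c i x))] =
    \bigcap_(i in [set: 'I_s]) [set x | B i (sub (tnth x i) (c i x))].
  by apply/seteqP; split => x /= H i; [move=> _; exact: H|exact: H i I].
apply: fin_bigcap_measurable => // i _.
have mf : measurable_fun setT (fun x : s.-tuple T => sub (tnth x i) (c i x)).
  exact: (measurableT_comp sub_measurable (measurable_fun_pair (measurable_tnth i) (mc i))).
by rewrite -[X in measurable X]setTI; exact: (mf measurableT _ (mB i)).
Qed.

(* The coordinates are constrained in the order given by rk, each by a translate
   of B_i depending on the previous ones. The shear x_0 -> x_0 + c_0 removes the
   first coordinate, whatever its position in that order. *)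
Lemma tuple_measure_triangular_le s (rk : 'I_s -> nat)
    (c : 'I_s -> s.-tuple T -> T) (B : 'I_s -> set T) :
  (forall i, measurable_fun setT (c i)) -> (forall i, measurable (B i)) ->
  (forall i x y, (forall j, (rk j < rk i)%N -> tnth x j = tnth y j) -> c i x = c i y) ->
  (tuple_measure mu s [set x | forall i, B i (sub (tnth x i) (c i x))]
     <= \prod_(i < s) mu (B i))%E.
Proof.
elim: s rk c B => [|s IH] rk c B mc mB dep.
  rewrite big_ord0 /= diracE; case: (_ \in _) => //=; by rewrite lee_fin.
have mS := measurable_triangular_set mc mB.
set S := [set x | _] in mS *.
have mcons : measurable_fun setT (@cons_pair _ T s).
  by apply: measurable_cons; [exact: measurable_fst|exact: measurable_snd].
have mS' : measurable (@cons_pair _ T s @^-1` S).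
  by rewrite -[X in measurable X]setTI; exact: mcons.
have -> : tuple_measure mu s.+1 S = (mu \x tuple_measure mu s)%E (@cons_pair _ T s @^-1` S).
  by [].
pose pt : T := point.
pose h (t : s.-tuple T) := c ord0 (cons_pair (pt, t)).
have mh : measurable_fun setT h.
  have mp : measurable_fun setT (fun t : s.-tuple T => (pt, t)).
    by apply: measurable_fun_pair; [exact: measurable_cst|exact: measurable_id].
  exact: measurableT_comp (mc ord0) (measurableT_comp mcons mp).
(* [c ord0] depends only on coordinates of rank below [rk ord0], hence not on the first coordinate
   itself. *)
have c0E y t : c ord0 (cons_pair (y, t)) = h t.
  apply: (dep) => j; case: (unliftP ord0 j) => [k ->|->]; last by rewrite ltnn.
  by rewrite /cons_pair /= !(tnth_nth point).
rewrite (product_measure_shear _ add_measurable add_invariant mh mS').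
rewrite big_ord_recl muleC.
set K := (\prod_(i < s) _)%E.
have K0 : (0 <= K)%E by apply: prode_ge0 => i _; exact: measure_ge0.
have sec y : (tuple_measure mu s [set t | (@cons_pair _ T s @^-1` S) (add y (h t), t)]
    <= (cst K \_ (B ord0)) y)%E.
  rewrite patchE; case: ifPn => yB; last first.
    rewrite (_ : [set t | _] = set0) ?measure0 // -subset0 => t /= /(_ ord0).
    rewrite tnth0 c0E addK => yB'; move/negP: yB; apply; exact: mem_set.
  (* Substituting y + h(t) for the first coordinate keeps the system triangular: a coordinate that
     depends on it has rank above [rk ord0], hence above all those that h involves. *)
  pose c' i (t : s.-tuple T) := c (lift ord0 i) (cons_pair (add y (h t), t)).
  pose B' i := B (lift ord0 i).
  have mc' i : measurable_fun setT (c' i).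
    have mp : measurable_fun setT (fun t : s.-tuple T => (y, h t)).
      by apply: measurable_fun_pair; [exact: measurable_cst|exact: mh].
    have mq := measurable_fun_pair (measurableT_comp add_measurable mp)
      (@measurable_id _ (s.-tuple T) setT).
    exact: measurableT_comp (mc _) (measurableT_comp mcons mq).
  apply: le_trans (IH (fun i => rk (lift ord0 i)) c' B' mc' _ _).
  - apply: le_measure; rewrite ?inE.
    + exact: measurable_shear_section.
    + by apply: measurable_triangular_set => // i; exact: mB.
    + move=> t /= H i; have := H (lift ord0 i); rewrite /c' /B'.
      by rewrite tnthS.
  - by move=> i; exact: mB.
  move=> i x z H; apply: (dep) => j; case: (unliftP ord0 j) => [k ->|->] ij.
    rewrite /cons_pair !tnthS; exact: H.
  rewrite !tnth0; congr (add y _); apply: (dep) => k.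
  case: (unliftP ord0 k) => [l ->|->]; last by rewrite ltnn.
  by move=> lr; rewrite !tnthS; apply: H; exact: ltn_trans lr ij.
apply: le_trans (_ : (\int[mu]_y (cst K \_ (B ord0)) y)%E <= _)%E.
  apply: ge0_le_integral => //.
  - exact: measurable_fun_shear_section.
  - apply/(measurable_restrictT _ (mB ord0)); exact: measurable_cst.
by rewrite -integral_mkcond integral_cst //; exact: mB.
Qed.

End TupleVolume.

Section Completions.
Variable R : realType.

Lemma lebesgue_measure_translation (c : R) (A : set (measurableTypeR R)) :
  measurable A ->
  @lebesgue_measure R [set y : R | A (y + c)] = @lebesgue_measure R A.
Proof.
move=> mA; pose f (y : measurableTypeR R) : measurableTypeR R := (y : R) + c.
have mf : measurable_fun setT f.
  by apply: measurable_funD; [exact: measurable_id|exact: measurable_cst].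
rewrite -[LHS]/(pushforward (@lebesgue_measure R) f A).
apply/esym; apply: lebesgue_measure_unique => // X [[a b] _ <-] /=.
rewrite /pushforward /f.
have -> : (fun y : R => y + c) @^-1` `]a, b]%classic = `]a - c, b - c]%classic.
  by apply/seteqP; split => y /=; rewrite !in_itv /= ltrBlDr lerBrDr.
rewrite !lebesgue_measure_itv /= !lte_fin ltrD2r; case: ifP => // _.
by rewrite -!EFinB opprB addrA subrK.
Qed.

Let ball2 (B : R) : (`[- B, B]%classic : set R) = [set x | `|x| <= B].
Proof. by apply/seteqP; split => x /=; rewrite in_itv /= ler_norml. Qed.

Lemma lebesgue_measure_ball (B : R) : 0 <= B ->
  @lebesgue_measure R [set x : R | `|x| <= B] = (2 * B)%:E.
Proof.
move=> B0; rewrite -ball2 lebesgue_measure_itv /= lte_fin.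
case: ltP => [_|H]; first by rewrite -EFinB opprK mulrDl mul1r.
by have -> : B = 0 by [lra]; rewrite mulr0.
Qed.

(** * Bodies cut out by linear inequalities, for real and complex places alike *)

Section Generic.
Variable ac : arch_completion R.
Local Notation V := (ac_carrier ac).
Local Notation e := (@ac_embed R ac).
Local Notation mu := (ac_measure ac).
Variables (add sub : V -> V -> V) (ret : R[i] -> V) (L : set R[i]).
Hypothesis add_measurable : measurable_fun setT (fun p : V * V => add p.1 p.2).
Hypothesis sub_measurable : measurable_fun setT (fun p : V * V => sub p.1 p.2).
Hypothesis addK : forall y c, sub (add y c) c = y.
Hypothesis add_invariant : forall A c, measurable A -> mu [set y | A (add y c)] = mu A.
Hypothesis embed_sub : forall x y, e (sub x y) = e x - e y.
Hypothesis retK : forall x l, L l -> e (ret (e x * l)) = e x * l.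
Hypothesis ret_measurable : forall l, L l -> measurable_fun setT (fun x => ret (e x * l)).
Hypothesis norm_measurable : measurable_fun setT (fun x : V => normc (e x)).
Hypothesis ball_le : forall B : R, 0 <= B ->
  (mu [set x | (normc (e x) <= B)%R] <= ((2 * B) ^+ ac_degree ac)%:E)%E.

Lemma measurable_ball (B : R) : measurable [set x : V | normc (e x) <= B].
Proof.
have := norm_measurable measurableT (@measurable_itv R `]-oo, B]).
by rewrite setTI.
Qed.

(* Only the bound on x_r and those on x_i l_ij - x_j along a tree rooted at r are
   used. *)
Lemma linear_body_measure_le s (l : 'I_s -> 'I_s -> R[i]) (A : R) (b : 'I_s -> 'I_s -> R)
    (r : 'I_s) (rk : 'I_s -> nat) (par : 'I_s -> 'I_s) (B : 'I_s -> R) :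
  (forall i j, L (l i j)) -> 0 <= A -> (forall i, 0 <= B i) ->
  (forall i, i != r -> (rk (par i) < rk i)%N /\ b (par i) i <= B i) ->
  (tuple_measure mu s [set x | (forall i, (normc (e (tnth x i)) <= A)%R) /\
      forall i j, i != j -> (normc (e (tnth x i) * l i j - e (tnth x j)) <= b i j)%R]
   <= ((2 * A * \prod_(i | i != r) (2 * B i)) ^+ ac_degree ac)%:E)%E.
Proof.
move=> lL A0 B0 par_r.
(* The root is not translated: [sub point point] embeds as 0. *)
pose c (i : 'I_s) (x : s.-tuple V) : V :=
  if i == r then sub point point else ret (e (tnth x (par i)) * l (par i) i).
pose B' (i : 'I_s) : R := if i == r then A else B i.
pose Bl (i : 'I_s) : set V := [set v | normc (e v) <= B' i].
have B'0 i : 0 <= B' i by rewrite /B'; case: ifP.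
have mc i : measurable_fun setT (c i).
  rewrite /c; case: (i == r); first exact: measurable_cst.
  exact: measurableT_comp (ret_measurable (lL _ _)) (measurable_tnth _).
have mBl i : measurable (Bl i) by exact: measurable_ball.
have dep i x y : (forall j, (rk j < rk i)%N -> tnth x j = tnth y j) -> c i x = c i y.
  rewrite /c; case: ifPn => // ir H; rewrite H //; by have [] := par_r i ir.
have mlin i j : measurable [set x : s.-tuple V |
    normc (e (tnth x i) * l i j - e (tnth x j)) <= b i j].
  have m1 := measurableT_comp (ret_measurable (lL i j)) (@measurable_tnth _ V s i).
  have m2 := measurableT_comp sub_measurable
    (measurable_fun_pair m1 (@measurable_tnth _ V s j)).
  have := m2 measurableT _ (measurable_ball (b i j)); rewrite setTI; congr measurable.
  by apply/seteqP; split => x /=; rewrite embed_sub retK.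
have mcoord i : measurable [set x : s.-tuple V | normc (e (tnth x i)) <= A].
  by have := @measurable_tnth _ V s i measurableT _ (measurable_ball A); rewrite setTI.
set C := [set x | _]; have mC : measurable C.
  have -> : C = \bigcap_(i in [set: 'I_s]) [set x | normc (e (tnth x i)) <= A] `&`
      \bigcap_(p in [set p : 'I_s * 'I_s | p.1 != p.2])
        [set x : s.-tuple V | normc (e (tnth x p.1) * l p.1 p.2 - e (tnth x p.2)) <= b p.1 p.2].
    apply/seteqP; split => x /=.
      by move=> [H1 H2]; split => [i _|[i j] /= ij]; [exact: H1|exact: H2].
    by move=> [H1 H2]; split => [i|i j ij]; [exact: H1|exact: (H2 (i, j))].
  apply: measurableI; apply: fin_bigcap_measurable => //.
apply: le_trans (_ : tuple_measure mu s
  [set x | forall i, Bl i (sub (tnth x i) (c i x))] <= _)%E.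
  apply: le_measure; rewrite ?inE //.
    exact: measurable_triangular_set.
  move=> x [H1 H2] i; rewrite /Bl /B' /c /= embed_sub; case: ifPn => ir.
    by rewrite embed_sub subrr subr0.
  have [rkp bB] := par_r i ir; rewrite retK // normcBC; apply: le_trans bB; apply: H2.
  by apply: contraTneq rkp => ->; rewrite ltnn.
apply: le_trans (tuple_measure_triangular_le add_measurable sub_measurable addK
  add_invariant mc mBl dep) _.
apply: le_trans (_ : (((\prod_(i < s) (2 * B' i)) ^+ ac_degree ac)%R)%:E <= _)%E.
  rewrite -prodrXl.
  suff [] : (0 <= \prod_(i < s) mu (Bl i) <= (\prod_(i < s) (2 * B' i) ^+ ac_degree ac)%:E)%E /\
      0 <= \prod_(i < s) (2 * B' i) ^+ ac_degree ac by move=> /andP[].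
  elim/big_ind2: _ => [|x1 x2 y1 y2 [/andP[x10 x12] x20] [/andP[y10 y12] y20]|i _].
  - by rewrite lee_fin !ler01 lexx.
  - by rewrite mule_ge0 //= EFinM lee_pmul //= mulr_ge0.
  - by rewrite measure_ge0 /= ball_le // exprn_ge0 // mulr_ge0.
rewrite lee_fin (bigD1 r) //= /B' eqxx le_eqVlt; apply/orP; left; apply/eqP.
by congr ((_ * _) ^+ _); apply: eq_bigr => i /negbTE ->.
Qed.

End Generic.
End Completions.

(** * The real and the complex completion *)

Section Instances.
Variable R : realType.
Local Notation leb := (@lebesgue_measure R).
Local Notation RT := (measurableTypeR R).

Lemma real_body_measure_le s (l : 'I_s -> 'I_s -> R[i]) (A : R) (b : 'I_s -> 'I_s -> R)
    (r : 'I_s) (rk : 'I_s -> nat) (par : 'I_s -> 'I_s) (B : 'I_s -> R) :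
  (forall i j, complex.Im (l i j) = 0) -> 0 <= A -> (forall i, 0 <= B i) ->
  (forall i, i != r -> (rk (par i) < rk i)%N /\ b (par i) i <= B i) ->
  (tuple_measure (ac_measure (real_completion R)) s
    [set x : s.-tuple (ac_carrier (real_completion R)) |
      (forall i, (normc (ac_embed (tnth x i)) <= A)%R) /\
      forall i j, i != j ->
        (normc (ac_embed (tnth x i) * l i j - ac_embed (tnth x j)) <= b i j)%R]
   <= ((2 * A * \prod_(i | i != r) (2 * B i)) ^+ 1)%:E)%E.
Proof.
move=> lL A0 B0 par_r.
apply: (@linear_body_measure_le R (real_completion R)
  (fun x y : RT => (x : R) + y) (fun x y : RT => (x : R) - y) (@complex.Re R)
  [set l | complex.Im l = 0]) par_r => //.
- by apply: measurable_funD; [exact: measurable_fst|exact: measurable_snd].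
- by apply: measurable_funB; [exact: measurable_fst|exact: measurable_snd].
- by move=> y c; rewrite addrK.
- by move=> C c mC; exact: lebesgue_measure_translation.
- by move=> x y; rewrite /= rmorphB.
- move=> x z /= z0; case: z z0 => p q /= ->.
  by apply/eqP; rewrite eq_complex /= !mul0r subr0 mulr0 addr0 !eqxx.
- move=> z z0 /=.
  have -> : (fun x : R => complex.Re (x%:C%C * z)) = (fun x => x * complex.Re z).
    by apply/funext => x; rewrite ReM /= mul0r subr0.
  by apply: measurable_funM; [exact: measurable_id|exact: measurable_cst].
- have -> : (fun x : R => normc x%:C%C) = (fun x => `|x|).
    by apply/funext => x; rewrite normc_real.
  by apply: measurableT_comp; [exact: normr_measurable|exact: measurable_id].
- move=> C C0; have -> : [set x : R | normc x%:C%C <= C] = [set x | `|x| <= C].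
    by apply/seteqP; split => x; rewrite /mkset normc_real.
  by rewrite /= lebesgue_measure_ball // expr1.
Qed.

Let add2 (p q : RT * RT) : RT * RT := ((p.1 : R) + q.1, (p.2 : R) + q.2).
Let sub2 (p q : RT * RT) : RT * RT := ((p.1 : R) - q.1, (p.2 : R) - q.2).

Let fst_m : measurable_fun setT (fun p : (RT * RT) * (RT * RT) => p.1.1).
Proof. exact: measurableT_comp measurable_fst measurable_fst. Qed.
Let snd_m : measurable_fun setT (fun p : (RT * RT) * (RT * RT) => p.1.2).
Proof. exact: measurableT_comp measurable_snd measurable_fst. Qed.
Let fst_m' : measurable_fun setT (fun p : (RT * RT) * (RT * RT) => p.2.1).
Proof. exact: measurableT_comp measurable_fst measurable_snd. Qed.
Let snd_m' : measurable_fun setT (fun p : (RT * RT) * (RT * RT) => p.2.2).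
Proof. exact: measurableT_comp measurable_snd measurable_snd. Qed.

Let add2_measurable : measurable_fun setT (fun p : (RT * RT) * (RT * RT) => add2 p.1 p.2).
Proof. by apply: measurable_fun_pair; apply: measurable_funD. Qed.

Let sub2_measurable : measurable_fun setT (fun p : (RT * RT) * (RT * RT) => sub2 p.1 p.2).
Proof. by apply: measurable_fun_pair; apply: measurable_funB. Qed.

Let add2_invariant (A : set (RT * RT)) c : measurable A ->
  sf_product leb leb [set y | A (add2 y c)] = sf_product leb leb A.
Proof.
move=> mA; pose f (p : RT * RT) := add2 p c.
have mf : measurable_fun setT f.
  have mp : measurable_fun setT (fun p : RT * RT => (p, c)).
    by apply: measurable_fun_pair; [exact: measurable_id|exact: measurable_cst].
  exact: measurableT_comp add2_measurable mp.
rewrite -[LHS]/(pushforward (sf_product leb leb) f A).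
apply/esym; apply: product_measure_unique => // X Y mX mY.
rewrite -[LHS]/(sf_product leb leb
  ([set x : RT | X ((x : R) + c.1)] `*` [set y : RT | Y ((y : R) + c.2)])).
have mt (Z : set RT) (d : R) : measurable Z -> measurable [set x : RT | Z ((x : R) + d)].
  move=> mZ; rewrite -[X in measurable X]setTI.
  have mg : measurable_fun setT (fun x : RT => (x : R) + d).
    by apply: measurable_funD; [exact: measurable_id|exact: measurable_cst].
  exact: mg.
rewrite /sf_product product_measure1E; [|exact: mt..].
by congr (_ * _)%E; apply: lebesgue_measure_translation.
Qed.

Lemma complex_body_measure_le s (l : 'I_s -> 'I_s -> R[i]) (A : R) (b : 'I_s -> 'I_s -> R)
    (r : 'I_s) (rk : 'I_s -> nat) (par : 'I_s -> 'I_s) (B : 'I_s -> R) :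
  0 <= A -> (forall i, 0 <= B i) ->
  (forall i, i != r -> (rk (par i) < rk i)%N /\ b (par i) i <= B i) ->
  (tuple_measure (ac_measure (complex_completion R)) s
    [set x : s.-tuple (ac_carrier (complex_completion R)) |
      (forall i, (normc (ac_embed (tnth x i)) <= A)%R) /\
      forall i j, i != j ->
        (normc (ac_embed (tnth x i) * l i j - ac_embed (tnth x j)) <= b i j)%R]
   <= ((2 * A * \prod_(i | i != r) (2 * B i)) ^+ 2)%:E)%E.
Proof.
move=> A0 B0 par_r.
have nm : measurable_fun setT (fun p : RT * RT => normc (Complex (p.1 : R) p.2)).
  apply: (measurableT_comp (f := @Num.sqrt R)).
    by apply: continuous_measurable_fun; exact: sqrt_continuous.
  by apply: measurable_funD; apply: measurable_funX;
    [exact: measurable_fst|exact: measurable_snd].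
apply: (@linear_body_measure_le R (complex_completion R) add2 sub2
  (fun z => (complex.Re z, complex.Im z)) setT) par_r => //.
- by move=> [y1 y2] [c1 c2]; rewrite /sub2 /add2 /= !addrK.
- by move=> x z _ /=; case: (_ * _).
- move=> z _ /=; apply: measurable_fun_pair.
    have -> : (fun x : RT * RT => complex.Re (Complex (x.1 : R) x.2 * z)) =
        (fun x => (x.1 : R) * complex.Re z - (x.2 : R) * complex.Im z).
      by apply/funext => x; rewrite ReM.
    by apply: measurable_funB; apply: measurable_funM; try exact: measurable_cst;
      [exact: measurable_fst|exact: measurable_snd].
  have -> : (fun x : RT * RT => complex.Im (Complex (x.1 : R) x.2 * z)) =
      (fun x => (x.1 : R) * complex.Im z + (x.2 : R) * complex.Re z).
    by apply/funext => x; rewrite ImM.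
  by apply: measurable_funD; apply: measurable_funM; try exact: measurable_cst;
    [exact: measurable_fst|exact: measurable_snd].
move=> C C0.
(* The disc is enclosed in the square of side 2 C, whose area is the square of the length 2 C found
   at a real place; both kinds of place thus give the same bound after the root of order d_v. *)
pose I := [set x : RT | (`|x : R| <= C)%R].
have mI : measurable I.
  have := @normr_measurable R setT measurableT _ (@measurable_itv R `]-oo, C]).
  by rewrite setTI.
apply: le_trans (_ : sf_product leb leb (I `*` I) <= _)%E.
  apply: le_measure; rewrite ?inE.
  - have := nm measurableT _ (@measurable_itv R `]-oo, C]).
    by rewrite setTI.
  - exact: measurableX.
  - move=> [x y] /= xy; split; rewrite /I /=.
      exact: le_trans (normRe_le (Complex x y)) xy.
    exact: le_trans (normIm_le (Complex x y)) xy.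
have lI : leb I = (2 * C)%:E := lebesgue_measure_ball C0.
have E : (leb \x leb)%E (I `*` I) = ((2 * C)%:E * (2 * C)%:E)%E.
  by apply: etrans (product_measure1E _ _ mI mI) _; congr (_ * _)%E; exact: lI.
rewrite /= expr2 EFinM le_eqVlt; apply/orP; left; apply/eqP; exact: E.
Qed.

Variables (K : fieldExtType rat) (sigma : {rmorphism K -> R[i]}).

Lemma d_v_cases : d_v sigma = 1%N \/ d_v sigma = 2%N.
Proof. by rewrite /d_v /completion; case: asboolP; [left|right]. Qed.

Lemma mu_v_body_le s (l : 'I_s -> 'I_s -> R[i]) (A : R) (b : 'I_s -> 'I_s -> R)
    (r : 'I_s) (rk : 'I_s -> nat) (par : 'I_s -> 'I_s) (B : 'I_s -> R) :
  (real_place sigma -> forall i j, complex.Im (l i j) = 0) -> 0 <= A -> (forall i, 0 <= B i) ->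
  (forall i, i != r -> (rk (par i) < rk i)%N /\ b (par i) i <= B i) ->
  (mu_v sigma s [set x : s.-tuple (K_v sigma) |
      (forall i, (normc (of_K_v (tnth x i)) <= A)%R) /\
      forall i j, i != j ->
        (normc (of_K_v (tnth x i) * l i j - of_K_v (tnth x j)) <= b i j)%R]
   <= ((2 * A * \prod_(i | i != r) (2 * B i)) ^+ d_v sigma)%:E)%E.
Proof.
move=> lreal A0 B0 par_r; rewrite /mu_v /of_K_v /d_v /K_v /completion.
case: asboolP => rp.
  by apply: real_body_measure_le par_r => //; exact: lreal.
exact: complex_body_measure_le par_r.
Qed.

End Instances.

(** * The bound *)

Section Factorials.

(** A single term of the binomial expansion of (a + b)^(a + b) is at most the whole. *)
Lemma fact_expn_le a b :
  ((a + b)`! * (a ^ a * b ^ b) <= (a + b) ^ (a + b) * (a`! * b`!))%N.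
Proof.
have bS : (b < (a + b).+1)%N by rewrite ltnS leq_addl.
have := bin_fact (leq_addl a b); rewrite addnK => <-.
rewrite [(b`! * _)%N]mulnC mulnAC leq_mul2r; apply/orP; right.
by rewrite expnDn (bigD1 (Ordinal bS)) //= addnK leq_addr.
Qed.

(* A multinomial probability is at most 1. *)
Lemma fact_sum_expn_le (I : Type) (s : seq I) (m : I -> nat) :
  ((\sum_(i <- s) m i)`! * \prod_(i <- s) m i ^ m i <=
   (\sum_(i <- s) m i) ^ (\sum_(i <- s) m i) * \prod_(i <- s) (m i)`!)%N.
Proof.
elim: s => [|i s IH]; first by rewrite !big_nil.
rewrite !big_cons; set S := (\sum_(j <- s) m j)%N in IH *.
set P := (\prod_(j <- s) _)%N in IH *; set F := (\prod_(j <- s) _)%N in IH *.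
(* The factor by which the case of two terms and the induction hypothesis overlap; it is positive
   for S = 0 as well, since 0^0 = 1. *)
have SS : (0 < S ^ S * S`!)%N.
  by rewrite muln_gt0 fact_gt0 expn_gt0 andbT; case: (S) => //=.
rewrite -(leq_pmul2r SS).
have := leq_mul (fact_expn_le (m i) S) IH.
have -> : ((m i + S)`! * (m i ^ m i * S ^ S) * (S`! * P) =
  (m i + S)`! * (m i ^ m i * P) * (S ^ S * S`!))%N by ring.
move/leq_trans; apply; rewrite leq_eqVlt; apply/orP; left; apply/eqP; ring.
Qed.

(** Used for t = s - 1, where M + t + 1 = N. *)
Lemma fact_addn_le M t : ((M + t)`! <= (M + t).+1 ^ t * M`!)%N.
Proof.
elim: t => [|t IH]; first by rewrite addn0 expn0 mul1n.
rewrite addnS factS expnS -mulnA leq_mul // (leq_trans IH) // leq_mul2r.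
apply/orP; right; have [->//|t0] := posnP t.
by rewrite leq_exp2r // leqnSn.
Qed.

End Factorials.

(** * The tree of integral bounds and the comparison with Delta_n *)

Section Main.
Variables (R : realType) (K : fieldExtType rat) (sigma : {rmorphism K -> R[i]}).
Variables (s : nat) (alpha : 'I_s -> K) (n : 'I_s -> nat).
Hypotheses (s_gt0 : (0 < s)%N) (alpha_inj : injective alpha).
Hypothesis n_gt0 : forall i, (0 < n i)%N.

Local Notation a := (fun i => sigma (alpha i)).
Local Notation m := (fun i => (n i).-1).
Local Notation M := (weight_sum m).
Local Notation D := (R_v sigma alpha).
Local Notation N := (\sum_(i < s) n i)%N.
Local Notation f := (weighted_poly a m).

Let a_inj : injective a.
Proof. by move=> i j /(fmorph_inj sigma)/alpha_inj. Qed.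

Let diam k l : normc (a k - a l) <= D.
Proof.
rewrite -rmorphB -/(abs_v sigma _) /R_v.
apply: le_trans (le_bigmax _ (fun k => \big[Num.max/0]_(l < s) abs_v sigma (alpha k - alpha l)) k).
exact: (le_bigmax _ (fun l => abs_v sigma (alpha k - alpha l))).
Qed.

Let D_ge0 : 0 <= D.
Proof. by apply: le_trans (diam (Ordinal s_gt0) (Ordinal s_gt0)); exact: normc_ge0. Qed.

Let sum_n : N = (M + s)%N.
Proof.
rewrite /weight_sum -[X in (_ + X)%N]card_ord -sum1_card -big_split /=.
by apply: eq_bigr => i _; rewrite addn1 prednK.
Qed.

Let sub_poly k : {poly R[i]} := map_poly sigma (f_poly alpha (sub_basis n k)).

Let horner_sub_poly k z :
  (sub_poly k).[z] = f.[z] * \prod_(l < s | l != k) (z - a l).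
Proof.
rewrite /sub_poly /f_poly rmorph_prod horner_prod horner_weighted_poly.
rewrite [X in _ = _ * X]big_mkcond -big_split /=; apply: eq_bigr => l _.
rewrite rmorphXn /= map_polyXsubC !hornerE /sub_basis.
have -> : (n l - (l == k) = (n l).-1 + (l != k))%N.
  by have := n_gt0 l; case: (l == k) => /=; lia.
by rewrite exprD; case: (l != k).
Qed.

Let sub_poly_le k z : in_hull a z -> normc (sub_poly k).[z] <= D ^+ s.-1 * normc f.[z].
Proof.
move=> hz; rewrite horner_sub_poly Normc.normcM mulrC ler_wpM2r ?normc_ge0 //.
rewrite normc_prod; have -> : s.-1 = #|predC1 k| by rewrite cardC1 card_ord.
rewrite -prodr_const; apply: ler_prod => l _.
by rewrite normc_ge0; exact: (in_hull_dist diam l hz).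
Qed.

Let exp_integral_le (B : R) i j : 0 <= B ->
  (forall k Q, Q^`() - Q = sub_poly k ->
    normc (Q.[a j] * cexp (a j - a j) - Q.[a i] * cexp (a j - a i)) <= B) ->
  \big[Num.max/0]_(k < s) normc (exp_integral sigma alpha n i j k) <= B.
Proof.
move=> B0 H; apply/bigmax_leP; split => // k _.
have [Q QE] := exists_antiderivative (sub_poly k).
by rewrite /exp_integral (segment_integral_prim (a j) QE); exact: H QE.
Qed.

(** A link costs e^D D^(s-1) |f(b)| times twice the length 2 M D of a lift; 4 M is relaxed to 2 pi
    N, the shape found in [c_v]. *)
Let kappa : R := expR D * D ^+ s * (2 * pi * N%:R).

(** By [prod_crit_values], the product of |f(b)| over the roots b of P when M > 0; its value is 1
    when M = 0. *)
Let weights_prod : R :=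
  \prod_(k < s) (((m k)%:R / M%:R) ^+ m k * \prod_(l < s | l != k) normc (a k - a l) ^+ m k).

Let D_expS : D ^+ s = D ^+ s.-1 * D.
Proof. by rewrite -exprSr prednK. Qed.

Let N_gt0 : (0 < N)%N.
Proof. by rewrite sum_n addn_gt0 s_gt0 orbT. Qed.

Let kappa_ge0 : 0 <= kappa.
Proof. by rewrite /kappa !mulr_ge0 ?expR_ge0 ?exprn_ge0 ?pi_ge0. Qed.

Lemma integral_tree (r : 'I_s) :
  exists (rk : 'I_s -> nat) (par : 'I_s -> 'I_s) (wt : 'I_s -> R),
    [/\ forall x, 0 <= wt x, forall x, x != r -> (rk (par x) < rk x)%N,
      forall x, x != r ->
        \big[Num.max/0]_(k < s) normc (exp_integral sigma alpha n (par x) x k) <= kappa * wt x &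
      \prod_(x | x != r) wt x = weights_prod].
Proof.
(* For M = 0 one has f = 1 and P = 0, so there are no critical points to use. A star at r with
   weights 1 works, each segment being estimated directly inside the hull. *)
have [M0|M_gt0] := posnP M.
  have m0 k : m k = 0%N.
    by move/eqP: M0; rewrite sum_nat_eq0 => /forallP/(_ k)/eqP.
  exists (fun x => (x != r)), (fun=> r), (fun=> 1); split => //.
  - by move=> x xr; rewrite eqxx xr.
  - move=> x xr; rewrite mulr1; apply: exp_integral_le => // k Q QE.
    apply: le_trans (normc_prim_le (b := a x) (p := a r) (q := a x)
      (K := D ^+ s.-1 * expR D) QE _) _.
      move=> t t01; set y := a r + _.
      have hy : in_hull a y by apply: in_hull_convex => //; exact: in_hull_point.
      rewrite Normc.normcM; apply: ler_pM; rewrite ?normc_ge0 //.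
        apply: le_trans (sub_poly_le k hy) _.
        rewrite horner_weighted_poly big1 ?Normc.normc1 ?mulr1 // => l _.
        by rewrite m0.
      apply: le_trans (normc_cexp_le _) _; rewrite ler_expR normcBC.
      exact: (in_hull_dist diam x hy).
    apply: le_trans (ler_wpM2l _ (diam x r)) _.
      by rewrite mulr_ge0 ?expR_ge0 ?exprn_ge0.
    rewrite mulrAC -D_expS mulrC /kappa ler_peMr ?mulr_ge0 ?expR_ge0 ?exprn_ge0 //.
    have := pi_ge2 R; have : 1 <= N%:R :> R by rewrite ler1n.
    move: (N%:R) => x1 x2 x3; nra.
  - by rewrite big1 // /weights_prod big1 // => k _; rewrite m0 expr0 mul1r big1.
have [bs size_bs bsE] := crit_roots a M_gt0.
have [rk [par [lab [rkP labP labE]]]] := crit_tree a_inj M_gt0 size_bs bsE r.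
exists rk, par, (fun x => normc f.[lab x]); split => //; last 1 first.
- by rewrite labE (prod_crit_values M_gt0 bsE).
- by move=> x; exact: normc_ge0.
move=> x xr; have [lbs lx lpar] := labP x xr.
apply: exp_integral_le; first by rewrite mulr_ge0 ?normc_ge0.
move=> k Q QE.
have fl : f.[lab x] != 0 by apply: (crit_value_neq0 a_inj M_gt0 bsE).
have hl : in_hull a (lab x).
  by apply: (crit_in_hull M_gt0); apply/eqP; rewrite (crit_poly_root M_gt0 bsE).
have DB : 0 <= D ^+ s.-1 by rewrite exprn_ge0.
apply: le_trans (reach_prim_le M_gt0 diam x QE DB (@sub_poly_le k) fl hl lpar lx) _.
rewrite /kappa D_expS.
have MN : M%:R <= N%:R :> R by rewrite ler_nat sum_n leq_addr.
have pi2 := pi_ge2 R.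
have E1 : expR D * D ^+ s.-1 * normc f.[lab x] * (4 * (M%:R * D)) =
  (expR D * D ^+ s.-1 * D * normc f.[lab x]) * (4 * M%:R) by ring.
have E2 : expR D * (D ^+ s.-1 * D) * (2 * pi * N%:R) * normc f.[lab x] =
  (expR D * D ^+ s.-1 * D * normc f.[lab x]) * (2 * pi * N%:R) by ring.
rewrite E1 E2 ler_wpM2l ?mulr_ge0 ?expR_ge0 ?normc_ge0 //.
apply: ler_pM => //; lra.
Qed.

(** Exchanging the two indices of the double product attaches the exponent n_k to the outer index,
    as in [weights_prod]; writing n_k = 1 + m_k then splits off Delta_1. *)
Lemma abs_Delta : abs_v sigma (Delta alpha n) = abs_v sigma (Delta alpha (fun=> 1%N)) *
  (\prod_(k < s) (m k)`!%:R * \prod_(k < s) \prod_(l < s | l != k) normc (a k - a l) ^+ m k).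
Proof.
have E (n' : 'I_s -> nat) : abs_v sigma (Delta alpha n') =
    \prod_(k < s) ((n' k).-1)`!%:R * \prod_(k < s) \prod_(l < s | l != k) normc (a k - a l) ^+ n' k.
  rewrite /abs_v /Delta rmorph_prod normc_prod.
  under eq_bigr do rewrite rmorphM rmorph_nat Normc.normcM normc_nat rmorph_prod normc_prod.
  rewrite big_split /=; congr (_ * _).
  rewrite (exchange_big_dep xpredT) //=; apply: eq_bigr => k _.
  apply: eq_big => [l|l _]; first by rewrite eq_sym.
  by rewrite rmorphXn normcX rmorphB normcBC.
rewrite !E /= [X in _ = X * _ * _]big1 ?mul1r // mulrCA; congr (_ * _).
rewrite -big_split /=; apply: eq_bigr => k _; rewrite -big_split /=.
by apply: eq_bigr => l _; rewrite -exprS prednK.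
Qed.

Lemma abs_Delta1_neq0 : abs_v sigma (Delta alpha (fun=> 1%N)) != 0.
Proof.
rewrite /abs_v normc_eq0 fmorph_eq0 /Delta; apply/prodf_neq0 => k _.
rewrite fact0 mul1r; apply/prodf_neq0 => l lk.
by rewrite expr1 subr_eq0 (inj_eq alpha_inj) eq_sym.
Qed.

Lemma fact_weights_prod_le : (N.-1)`!%:R * weights_prod <=
  N%:R ^+ (s - 1) *
  (\prod_(k < s) (m k)`!%:R * \prod_(k < s) \prod_(l < s | l != k) normc (a k - a l) ^+ m k).
Proof.
rewrite /weights_prod big_split /= !mulrA ler_wpM2r //.
  by rewrite prodr_ge0 // => k _; rewrite prodr_ge0 // => l _; rewrite exprn_ge0 ?normc_ge0.
have MM : 0 < (M ^ M)%:R :> R.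
  by rewrite ltr0n expn_gt0; case: (M) => //=.
have -> : \prod_(k < s) ((m k)%:R / M%:R) ^+ m k =
    (\prod_(k < s) m k ^ m k)%N%:R / (M ^ M)%:R :> R.
  under eq_bigr do rewrite expr_div_n.
  rewrite prodf_div prodrXr natr_prod natrX; congr (_ / _).
  by apply: eq_bigr => k _; rewrite natrX.
rewrite mulrA ler_pdivrMr // -natr_prod -natrX -!natrM ler_nat.
have NE : (N.-1 = M + (s - 1))%N by rewrite sum_n; lia.
have := fact_sum_expn_le (index_enum 'I_s) m; rewrite -/M => H1.
have := fact_addn_le M (s - 1); rewrite -NE prednK // => H2.
have := leq_mul H2 (leqnn (\prod_(k < s) m k ^ m k)); move/leq_trans; apply.
rewrite -!mulnA leq_mul2l; apply/orP; right.
by rewrite [(_ * M ^ M)%N]mulnC.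
Qed.

End Main.

Theorem theorem8p1 (R : realType) (K : fieldExtType rat)
    (sigma : {rmorphism K -> R[i]}) (s : nat) (s_gt0 : (0 < s)%N)
    (alpha : 'I_s -> K) (alpha_inj : injective alpha)
    (n : 'I_s -> nat) (n_gt0 : forall i, (0 < n i)%N) :
  (mu_v sigma s (C_set sigma alpha n) `^ ((d_v sigma)%:R^-1) <=
   (c_v sigma alpha * (\sum_(i < s) n i)%N%:R ^+ (2 * s - 2)
    * abs_v sigma (Delta alpha n))%:E)%E.
Proof.
pose r := Ordinal s_gt0; pose N := (\sum_(i < s) n i)%N.
pose D := R_v sigma alpha.
have [rk [par [wt [wt0 rkP intP wtE]]]] := integral_tree sigma s_gt0 alpha_inj n_gt0 r.
set kappa := (expR _ * _ * _) in intP.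
have D0 : 0 <= D by apply: bigmax_ge_id.
have kappa0 : 0 <= kappa by rewrite !mulr_ge0 ?expR_ge0 ?exprn_ge0 ?pi_ge0.
pose l i j := cexp (sigma (alpha j) - sigma (alpha i)).
have l_real : real_place sigma -> forall i j, complex.Im (l i j) = 0.
  by move=> rp i j; rewrite /l /cexp /= -rmorphB rp sin0 mulr0.
pose A : R := expR D * (N.-1)`!%:R.
have A0 : 0 <= A by rewrite mulr_ge0 ?expR_ge0.
pose b i j : R := \big[Num.max/0]_(k < s) normc (exp_integral sigma alpha n i j k).
have B0 i : 0 <= kappa * wt i by rewrite mulr_ge0.
have parP i : i != r -> (rk (par i) < rk i)%N /\ b (par i) i <= kappa * wt i.
  by move=> ir; split; [exact: rkP|exact: intP].
have := mu_v_body_le l_real A0 B0 parP.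
set Y := 2 * A * _; rewrite -[X in mu_v sigma s X]/(C_set sigma alpha n) => muY.
have Y0 : 0 <= Y by rewrite !mulr_ge0 // prodr_ge0 // => i _; rewrite mulr_ge0.
have YE : ((Y ^+ d_v sigma)%:E `^ (d_v sigma)%:R^-1)%E = Y%:E.
  rewrite poweR_EFin -powR_mulrn // -powRrM divff ?powRr1 //.
  by rewrite pnatr_eq0; case: (d_v_cases sigma) => ->.
apply: (@le_trans _ _ Y%:E).
  rewrite -YE; apply: gt0_ler_poweR; rewrite ?invr_ge0 // in_itv /= ?leey ?andbT.
    exact: measure_ge0.
  by rewrite lee_fin exprn_ge0.
(* The ball for x_r contributes 2 e^D (N-1)!, and each of the s - 1 edges contributes 2 kappa times
   its weight. *)
have YE' : Y = 2 ^+ s * expR D * kappa ^+ (s - 1) * ((N.-1)`!%:R * \prod_(i | i != r) wt i).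
  rewrite /Y /A.
  under eq_bigr do rewrite mulrA.
  rewrite big_split /= prodr_const cardC1 card_ord exprMn subn1.
  have -> : 2 ^+ s = 2 * 2 ^+ s.-1 :> R by rewrite -exprS prednK.
  by ring.
rewrite lee_fin YE' wtE (abs_Delta sigma alpha n_gt0) /c_v -/D.
have E1 : kappa ^+ (s - 1) =
    expR D ^+ (s - 1) * (2 * pi * D ^+ s) ^+ (s - 1) * N%:R ^+ (s - 1).
  rewrite -!exprMn; congr (_ ^+ _); rewrite /kappa; ring.
have E2 : expR (s%:R * D) = expR D * expR D ^+ (s - 1).
  by rewrite expRM_natl -exprS subn1 prednK.
(* One half is the power of N in kappa^(s-1), the other is the one in [fact_weights_prod_le]. *)
have E3 : N%:R ^+ (2 * s - 2) = N%:R ^+ (s - 1) * N%:R ^+ (s - 1) :> R.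
  by rewrite -exprD; congr (_ ^+ _); lia.
have XQ := fact_weights_prod_le sigma alpha s_gt0 n_gt0.
have D1 := abs_Delta1_neq0 sigma alpha_inj.
have aux (t e e1 u v d X Q : R) : d != 0 -> 0 <= t * e * (e1 * u * v) -> X <= v * Q ->
    t * e * (e1 * u * v) * X <= t * (e * e1) * u * d^-1 * (v * v) * (d * Q).
  move=> d0 w0 XvQ; apply: le_trans (ler_wpM2l w0 XvQ) _.
  by rewrite le_eqVlt; apply/orP; left; apply/eqP; field.
rewrite E1 E2 E3; apply: aux XQ => //.
by rewrite !mulr_ge0 ?exprn_ge0 ?expR_ge0 // !mulr_ge0 ?pi_ge0 // exprn_ge0.
Qed.
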